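(* Let $(X,\omega)$ be a strong symplectic cobordism from $(Y_-,\xi_-)$ to $(Y_+,\xi_+)$ and let $L\subset X$ be a Lagrangian cobordism from a Legendrian link $\Lambda_-\subset (Y_-,\xi_-)$ to a Legendrian link $\Lambda_+\subset(Y_+,\xi_+)$. Then there are Liouville vector fields $v_-$ defined near $Y_-$ and $v_+$ defined near $Y_+$ (as in the definition of a strong symplectic cobordism) that are tangent to $L$.
   Context: Let $(Y_\pm,\xi_\pm)$ be closed contact $3$-manifolds. A strong symplectic cobordism from $(Y_-,\xi_-)$ to $(Y_+,\xi_+)$ is a compact symplectic $4$-manifold $(X,\omega)$ with $\partial X=-Y_-\cup Y_+$, with $(Y_-,\xi_-)$ a (strongly) concave boundary component and $(Y_+,\xi_+)$ a (strongly) convex one: near $Y_\pm$ there is a Liouville vector field $v_\pm$ (i.e. $\mathcal{L}_{v_\pm}\omega=\omega$), transverse to $Y_\pm$, pointing into $X$ along $Y_-$ and out of $X$ along $Y_+$, such that $\iota_{v_\pm}\omega|_{Y_\pm}$ is a contact form for $\xi_\pm$. A Lagrangian cobordism from $\Lambda_-$ to $\Lambda_+$ is a Lagrangian surface $L$ in $X$ that is transverse to $\partial X$ and satisfies $\partial L=-\Lambda_-\cup\Lambda_+$; $L$ is not assumed to be a product near the boundary. *)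

(* Defs.v *)
From HB Require Import structures.
From mathcomp Require Export all_boot all_order all_algebra.
From mathcomp Require Export all_classical all_reals all_analysis.

Set Implicit Arguments.
Unset Strict Implicit.
Unset Printing Implicit Defensive.

Import Order.TTheory GRing.Theory Num.Theory.
Import numFieldNormedType.Exports.
Local Open Scope classical_set_scope.
Local Open Scope ring_scope.

(** * Calculus on the half-space [x_0 >= 0] *)

Section Calculus.
Context {R : realType}.

Definition halfspace n : set 'rV[R]_n :=
  [set x | forall k : 'I_n, val k = 0%N -> 0 <= x 0 k].

(* The directional derivative, with the increments restricted to those that
   stay in the half-space (at a boundary point, one-sided in directions
   transverse to the boundary).  For a function that extends smoothly across
   the boundary this is the derivative of any extension. *)
Definition hderive n (V : normedModType R) (f : 'rV[R]_n -> V)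
    (x v : 'rV[R]_n) : V :=
  lim ((fun t : R => t^-1 *: (f (x + t *: v) - f x))
         @ within [set t : R | halfspace (x + t *: v)] 0^').

Fixpoint Ck (k : nat) n (V : normedModType R) (U : set 'rV[R]_n)
    (f : 'rV[R]_n -> V) : Prop :=
  (forall x, U x -> {for x, continuous f}) /\
  if k is k'.+1 then
    forall v, (forall x, U x -> derivable f x v) /\ Ck k' U ('D_v f)
  else True.

(* Smoothness on an arbitrary subset of R^n: local existence of C^oo extensions
   to open sets. *)
Definition smooth_on n (V : normedModType R) (A : set 'rV[R]_n)
    (f : 'rV[R]_n -> V) : Prop :=
  forall x, A x -> exists U g,
    [/\ open U, U x, forall k, Ck k U g & {in U `&` A, g =1 f}].

End Calculus.

(** * Smooth manifolds with boundary *)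

(* Smooth n-manifolds with (possibly empty) boundary, given by an atlas, not
   necessarily maximal; [param i] is the inverse of the chart [coord i]. *)
Record manifold (R : realType) (n : nat) := Manifold {
  carrier :> topologicalType ;
  carrier_hausdorff : hausdorff_space carrier ;
  carrier_second_countable : @second_countable carrier ;
  index : Type ;
  dom : index -> set carrier ;
  coord : index -> carrier -> 'rV[R]_n ;
  param : index -> 'rV[R]_n -> carrier ;
  dom_cover : forall p, exists i, dom i p ;
  dom_open : forall i, open (dom i) ;
  coord_image : forall i, exists2 U, open U &
    coord i @` dom i = U `&` halfspace (n:=n) ;
  coordK : forall i, {in dom i, cancel (coord i) (param i)} ;
  coord_continuous : forall i, {within dom i, continuous (coord i)} ;
  param_continuous : forall i, {within coord i @` dom i, continuous (param i)} ;
  transition_smooth : forall i j,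
    smooth_on (coord i @` (dom i `&` dom j)) (coord j \o param i)
}.

Section Manifolds.
Context {R : realType}.

Definition boundary n (M : manifold R n) : set M :=
  [set p | exists (i : index M) (k : 'I_n),
             [/\ dom i p, val k = 0%N & coord i p 0 k = 0]].

Definition closed_manifold n (M : manifold R n) : Prop :=
  compact [set: M] /\ boundary (M:=M) = set0.

Section Maps.
Context {m n : nat} {M : manifold R m} {N : manifold R n} (f : M -> N).

(* The differential of [f] at [p], read in the charts [i] and [j]; with
   [f = id], this is the differential of a change of coordinates. *)
Definition dmap (i : index M) (j : index N) (p : M) : 'rV[R]_m -> 'rV[R]_n :=
  hderive (coord j \o f \o param i) (coord i p).

Definition jacobian (i : index M) (j : index N) (p : M) : 'M[R]_(m, n) :=
  \matrix_(k < m) dmap i j p (delta_mx 0 k).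

Definition smooth_map : Prop :=
  continuous f /\
  forall (i : index M) (j : index N),
    smooth_on (coord i @` (dom i `&` f @^-1` dom j))
              (coord j \o f \o param i).

Definition immersion : Prop :=
  smooth_map /\
  forall p (i : index M) (j : index N), dom i p -> dom j (f p) ->
    injective (dmap i j p).

Definition topological_embedding : Prop :=
  [/\ continuous f, injective f &
      forall U : set M, open U -> exists2 V : set N, open V & U = f @^-1` V].

Definition smooth_embedding : Prop := immersion /\ topological_embedding.

End Maps.

(** * Orientations *)

(* [o i p] is 1 or -1 according to whether the coordinate frame of the chart
   [i] at [p] is positive or negative. *)
Definition orientation n (M : manifold R n) := index M -> M -> R.

Definition is_orientation n (M : manifold R n) (o : orientation M) : Prop :=
  [/\ forall (i : index M) p, dom i p -> o i p = 1 \/ o i p = -1,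
      forall (i j : index M) p, dom i p -> dom j p ->
        o j p = Num.sg (\det (jacobian (@id M) i j p)) * o i p &
      forall (i : index M) p, dom i p -> \forall q \near p, o i q = o i p].

(* [f], mapping into the boundary of [M], preserves (s = 1) or reverses
   (s = -1) orientation, the boundary being oriented by the outward normal
   first convention; in charts the outward normal is - d/dx_0. *)
Definition boundary_oriented (s : R) n (N : manifold R n)
    (M : manifold R n.+1) (f : N -> M) (oN : orientation N)
    (oM : orientation M) : Prop :=
  forall q (k : index N) (i : index M), dom k q -> dom i (f q) ->
    oN k q = s * oM i (f q) *
      Num.sg (\det (col_mx (- delta_mx 0 0) (jacobian f k i q) : 'M[R]_(1 + n))).

(* boundary M = - Nm \cup Np, as oriented manifolds. *)
Definition boundary_decomposition n (M : manifold R n.+1) (oM : orientation M)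
    (Nm Np : manifold R n) (oNm : orientation Nm) (oNp : orientation Np)
    (fm : Nm -> M) (fp : Np -> M) : Prop :=
  [/\ smooth_embedding fm /\ smooth_embedding fp,
      range fm `&` range fp = set0,
      range fm `|` range fp = boundary (M:=M),
      boundary_oriented (-1) fm oNm oM &
      boundary_oriented 1 fp oNp oM].

(** * Vector fields and differential forms *)

(* Tensors are families of coordinate expressions, one for each chart [i],
   meaningful on [dom i] and subject to the transformation rule. *)
Definition vfield n (M : manifold R n) := index M -> M -> 'rV[R]_n.
Definition form1 n (M : manifold R n) := index M -> M -> 'rV[R]_n -> R.
Definition form2 n (M : manifold R n) :=
  index M -> M -> 'rV[R]_n -> 'rV[R]_n -> R.

Section Tensors.
Context {n : nat} {M : manifold R n}.

Definition is_vfield (W : set M) (v : vfield M) : Prop :=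
  (forall (i j : index M) p, W p -> dom i p -> dom j p ->
     v j p = dmap id i j p (v i p)) /\
  (forall i : index M,
     smooth_on (coord i @` (dom i `&` W)) (fun x => v i (param i x))).

Definition is_form1 (W : set M) (a : form1 M) : Prop :=
  [/\ forall (i : index M) p, W p -> dom i p -> scalar (a i p),
      forall (i j : index M) p u, W p -> dom i p -> dom j p ->
        a i p u = a j p (dmap id i j p u) &
      forall (i : index M) u,
        smooth_on (coord i @` (dom i `&` W)) (fun x => a i (param i x) u)].

Definition is_form2 (w : form2 M) : Prop :=
  [/\ forall (i : index M) p u', dom i p -> scalar (fun u => w i p u u'),
      forall (i : index M) p u u', dom i p -> w i p u u' = - w i p u' u,
      forall (i j : index M) p u u', dom i p -> dom j p ->
        w i p u u' = w j p (dmap id i j p u) (dmap id i j p u') &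
      forall (i : index M) u u',
        smooth_on (coord i @` dom i) (fun x => w i (param i x) u u')].

(* The formulas below are the invariant ones for vector fields that are
   constant in the chart [i], so that their brackets vanish. *)
Definition d1 (a : form1 M) : form2 M := fun i p u v =>
  hderive (fun x => a i (param i x) v) (coord i p) u
  - hderive (fun x => a i (param i x) u) (coord i p) v.

Definition wedge_d1 (a : form1 M) (i : index M) (p : M)
    (u v t : 'rV[R]_n) : R :=
  a i p u * d1 a i p v t + a i p v * d1 a i p t u + a i p t * d1 a i p u v.

Definition d2 (w : form2 M) (i : index M) (p : M) (u v t : 'rV[R]_n) : R :=
  hderive (fun x => w i (param i x) v t) (coord i p) u
  + hderive (fun x => w i (param i x) t u) (coord i p) v
  + hderive (fun x => w i (param i x) u v) (coord i p) t.

(* (L_v w)(a, b) = v(w(a, b)) - w([v, a], b) - w(a, [v, b]), where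
   [v, a] = - D_a v for a constant field a. *)
Definition lie_derivative (v : vfield M) (w : form2 M) : form2 M :=
  fun i p a b =>
    let dv := hderive (fun x => v i (param i x)) (coord i p) in
    hderive (fun x => w i (param i x) a b) (coord i p) (v i p)
    + w i p (dv a) b + w i p a (dv b).

Definition symplectic (w : form2 M) : Prop :=
  [/\ is_form2 w,
      forall (i : index M) p u v t, dom i p -> d2 w i p u v t = 0 &
      forall (i : index M) p u, dom i p -> (forall u', w i p u u' = 0) -> u = 0].

End Tensors.

(* The orientation by w /\ w, whose value on the coordinate frame is twice the
   Pfaffian. *)
Definition symplectic_orientation (X : manifold R 4) (w : form2 X) :
    orientation X := fun i p =>
  let c (k l : 'I_4) := w i p (delta_mx 0 k) (delta_mx 0 l) in
  Num.sg (c 0 1 * c 2 3 - c 0 2 * c 1 3 + c 0 3 * c 1 2).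

(** * Contact 3-manifolds and Legendrian links *)

Definition plane_field (Y : manifold R 3) := index Y -> Y -> set 'rV[R]_3.

(* [a] is a contact form for [xi] on [W]: its kernel is [xi], and a /\ da is a
   positive volume form. *)
Definition contact_form (Y : manifold R 3) (o : orientation Y)
    (xi : plane_field Y) (W : set Y) (a : form1 Y) : Prop :=
  is_form1 W a /\
  forall (i : index Y) p, W p -> dom i p ->
    xi i p = [set u | a i p u = 0] /\
    0 < o i p * wedge_d1 a i p (delta_mx 0 0) (delta_mx 0 1) (delta_mx 0 2).

Definition contact_structure (Y : manifold R 3) (o : orientation Y)
    (xi : plane_field Y) : Prop :=
  forall p, exists W a, [/\ open W, W p & contact_form o xi W a].

Definition closed_contact_manifold (Y : manifold R 3) (o : orientation Y)
    (xi : plane_field Y) : Prop :=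
  [/\ closed_manifold Y, is_orientation o & contact_structure o xi].

Definition legendrian_link (Y : manifold R 3) (xi : plane_field Y)
    (K : manifold R 1) (oK : orientation K) (f : K -> Y) : Prop :=
  [/\ closed_manifold K, is_orientation oK, smooth_embedding f &
      forall p (k : index K) (i : index Y) u, dom k p -> dom i (f p) ->
        xi i (f p) (dmap f k i p u)].

(** * Strong symplectic cobordisms *)

Section Cobordisms.
Context {X : manifold R 4} (w : form2 X).

(* The boundary component [Y], included by [f], is convex (s = 1) or concave
   (s = -1), witnessed by the vector field [v] on the neighbourhood [W]: [v] is
   Liouville, transverse to [Y], pointing out of [X] (s = 1) or into [X]
   (s = -1) along [Y], and the contraction of [w] with [v] restricts to a
   contact form for [xi]. *)
Definition liouville_near (s : R) (Y : manifold R 3) (o : orientation Y)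
    (xi : plane_field Y) (f : Y -> X) (W : set X) (v : vfield X) : Prop :=
  [/\ open W /\ range f `<=` W,
      is_vfield W v,
      forall (i : index X) p a b, W p -> dom i p ->
        lie_derivative v w i p a b = w i p a b,
      forall q (i : index X), dom i (f q) -> s * v i (f q) 0 0 < 0 &
      exists2 a : form1 Y, contact_form o xi setT a &
        forall q (k : index Y) (i : index X) u, dom k q -> dom i (f q) ->
          a k q u = w i (f q) (v i (f q)) (dmap f k i q u)].

Definition strong_symplectic_cobordism
    (Ym Yp : manifold R 3) (om : orientation Ym) (op : orientation Yp)
    (xim : plane_field Ym) (xip : plane_field Yp)
    (im : Ym -> X) (ip : Yp -> X) : Prop :=
  [/\ compact [set: X] /\ symplectic w,
      closed_contact_manifold om xim /\ closed_contact_manifold op xip,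
      boundary_decomposition (symplectic_orientation w) om op im ip,
      exists W v, liouville_near (-1) om xim im W v &
      exists W v, liouville_near 1 op xip ip W v].

(** * Lagrangian cobordisms *)

Section Surfaces.
Context {L : manifold R 2} (iota : L -> X).

Definition lagrangian : Prop :=
  forall p (k : index L) (i : index X) u u', dom k p -> dom i (iota p) ->
    w i (iota p) (dmap iota k i p u) (dmap iota k i p u') = 0.

(* T L + T (boundary X) = T X along the boundary of X; in charts, the tangent
   space of the boundary is the hyperplane [t_0 = 0]. *)
Definition transverse_to_boundary : Prop :=
  forall p (k : index L) (i : index X), dom k p -> dom i (iota p) ->
    boundary (iota p) ->
    forall z : 'rV[R]_4, exists (u : 'rV[R]_2) (t : 'rV[R]_4),
      t 0 0 = 0 /\ z = dmap iota k i p u + t.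

Definition tangent_to (W : set X) (v : vfield X) : Prop :=
  forall p (k : index L) (i : index X), W (iota p) ->
    dom k p -> dom i (iota p) ->
    exists u, v i (iota p) = dmap iota k i p u.

(* The maps [bm], [bp] identify the links with the boundary of [L], compatibly
   with their inclusions into [X] through [Ym] and [Yp]. *)
Definition lagrangian_cobordism (oL : orientation L)
    (Ym Yp : manifold R 3) (im : Ym -> X) (ip : Yp -> X)
    (Km Kp : manifold R 1) (oKm : orientation Km) (oKp : orientation Kp)
    (jm : Km -> Ym) (jp : Kp -> Yp) (bm : Km -> L) (bp : Kp -> L) : Prop :=
  [/\ compact [set: L] /\ is_orientation oL,
      smooth_embedding iota,
      lagrangian,
      transverse_to_boundary &
      [/\ boundary_decomposition oL oKm oKp bm bp,
          iota \o bm =1 im \o jm &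
          iota \o bp =1 ip \o jp]].

End Surfaces.
End Cobordisms.
End Manifolds.

(* Main.v *)
From HB Require Import structures.
From mathcomp Require Import all_boot all_order all_algebra.
From mathcomp Require Import all_classical all_reals all_analysis.
From mathcomp Require Import ring lra.
Require Import Defs.
Set Implicit Arguments.
Unset Strict Implicit.
Unset Printing Implicit Defensive.
Import Order.TTheory GRing.Theory Num.Theory.
Import numFieldNormedType.Exports.
Local Open Scope classical_set_scope.
Local Open Scope ring_scope.

(** Near an end Y of X let v be the given Liouville field and alpha the 1-form
    w(v, .).  By Cartan's formula d alpha = L_v w = w, so the restriction of
    alpha to the Lagrangian surface L is closed.  It vanishes on vectors tangent
    to the boundary of L, because alpha restricts on Y to a contact form for xi
    and the boundary links are Legendrian.

    Suppose that h is a function on a neighbourhood of Y which vanishes on Y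
    and satisfies dh = - alpha on L.  Let X_h be its Hamiltonian field,
    w(X_h, .) = dh, and put v' = v + X_h.  Then
    - v' is Liouville: w(v', .) = alpha + dh has the same differential as alpha
      ([modified_liouville]);
    - on Y, dh vanishes on vectors tangent to Y, so alpha + dh induces the same
      contact form as alpha; moreover X_h is tangent to Y
      ([hamiltonian_tangent]), so v' crosses Y in the same direction as v;
    - on L, w(v', .) vanishes on T L, and T L is its own w-orthogonal, so v' is
      tangent to L ([modified_tangent]).

    The function h is first built near a point iota b with b in the boundary
    of L ([local_primitive_exists]).  In a half-disc chart of L centred at b,
    the radial primitive of - alpha (Poincare lemma) is constant along the
    boundary, hence vanishes there.  It is carried over to X by a local
    retraction onto L: transversality of L to the boundary of X makes two of
    the coordinates of X, one of them the coordinate that defines the boundary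
    of X, local coordinates on L (inverse function theorem), and forgetting the
    two others sends the boundary of X to the boundary of L.  Away from L the
    zero function will do.

    Two local solutions defined near the same point of Y agree on L near that
    point ([primitive_unique]): their restrictions to L have the same
    differential and both vanish on the boundary of L.  A quotient
    (sum rho_a h_a) / (sum rho_a), with bump functions rho_a, therefore still
    solves dh = - alpha on L ([primitive_glue]), although multiplying by rho_a
    does not respect that equation.

    All this rests on calculus from directional derivatives: the
    chain rule, Schwarz's theorem, the smooth inverse function theorem,
    differentiation under the integral sign and flat functions. *)

(** * Directional derivatives *)

Section LiouvilleTangency.
Context {R : realType}.
Implicit Types (n m : nat).

Lemma derive_ray n (f : 'rV[R]_n -> R) (b w : 'rV[R]_n) (t : R) :
  derivable f (b + t *: w) w ->
  is_derive t 1 (fun s : R => f (b + s *: w)) ('D_w f (b + t *: w)).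
Proof.
move=> df; have E : (fun h : R => h^-1 *: (((fun s : R => f (b + s *: w)) \o shift t) (h *: 1) - f (b + t *: w))) =
      (fun h => h^-1 *: ((f \o shift (b + t *: w)) (h *: w) - f (b + t *: w))).
  apply/funext => h /=; congr (_ *: (f _ - _)).
  by rewrite [h *: 1]mulr1 scalerDl addrCA.
by split; [rewrite /derivable E|rewrite /derive E].
Qed.

Lemma mvt_dir n (f : 'rV[R]_n -> R) (x v : 'rV[R]_n) :
  (forall s : R, 0 <= s <= 1 -> derivable f (x + s *: v) v) ->
  exists2 s : R, 0 <= s <= 1 & f (x + v) - f x = 'D_v f (x + s *: v).
Proof.
move=> df; pose p (s : R) := f (x + s *: v).
have dp (s : R) : 0 <= s <= 1 -> is_derive s 1 p ('D_v f (x + s *: v)).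
  by move=> /df dfs; exact: derive_ray.
have cp : {within `[0, 1], continuous p}.
  apply: derivable_within_continuous => s; rewrite in_itv /= => /dp H.
  exact: ex_derive.
have dp' (s : R) : s \in `]0, 1[%R -> is_derive s 1 p ('D_v f (x + s *: v)).
  by rewrite in_itv /= => /andP[s0 s1]; apply: dp; rewrite !ltW.
have [s s01] := MVT ltr01 dp' cp.
rewrite subr0 mulr1 /p scale1r scale0r addr0 => ->; exists s => //.
by move: s01; rewrite in_itv /= => /andP[s0 s1]; rewrite !ltW.
Qed.

Lemma derivable_scale n (V : normedModType R) (f : 'rV[R]_n -> V) x v (c : R) :
  derivable f x v -> derivable f x (c *: v) /\ 'D_(c *: v) f x = c *: 'D_v f x.
Proof.
move=> df; have [->|c0] := eqVneq c 0.
  by rewrite !scale0r derive0; split=> //; exact: derivable0.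
suff H : (fun h : R => h^-1 *: ((f \o shift x) (h *: (c *: v)) - f x)) @ 0^'
    --> c *: 'D_v f x.
  by split; [apply/cvg_ex; exists (c *: 'D_v f x)|exact: cvg_lim].
have -> : (fun h : R => h^-1 *: ((f \o shift x) (h *: (c *: v)) - f x)) =
  (fun h : R => c *: ((h * c)^-1 *: ((f \o shift x) ((h * c) *: v) - f x))).
  apply/funext => h /=; rewrite [RHS]scalerA [in RHS]invfM mulrCA divff // mulr1.
  by rewrite scalerA.
apply: cvgZl_tmp.
have hc : h * c @[h --> 0^'] --> (0:R)^'.
  move=> A; rewrite /dnbhs /within /= => -[e /= e0 eA].
  exists (e / `|c|) => /=; first by rewrite divr_gt0 ?normr_gt0.
  move=> t /=; rewrite sub0r normrN ltr_pdivlMr ?normr_gt0 // -normrM => te t0.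
  by apply: eA; rewrite ?mulf_neq0 //= sub0r normrN.
exact: (cvg_comp _ _ hc df).
Qed.

Lemma coord_at n (v : 'rV[R]_n) i : {for v, continuous (fun y : 'rV[R]_n => y 0 i)}.
Proof. exact: (@matrix_normedtype.coord_continuous R 1 n 0 i v). Qed.

Lemma continuous_at_sum (I : finType) (T : topologicalType) (P : pred I)
    (f : I -> T -> R) (x : T) :
  (forall i, P i -> {for x, continuous (f i)}) ->
  {for x, continuous (fun y => \sum_(i | P i) f i y)}.
Proof.
move=> fa; apply: (@cvg_big _ _ +%R) => // -[a b].
by apply: cvgD; [exact: cvg_fst|exact: cvg_snd].
Qed.

(** Continuity of the directional derivatives only; on an open set this forces
    differentiability, see [C1_differentiable]. *)
Definition C1 n (U : set 'rV[R]_n) (f : 'rV[R]_n -> R) :=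
  forall v x, U x -> derivable f x v /\ {for x, continuous ('D_v f)}.

(** The increment along h (u + v) is split at x + h u.  The second half is, by
    the mean value theorem, a derivative along v at a nearby point, so that
    continuity of 'D_v f suffices. *)
Lemma C1_derivable_add n (U : set 'rV[R]_n) (f : 'rV[R]_n -> R) u v x :
  open U -> C1 U f -> U x -> 'D_(u + v) f x = 'D_u f x + 'D_v f x.
Proof.
move=> oU cf Ux.
have [du _] := cf u x Ux; have [dv cv] := cf v x Ux.
pose q1 (h : R) := h^-1 *: ((f \o shift x) (h *: u) - f x).
pose q2 (h : R) := h^-1 *: (f (h *: u + x + h *: v) - f (h *: u + x)).
apply: cvg_lim => //.
have -> : (fun h : R => h^-1 *: ((f \o shift x) (h *: (u + v)) - f x)) = q1 + q2.
  apply/funext => h; rewrite /q1 /q2 !fctE /= -scalerDr; congr (_ *: _).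
  by rewrite scalerDr (addrAC _ _ x) [RHS]addrC addrA subrK.
have c1 : q1 @ 0^' --> 'D_u f x by exact: du.
suff c2 : q2 @ 0^' --> 'D_v f x by exact: (cvgD c1 c2).
apply/cvgrPdist_le => e e0.
have /cvgrPdist_le/(_ e e0) ce := cv.
have : \forall y \near x, U y /\ `|'D_v f x - 'D_v f y| <= e.
  by apply: filterI => //; exact: open_nbhs_nbhs.
move=> /nbhs_ballP[d /= d0 bd].
near=> h.
have [h0 hd] : h != 0 /\ `|h| * (`|u| + `|v|) < d.
  split; first by near: h; exact: nbhs_dnbhs_neq.
  have : `|h| < d / (`|u| + `|v| + 1).
    by near: h; apply: dnbhs0_lt; rewrite divr_gt0 // ltr_wpDl ?addr_ge0.
  rewrite ltr_pdivlMr ?ltr_wpDl ?addr_ge0 //; apply: le_lt_trans.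
  by rewrite ler_wpM2l // lerDl.
have bs (s : R) : 0 <= s <= 1 -> ball x d (h *: u + x + s *: (h *: v)).
  move=> /andP[s0 s1]; rewrite -ball_normE /=.
  rewrite addrAC opprD addrCA subrr addr0 normrN.
  apply: le_lt_trans hd; apply: le_trans (ler_normD _ _) _.
  rewrite mulrDr !normrZ lerD2l ger0_norm //.
  by rewrite ler_piMl ?mulr_ge0.
have dd (s : R) : 0 <= s <= 1 -> derivable f (h *: u + x + s *: (h *: v)) (h *: v).
  by move=> /bs/bd[Us _]; have [d' _] := cf v _ Us; have [] := derivable_scale h d'.
have [s s01 E] := mvt_dir dd.
have [Us ?] := bd _ (bs _ s01).
rewrite /q2 E; have [d' _] := cf v _ Us; have [_ ->] := derivable_scale h d'.
by rewrite -[X in _ - X]/(h^-1 * (h * _)) mulKf.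
Unshelve. all: by end_near. Qed.

Lemma C1_deriveE n (U : set 'rV[R]_n) (f : 'rV[R]_n -> R) v x :
  open U -> C1 U f -> U x ->
  'D_v f x = \sum_i v 0 i * 'D_(delta_mx 0 i) f x.
Proof.
move=> oU cf Ux; rewrite {1}[v]row_sum_delta.
elim/big_ind2 : _ => [|a1 a2 b1 b2 <- <-|i _]; first exact: derive0.
  exact: C1_derivable_add oU cf Ux.
by have [d _] := cf (delta_mx 0 i) x Ux; have [_ ->] := derivable_scale (v 0 i) d.
Qed.

(** By the mean value theorem the remainder of the affine approximation at x is
    a difference of derivatives along the increment, and these are controlled
    by the finitely many partial derivatives. *)
Lemma C1_differentiable n (U : set 'rV[R]_n) (f : 'rV[R]_n -> R) x :
  open U -> C1 U f -> U x -> differentiable f x.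
Proof.
move=> oU cf Ux.
pose D (v : 'rV[R]_n) : R := \sum_i v 0 i * 'D_(delta_mx 0 i) f x.
have Dlin : linear D.
  move=> a u v; rewrite /D scaler_sumr -big_split /=; apply: eq_bigr => i _.
  by rewrite !mxE mulrDl -mulrA.
pose DL : {linear 'rV[R]_n -> R} := HB.pack D (GRing.isLinear.Build _ _ _ _ _ Dlin).
have Dcont : continuous DL.
  move=> v; apply: continuous_at_sum => i _.
  by apply: continuousM; [exact: coord_at|exact: cst_continuous].
have := @diff_unique _ _ _ f DL x Dcont; set Q := (X in (X -> _) -> _) => K.
suff H : Q by apply/diff_locallyP; rewrite K.
apply/eqaddoP => e e0.
have ci (i : 'I_n) : \forall y \near x,
   `|'D_(delta_mx 0 i) f x - 'D_(delta_mx 0 i) f y| <= e / n.+1%:R.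
  have [_ ci] := cf (delta_mx 0 i) x Ux.
  by move/cvgrPdist_le : ci; apply; rewrite divr_gt0.
have : \forall y \near x, forall i : 'I_n,
   `|'D_(delta_mx 0 i) f x - 'D_(delta_mx 0 i) f y| <= e / n.+1%:R.
  exact: (@filter_forall _ _ _ (nbhs x) _ ci).
move=> /(filterI (open_nbhs_nbhs (conj oU Ux)))/nbhs_ballP[d /= d0 bd].
have nd : \forall h \near (0 : 'rV[R]_n), `|h| < d by exact: nbhs0_lt.
apply: filterS nd => h hd.
have bs (s : R) : 0 <= s <= 1 -> ball x d (x + s *: h).
  move=> /andP[s0 s1]; rewrite -ball_normE /= opprD addNKr normrN normrZ.
  by rewrite (le_lt_trans _ hd) // ger0_norm // ler_piMl.
have dd (s : R) : 0 <= s <= 1 -> derivable f (x + s *: h) h.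
  by move=> /bs/bd[Us _]; have [] := cf h _ Us.
have [s s01 E] := mvt_dir dd.
have [Us De] := bd _ (bs _ s01).
rewrite !fctE /= opprD addrA [h + x]addrC E (C1_deriveE _ oU cf Us) -sumrB.
apply: le_trans (ler_norm_sum _ _ _) _.
have -> : e * `|h| = \sum_(i < n.+1) (e / n.+1%:R * `|h|).
  by rewrite sumr_const card_ord -mulrnAl -mulr_natr divfK.
rewrite big_ord_recr /=.
apply: ler_wpDr; first by rewrite mulr_ge0 // divr_ge0 // ltW.
apply: ler_sum => i _; rewrite -mulrBr normrM mulrC distrC; apply: ler_pM => //.
by rewrite [leRHS]/Num.Def.normr/= mx_normrE; exact: (le_bigmax _ (fun i => `|h i.1 i.2|) (0, i)).
Unshelve. all: by end_near. Qed.

(** * Functions of class C^k *)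

Section CkAlgebra.
Context {n : nat}.
Implicit Types (U : set 'rV[R]_n) (k : nat).

Lemma Ck_cont (V : normedModType R) k U (f : 'rV[R]_n -> V) x :
  Ck k U f -> U x -> {for x, continuous f}.
Proof. by case: k => [|k] [cf _]; exact: cf. Qed.

Lemma Ck_derivable (V : normedModType R) k U (f : 'rV[R]_n -> V) x v :
  Ck k.+1 U f -> U x -> derivable f x v.
Proof. by move=> [_ /(_ v)[df _]]; exact: df. Qed.

Lemma Ck_derive (V : normedModType R) k U (f : 'rV[R]_n -> V) v :
  Ck k.+1 U f -> Ck k U ('D_v f).
Proof. by move=> [_ /(_ v)[]]. Qed.

Lemma eq_near_open (T : Type) U (f g : 'rV[R]_n -> T) x :
  open U -> U x -> (forall y, U y -> f y = g y) -> \forall y \near x, f y = g y.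
Proof. by move=> oU Ux fg; apply: filterS (open_nbhs_nbhs (conj oU Ux)). Qed.

Lemma eq_continuous_at (T : topologicalType) (V : topologicalType) (f g : T -> V) x :
  (\forall y \near x, f y = g y) -> {for x, continuous f} -> {for x, continuous g}.
Proof.
move=> fg cf; have E := nbhs_singleton fg.
rewrite /prop_for /continuous_at -E; apply: cvg_trans cf.
by apply: near_eq_cvg; apply: filterS fg.
Qed.

Lemma Ck_ext (V : normedModType R) k U (f g : 'rV[R]_n -> V) :
  open U -> (forall y, U y -> f y = g y) -> Ck k U f -> Ck k U g.
Proof.
move=> oU; elim: k f g => [|k IH] f g fg [cf df]; split => //.
- by move=> x Ux; apply: eq_continuous_at (cf x Ux); exact: eq_near_open fg.
- by move=> x Ux; apply: eq_continuous_at (cf x Ux); exact: eq_near_open fg.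
- move=> v; have [dfv cv] := df v; split.
    by move=> x Ux; apply: near_eq_derivable (dfv x Ux); exact: eq_near_open fg.
  apply: IH cv => y Uy; apply: near_eq_derive; exact: eq_near_open fg.
Qed.

Lemma Ck_sub (V : normedModType R) k U W (f : 'rV[R]_n -> V) :
  W `<=` U -> Ck k U f -> Ck k W f.
Proof.
move=> WU; elim: k f => [|k IH] f [cf df]; split=> //; try by move=> x /WU; exact: cf.
by move=> v; have [dfv cv] := df v; split; [move=> x /WU; exact: dfv|exact: IH].
Qed.

Lemma Ck_pred (V : normedModType R) k U (f : 'rV[R]_n -> V) : Ck k.+1 U f -> Ck k U f.
Proof.
elim: k f => [|k IH] f [cf df]; split=> // v.
by have [dfv cv] := df v; split=> //; exact: IH.
Qed.

Lemma Ck_C1 k U (f : 'rV[R]_n -> R) : Ck k.+1 U f -> C1 U f.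
Proof.
by move=> [_ df] v x Ux; have [dv /Ck_cont cv] := df v; split; [exact: dv|exact: cv].
Qed.

Lemma Ck_cst (V : normedModType R) k U (c : V) : open U -> Ck k U (fun=> c).
Proof.
move=> oU; elim: k c => [|k IH] c; split=> //; try by move=> x _; exact: cst_continuous.
move=> v; split; first by move=> x _; exact: derivable_cst.
by apply: (Ck_ext oU _ (IH 0)) => y _; rewrite derive_cst.
Qed.

Lemma CkD (V : normedModType R) k U (f g : 'rV[R]_n -> V) : open U ->
  Ck k U f -> Ck k U g -> Ck k U (fun x => f x + g x).
Proof.
move=> oU; elim: k f g => [|k IH] f g [cf df] [cg dg].
  by split=> // x Ux; apply: continuousD; [exact: cf|exact: cg].
split=> [x Ux|v]; first by apply: continuousD; [exact: cf|exact: cg].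
have [dfv cfv] := df v; have [dgv cgv] := dg v; split.
  by move=> x Ux; apply: derivableD; [exact: dfv|exact: dgv].
by apply: (Ck_ext oU _ (IH _ _ cfv cgv)) => y Uy; rewrite deriveD //; [exact: dfv|exact: dgv].
Qed.

(** The Leibniz formula for 'D_v (f g) involves f and g themselves, hence
    [Ck_pred] in the induction. *)
Lemma CkM k U (f g : 'rV[R]_n -> R) : open U ->
  Ck k U f -> Ck k U g -> Ck k U (fun x => f x * g x).
Proof.
move=> oU; elim: k f g => [|k IH] f g Cf Cg; have [cf df] := Cf; have [cg dg] := Cg.
  by split=> // x Ux; apply: continuousM; [exact: cf|exact: cg].
split=> [x Ux|v]; first by apply: continuousM; [exact: cf|exact: cg].
have [dfv cfv] := df v; have [dgv cgv] := dg v; split.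
  by move=> x Ux; apply: derivableM; [exact: dfv|exact: dgv].
apply: (Ck_ext oU _ (CkD oU (IH _ _ (Ck_pred Cf) cgv) (IH _ _ (Ck_pred Cg) cfv))).
by move=> y Uy; rewrite deriveM //; [exact: dfv|exact: dgv].
Qed.

Lemma CkN k U (f : 'rV[R]_n -> R) : open U -> Ck k U f -> Ck k U (fun x => - f x).
Proof.
move=> oU Cf; apply: (Ck_ext oU _ (CkM oU (Ck_cst k (-1 : R) oU) Cf)) => y _.
by rewrite mulN1r.
Qed.

Lemma Ck_sum k U (I : Type) (r : seq I) (P : pred I) (F : I -> 'rV[R]_n -> R) :
  open U -> (forall i, Ck k U (F i)) -> Ck k U (fun x => \sum_(i <- r | P i) F i x).
Proof.
move=> oU CF; elim: r => [|i r IH].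
  by apply: (Ck_ext oU _ (Ck_cst k (0 : R) oU)) => y _; rewrite big_nil.
have [Pi|nPi] := boolP (P i).
  by apply: (Ck_ext oU _ (CkD oU (CF i) IH)) => y _; rewrite big_cons Pi.
by apply: (Ck_ext oU _ IH) => y _; rewrite big_cons (negbTE nPi).
Qed.

Lemma Ck_prod k U (I : Type) (r : seq I) (P : pred I) (F : I -> 'rV[R]_n -> R) :
  open U -> (forall i, Ck k U (F i)) -> Ck k U (fun x => \prod_(i <- r | P i) F i x).
Proof.
move=> oU CF; elim: r => [|i r IH].
  by apply: (Ck_ext oU _ (Ck_cst k (1 : R) oU)) => y _; rewrite big_nil.
have [Pi|nPi] := boolP (P i).
  by apply: (Ck_ext oU _ (CkM oU (CF i) IH)) => y _; rewrite big_cons Pi.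
by apply: (Ck_ext oU _ IH) => y _; rewrite big_cons (negbTE nPi).
Qed.

Lemma derive_coord (x v : 'rV[R]_n) i :
  derivable (fun y : 'rV[R]_n => y 0 i) x v /\ 'D_v (fun y : 'rV[R]_n => y 0 i) x = v 0 i.
Proof.
split; first exact/diff_derivable/differentiable_coord.
by have := derive_mx (@derivable_id _ _ x v); rewrite derive_id => /matrixP/(_ 0 i); rewrite mxE.
Qed.

Lemma Ck_coord k U i : open U -> Ck k U (fun x : 'rV[R]_n => x 0 i).
Proof.
move=> oU; case: k => [|k]; split=> //; try by move=> x Ux; exact: coord_at.
move=> v; split; first by move=> x Ux; have [] := derive_coord x v i.
apply: (Ck_ext oU _ (Ck_cst k (v 0 i) oU)) => y _.
by have [_ ->] := derive_coord y v i.
Qed.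

Lemma CkV k U (f : 'rV[R]_n -> R) : open U -> (forall x, U x -> f x != 0) ->
  Ck k U f -> Ck k U (fun x => (f x)^-1).
Proof.
move=> oU f0; elim: k => [|k IH] Cf; have [cf df] := Cf.
  by split=> // x Ux; apply: continuousV; [exact: f0|exact: cf].
split=> [x Ux|v]; first by apply: continuousV; [exact: f0|exact: cf].
have [dfv cfv] := df v; split.
  by move=> x Ux; apply: derivableV; [exact: f0|exact: dfv].
have Ci := IH (Ck_pred Cf).
apply: (Ck_ext oU _ (CkN oU (CkM oU (CkM oU Ci Ci) cfv))) => y Uy.
rewrite deriveV; [|exact: f0|exact: dfv].
by rewrite -[RHS]/(_ * _) mulNr expr2 invfM.
Qed.

Lemma continuous_rowP (T : topologicalType) m (g : T -> 'rV[R]_m) x :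
  {for x, continuous g} <-> forall j, {for x, continuous (fun y => g y 0 j)}.
Proof.
split=> [cg j|cg].
  exact: (cvg_comp _ _ cg (@coord_at _ (g x) j)).
apply/cvgrPdist_le => e e0.
have H j : \forall y \near x, `|g x 0 j - g y 0 j| <= e.
  by move: (cg j) => /cvgrPdist_le; exact.
have {}H : \forall y \near x, forall j, `|g x 0 j - g y 0 j| <= e.
  exact: (@filter_forall _ _ _ (nbhs x) _ H).
apply: filterS H => y Hy.
rewrite [leLHS]/Num.Def.normr/= mx_normrE; apply: bigmax_le; first exact: ltW.
by move=> [i j] _; rewrite !mxE /= (ord1 i).
Qed.

Lemma Ck_rowP k U m (g : 'rV[R]_n -> 'rV[R]_m) : open U ->
  Ck k U g <-> forall j, Ck k U (fun x => g x 0 j).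
Proof.
move=> oU; elim: k g => [|k IH] g.
  split=> [[cg _] j|cg].
    by split=> // x Ux; exact: (continuous_rowP g x).1 (cg x Ux) j.
  by split=> // x Ux; apply/continuous_rowP => j; exact: (cg j).1.
split=> [[cg dg] j|cg].
  split=> [x Ux|v]; first exact: (continuous_rowP g x).1 (cg x Ux) j.
  have [dgv Cgv] := dg v; split.
    by move=> x Ux; exact: (derivable_mxP _ _ _).1 (dgv x Ux) 0 j.
  apply: (Ck_ext oU _ ((IH _).1 Cgv j)) => y Uy.
  by rewrite derive_mx ?mxE //; exact: dgv.
split=> [x Ux|v]; first by apply/continuous_rowP => j; exact: (cg j).1.
have dgv x : U x -> derivable g x v.
  by move=> Ux; apply/derivable_mxP => i j; rewrite (ord1 i); exact: Ck_derivable (cg j) Ux.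
split=> //; apply/IH => j.
apply: (Ck_ext oU _ (Ck_derive v (cg j))) => y Uy.
by rewrite derive_mx ?mxE //; exact: dgv.
Qed.

End CkAlgebra.

(** * The chain rule and the symmetry of second derivatives *)

(** The derivative along v is the ordinary derivative of the restriction to a
    line; this gives access to the chain rule for differentials. *)
Lemma derive_along n (V : normedModType R) (f : 'rV[R]_n -> V) x v :
  (fun h : R => h^-1 *: ((fun h : R => f (h *: v + x)) (h *: 1 + 0) - f (0 *: v + x)))
  = (fun h : R => h^-1 *: ((f \o shift x) (h *: v) - f x)).
Proof.
by apply/funext => h /=; rewrite addr0 scale0r add0r [h *: 1]mulr1.
Qed.

Lemma derive1_along n (V : normedModType R) (f : 'rV[R]_n -> V) x v :
  'D_1 (fun h : R => f (h *: v + x)) 0 = 'D_v f x.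
Proof. by rewrite /derive -derive_along. Qed.

Lemma derive_comp n m (W : set 'rV[R]_m) (f : 'rV[R]_m -> R) (g : 'rV[R]_n -> 'rV[R]_m) x v :
  open W -> C1 W f -> W (g x) -> derivable g x v ->
  derivable (f \o g) x v /\ 'D_v (f \o g) x = 'D_('D_v g x) f (g x).
Proof.
move=> oW cf Wg dg.
have d1 : differentiable (fun h : R => g (h *: v + x)) 0.
  by apply/derivable1_diffP; exact: (derivable1P g x v).1 dg.
have d2 : differentiable f ((fun h : R => g (h *: v + x)) 0).
  by rewrite scale0r add0r; exact: C1_differentiable oW cf Wg.
have d12 := differentiable_comp d1 d2.
split; first by apply/(derivable1P _ x v).2; apply/derivable1_diffP.
rewrite -derive1_along.
rewrite (_ : (fun h : R => (f \o g) (h *: v + x)) = f \o (fun h : R => g (h *: v + x))) //.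
rewrite deriveE // diff_comp //= -(deriveE _ d1) derive1_along.
by rewrite -(deriveE _ d2) scale0r add0r.
Qed.

Lemma derive_comp_sum n m (W : set 'rV[R]_m) (f : 'rV[R]_m -> R) (g : 'rV[R]_n -> 'rV[R]_m) x v :
  open W -> C1 W f -> W (g x) -> derivable g x v ->
  'D_v (f \o g) x = \sum_i 'D_v (fun y => g y 0 i) x * 'D_(delta_mx 0 i) f (g x).
Proof.
move=> oW cf Wg dg; have [_ ->] := derive_comp oW cf Wg dg.
rewrite (C1_deriveE _ oW cf Wg); apply: eq_bigr => i _.
by rewrite derive_mx // mxE.
Qed.

Lemma Ck_comp n m k (U : set 'rV[R]_n) (W : set 'rV[R]_m) (f : 'rV[R]_m -> R)
    (g : 'rV[R]_n -> 'rV[R]_m) :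
  open U -> open W -> (forall x, U x -> W (g x)) ->
  Ck k W f -> Ck k U g -> Ck k U (f \o g).
Proof.
move=> oU oW UW; elim: k f => [|k IH] f Cf Cg.
  by split=> // x Ux; apply: continuous_comp; [exact: Ck_cont Cg Ux|exact: Ck_cont Cf (UW _ Ux)].
split=> [x Ux|v].
  by apply: continuous_comp; [exact: Ck_cont Cg Ux|exact: Ck_cont Cf (UW _ Ux)].
have dg x : U x -> derivable g x v by move=> Ux; exact: Ck_derivable Cg Ux.
split=> [x Ux|].
  by have [] := derive_comp oW (Ck_C1 Cf) (UW _ Ux) (dg _ Ux).
apply: (@Ck_ext _ _ _ _ (fun x => \sum_i 'D_v (fun y => g y 0 i) x * ('D_(delta_mx 0 i) f \o g) x)) => //.
  by move=> y Uy; rewrite (derive_comp_sum oW (Ck_C1 Cf) (UW _ Uy) (dg _ Uy)).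
apply: Ck_sum => // i; apply: CkM => //.
  by apply: Ck_derive; exact: (Ck_rowP _ _ oU).1 Cg i.
by apply: IH; [exact: Ck_derive Cf|exact: Ck_pred Cg].
Qed.

Lemma derive_row n m (g : 'rV[R]_n -> 'rV[R]_m) x v i :
  derivable g x v -> 'D_v g x 0 i = 'D_v (fun y => g y 0 i) x.
Proof. by move=> dg; rewrite derive_mx // mxE. Qed.

Lemma derive_shift_at n (f : 'rV[R]_n -> R) (a x v : 'rV[R]_n) :
  derivable f (x + a) v ->
  derivable (fun y => f (y + a)) x v /\ 'D_v (fun y => f (y + a)) x = 'D_v f (x + a).
Proof.
have E : (fun h : R => h^-1 *: (((fun y => f (y + a)) \o shift x) (h *: v) - f (x + a)))
  = (fun h : R => h^-1 *: ((f \o shift (x + a)) (h *: v) - f (x + a))).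
  by apply/funext => h /=; rewrite addrA.
by move=> d; split; [rewrite /derivable E|rewrite /derive E].
Qed.

(** The mean value theorem, applied first along u to the increment along v and
    then along v to the derivative along u. *)
Lemma second_difference n (x : 'rV[R]_n) (d : R) (f : 'rV[R]_n -> R) u v (h : R) :
  Ck 2 (ball x d) f -> `|h| * (`|u| + `|v|) < d ->
  exists2 y, ball x d y &
    f (x + h *: u + h *: v) - f (x + h *: u) - (f (x + h *: v) - f x)
     = h * (h * 'D_v ('D_u f) y).
Proof.
move=> Cf hd.
have bs (s t : R) : 0 <= s <= 1 -> 0 <= t <= 1 ->
    ball x d (x + s *: (h *: u) + t *: (h *: v)).
  move=> /andP[s0 s1] /andP[t0 t1]; rewrite -ball_normE /=.
  rewrite -addrA opprD addNKr normrN; apply: le_lt_trans hd.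
  apply: le_trans (ler_normD _ _) _; rewrite mulrDr !normrZ ger0_norm // (ger0_norm t0).
  by apply: lerD; rewrite ler_piMl ?mulr_ge0.
have b0 (s : R) : 0 <= s <= 1 -> ball x d (x + s *: (h *: u)).
  by move=> /bs/(_ (_ : 0 <= 0 <= 1)); rewrite scale0r addr0; apply; rewrite lexx ler01.
have b1 (s : R) : 0 <= s <= 1 -> ball x d (x + s *: (h *: u) + h *: v).
  by move=> /bs/(_ (_ : 0 <= 1 <= 1)); rewrite scale1r; apply; rewrite lexx ler01.
pose F y := f (y + h *: v) - f y.
have dF (s : R) : 0 <= s <= 1 -> derivable F (x + s *: (h *: u)) (h *: u) /\
   'D_(h *: u) F (x + s *: (h *: u)) =
   h * ('D_u f (x + s *: (h *: u) + h *: v) - 'D_u f (x + s *: (h *: u))).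
  move=> s01.
  have d0 := Ck_derivable (v := u) Cf (b0 s s01).
  have [d1 E1] := derive_shift_at (Ck_derivable (v := u) Cf (b1 s s01)).
  have dF := derivableB d1 d0.
  have [dh Eh] := derivable_scale h dF.
  split; first exact: dh.
  by rewrite Eh (deriveB d1 d0) E1.
have [s s01] := mvt_dir (fun s s01 => (dF s s01).1).
have [_ ->] := dF s s01.
rewrite {1 2}/F => ->.
have CDu := Ck_derive u Cf.
have dD (t : R) : 0 <= t <= 1 ->
   derivable ('D_u f) (x + s *: (h *: u) + t *: (h *: v)) (h *: v) /\
   'D_(h *: v) ('D_u f) (x + s *: (h *: u) + t *: (h *: v)) =
   h * 'D_v ('D_u f) (x + s *: (h *: u) + t *: (h *: v)).
  move=> t01; have d1 := Ck_derivable (v := v) CDu (bs s t s01 t01).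
  by have [] := derivable_scale h d1.
have [t t01 ->] := mvt_dir (fun t t01 => (dD t t01).1).
have [_ ->] := dD t t01.
by exists (x + s *: (h *: u) + t *: (h *: v)) => //; exact: bs.
Qed.

Fact le_of_midpoint (a b c e : R) : `|a - c| <= e / 2 -> `|b - c| <= e / 2 -> a <= b + e.
Proof. by rewrite !ler_norml => /andP[? ?] /andP[? ?]; lra. Qed.

Fact subACA (a b c d : R) : a - b - (c - d) = a - c - (b - d).
Proof. ring. Qed.

(** The second difference is symmetric in u and v, and by [second_difference]
    it is, up to h ^+ 2, a value of either iterated derivative near x. *)
Lemma derive_sym n (U : set 'rV[R]_n) (f : 'rV[R]_n -> R) u v x :
  open U -> Ck 2 U f -> U x -> 'D_v ('D_u f) x = 'D_u ('D_v f) x.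
Proof.
move=> oU Cf Ux; pose D (a b : 'rV[R]_n) : R := 'D_b ('D_a f) x.
suff H (u' v' : 'rV[R]_n) : D u' v' <= D v' u'.
  change (D u v = D v u); apply/eqP; rewrite eq_le; apply/andP; split; exact: H.
apply/ler_addgt0Pr => e e0; rewrite /D.
have Cu := Ck_cont (Ck_derive v' (Ck_derive u' Cf)) Ux.
have Cv := Ck_cont (Ck_derive u' (Ck_derive v' Cf)) Ux.
have e2 : 0 < e / 2 by rewrite divr_gt0.
have /cvgrPdist_le/(_ _ e2) nu := Cu.
have /cvgrPdist_le/(_ _ e2) nv := Cv.
have nn : \forall y \near x, U y /\ `|'D_v' ('D_u' f) x - 'D_v' ('D_u' f) y| <= e / 2 /\
    `|'D_u' ('D_v' f) x - 'D_u' ('D_v' f) y| <= e / 2.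
  exact: filterI (open_nbhs_nbhs (conj oU Ux)) (filterI nu nv).
have [d /= d0 bd] := (nbhs_ballP _ _).1 nn.
pose h := d / (`|u'| + `|v'| + 1) / 2.
have n1 : 0 < `|u'| + `|v'| + 1 by rewrite ltr_wpDl ?addr_ge0.
have h0 : 0 < h by rewrite /h !divr_gt0.
have hd : `|h| * (`|u'| + `|v'|) < d.
  rewrite gtr0_norm //; apply: (@lt_le_trans _ _ (h * (`|u'| + `|v'| + 1))).
    by rewrite ltr_pM2l // ltrDl.
  by rewrite /h mulrAC divfK ?gt_eqF // ler_pdivrMr // ler_peMr ?ltW // ltr1n.
have Cb : Ck 2 (ball x d) f by apply: Ck_sub Cf => y /bd[].
have [y1 by1 E1] := second_difference Cb hd.
rewrite addrC in hd; have [y2 by2 E2] := second_difference Cb hd.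
have E : h * (h * 'D_v' ('D_u' f) y1) = h * (h * 'D_u' ('D_v' f) y2).
  apply: (etrans (esym E1)); apply: (etrans _ E2); rewrite (addrAC x (h *: u') (h *: v')).
  exact: (subACA _ _ _ _).
have {}E : 'D_v' ('D_u' f) y1 = 'D_u' ('D_v' f) y2.
  by apply: (mulfI (lt0r_neq0 h0)); apply: (mulfI (lt0r_neq0 h0)).
have [_ [n1' _]] := bd _ by1; have [_ [_ n2']] := bd _ by2.
rewrite E in n1'; exact: (le_of_midpoint n1' n2').
Qed.

(** * The inverse function theorem *)

Lemma ball_segment n (c : 'rV[R]_n) (r : R) x y (s : R) :
  ball c r x -> ball c r y -> 0 <= s <= 1 -> ball c r (y + s *: (x - y)).
Proof.
rewrite -!ball_normE /= => bx byy /andP[s0 s1].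
have -> : c - (y + s *: (x - y)) = s *: (c - x) + (1 - s) *: (c - y).
  by apply/rowP => i; rewrite !mxE; ring.
apply: le_lt_trans (ler_normD _ _) _; rewrite !normrZ ger0_norm // ger0_norm ?subr_ge0 //.
have [->|sn] := eqVneq s 0; first by rewrite mul0r add0r subr0 mul1r.
have sp : 0 < s by rewrite lt_def sn.
rewrite [ltRHS](_ : r = s * r + (1 - s) * r); last by ring.
apply: ltr_leD; first by rewrite ltr_pM2l.
by rewrite ler_wpM2l ?subr_ge0 // ltW.
Qed.

Lemma fixed_point_half n (A : set 'rV[R]_n) (f : 'rV[R]_n -> 'rV[R]_n) :
  closed A -> A !=set0 -> (forall x, A x -> A (f x)) ->
  (forall x y, A x -> A y -> `|f x - f y| <= 2^-1 * `|x - y|) ->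
  exists2 p, A p & p = f p.
Proof.
move=> cA A0 fA lf.
pose g : {fun A >-> A} := HB.pack f (isFun.Build _ _ A A f fA).
have half0 : 0 <= 2^-1 :> R by rewrite invr_ge0.
have ctr : is_contraction g.
  exists (NngNum half0); split; first by rewrite /= invf_lt1 ?ltr1n.
  by move=> [x y] [/= Ax Ay]; exact: lf.
have [p Ap pf] := @banach_fixed_point R (HB.pack 'rV[R]_n) A g ctr cA A0.
by exists p.
Qed.

Lemma row_norm_le n (x : 'rV[R]_n) (c : R) : 0 <= c ->
  (forall i, `|x 0 i| <= c) -> `|x| <= c.
Proof.
move=> c0 xc; rewrite [leLHS]/Num.Def.normr/= mx_normrE; apply: bigmax_le => //.
by move=> [i j] _ /=; rewrite (ord1 i).
Qed.

Lemma row_norm_coord n (x : 'rV[R]_n) i : `|x 0 i| <= `|x|.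
Proof.
rewrite [leRHS]/Num.Def.normr/= mx_normrE.
exact: (le_bigmax _ (fun i => `|x i.1 i.2|) (0, i)).
Qed.

(** Near x0 the partial derivatives are as small as one likes, and the mean
    value theorem turns this into a Lipschitz bound. *)
Lemma local_lipschitz n m (U : set 'rV[R]_n) (G : 'rV[R]_n -> 'rV[R]_m) x0 (e : R) :
  open U -> Ck 1 U G -> U x0 -> (forall v, 'D_v G x0 = 0) -> 0 < e ->
  exists2 r, 0 < r & ball x0 r `<=` U /\
    forall x y, ball x0 r x -> ball x0 r y -> `|G x - G y| <= e * `|x - y|.
Proof.
move=> oU CG Ux0 D0 e0.
have CGj j := (Ck_rowP _ _ oU).1 CG j.
have ci (ij : 'I_n * 'I_m) : \forall y \near x0,
   `|'D_(delta_mx 0 ij.1) (fun x => G x 0 ij.2) y| <= e / n.+1%:R.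
  have C := Ck_cont (Ck_derive (delta_mx 0 ij.1) (CGj ij.2)) Ux0.
  have en : 0 < e / n.+1%:R by rewrite divr_gt0.
  have E0 : 'D_(delta_mx 0 ij.1) (fun x => G x 0 ij.2) x0 = 0.
    by rewrite -(derive_row _ (Ck_derivable CG Ux0)) D0 mxE.
  move/cvgrPdist_le : C => /(_ _ en); apply: filterS => y.
  by rewrite E0 sub0r normrN.
have ca : \forall y \near x0, U y /\ forall ij : 'I_n * 'I_m,
   `|'D_(delta_mx 0 ij.1) (fun x => G x 0 ij.2) y| <= e / n.+1%:R.
  exact: (filterI (open_nbhs_nbhs (conj oU Ux0)) (@filter_forall _ _ _ (nbhs x0) _ ci)).
have [r /= r0 br] := (nbhs_ballP _ _).1 ca.
exists r => //; split; first by move=> y /br[].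
move=> x y bx byy; apply: row_norm_le; first by rewrite mulr_ge0 // ltW.
move=> j; rewrite !mxE.
pose g z := G z 0 j.
have bs (s : R) : 0 <= s <= 1 -> ball x0 r (y + s *: (x - y)) by exact: ball_segment.
have dd (s : R) : 0 <= s <= 1 -> derivable g (y + s *: (x - y)) (x - y).
  by move=> /bs/br[Us _]; exact: Ck_derivable (CGj j) Us.
have [s s01 E] := mvt_dir dd.
have [Us De] := br _ (bs _ s01).
rewrite [y + (x - y)]addrC subrK in E.
rewrite -/(g x) -/(g y) E (C1_deriveE _ oU (Ck_C1 (CGj j)) Us).
apply: le_trans (ler_norm_sum _ _ _) _.
have -> : e * `|x - y| = \sum_(i < n.+1) (e / n.+1%:R * `|x - y|).
  by rewrite sumr_const card_ord -mulrnAl -mulr_natr divfK.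
rewrite big_ord_recr /=.
apply: ler_wpDr; first by rewrite mulr_ge0 // divr_ge0 // ltW.
apply: ler_sum => i _; rewrite normrM mulrC; apply: ler_pM => //.
  exact: (De (i, j)).
exact: row_norm_coord.
Qed.

Section MatrixSmooth.
Context {n : nat} (U : set 'rV[R]_n) (oU : open U) (k : nat).

Lemma Ck_det m (A : 'rV[R]_n -> 'M[R]_m) :
  (forall i j, Ck k U (fun x => A x i j)) -> Ck k U (fun x => \det (A x)).
Proof.
move=> CA; rewrite /determinant; apply: Ck_sum => // s; apply: CkM => //.
  exact: Ck_cst.
exact: Ck_prod.
Qed.

(** Cramer's rule expresses the inverse through determinants. *)
Lemma Ck_invmx m (A : 'rV[R]_n -> 'M[R]_m) :
  (forall i j, Ck k U (fun x => A x i j)) -> (forall x, U x -> A x \in unitmx) ->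
  forall i j, Ck k U (fun x => invmx (A x) i j).
Proof.
move=> CA uA i j.
apply: (@Ck_ext _ _ _ _ (fun x => (\det (A x))^-1 * \adj (A x) i j)) => //.
  by move=> y Uy; rewrite /invmx uA // [RHS]mxE.
apply: CkM => //.
  apply: CkV => //; last exact: Ck_det.
  by move=> x Ux; move: (uA x Ux); rewrite unitmxE unitfE.
apply: (@Ck_ext _ _ _ _ (fun x => (-1) ^+ (j + i) * \det (row' j (col' i (A x))))) => //.
  by move=> y Uy; rewrite mxE.
apply: CkM => //; first exact: Ck_cst.
by apply: Ck_det => a b; apply: (@Ck_ext _ _ _ _ (fun x => A x (lift j a) (lift i b))) => // y Uy; rewrite !mxE.
Qed.

Lemma Ck_mulmx m p q (A : 'rV[R]_n -> 'M[R]_(m, p)) (B : 'rV[R]_n -> 'M[R]_(p, q)) :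
  (forall i j, Ck k U (fun x => A x i j)) -> (forall i j, Ck k U (fun x => B x i j)) ->
  forall i j, Ck k U (fun x => (A x *m B x) i j).
Proof.
move=> CA CB i j; apply: (@Ck_ext _ _ _ _ (fun x => \sum_l A x i l * B x l j)) => //.
  by move=> y Uy; rewrite mxE.
by apply: Ck_sum => // l; apply: CkM.
Qed.

End MatrixSmooth.

Lemma continuous_mulmxr n m (M : 'M[R]_(n, m)) (x : 'rV[R]_n) :
  {for x, continuous (fun y : 'rV[R]_n => y *m M)}.
Proof.
apply/continuous_rowP => j.
apply: (@eq_continuous_at _ _ (fun y : 'rV[R]_n => \sum_i y 0 i * M i j)).
  by near=> y; rewrite mxE.
by apply: continuous_at_sum => i _; apply: continuousM; [exact: coord_at|exact: cst_continuous].
Unshelve. all: by end_near. Qed.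

Lemma derive_mulmxr n m p (M : 'M[R]_(m, p)) (G : 'rV[R]_n -> 'rV[R]_m) x v :
  derivable G x v -> derivable (fun y => G y *m M) x v /\
    'D_v (fun y => G y *m M) x = 'D_v G x *m M.
Proof.
move=> dG.
have H : (fun h : R => h^-1 *: (((fun y => G y *m M) \o shift x) (h *: v) - G x *m M)) @ 0^'
    --> 'D_v G x *m M.
  have -> : (fun h : R => h^-1 *: (((fun y => G y *m M) \o shift x) (h *: v) - G x *m M)) =
    (fun z => z *m M) \o (fun h : R => h^-1 *: ((G \o shift x) (h *: v) - G x)).
    by apply/funext => h /=; rewrite -mulmxBl -scalemxAl.
  exact: (cvg_comp _ _ dG (continuous_mulmxr (M:=M) (x := 'D_v G x))).
by split; [exact: (cvgP _ H)|exact: (cvg_lim _ H)].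
Qed.

Lemma continuous_at_dist (T : topologicalType) (V : normedModType R) (f : T -> V) x :
  (forall e : R, 0 < e -> \forall z \near x, `|f x - f z| <= e) -> {for x, continuous f}.
Proof. by move=> H; apply/cvgrPdist_le. Qed.

Definition smooth n (V : normedModType R) (U : set 'rV[R]_n) (f : 'rV[R]_n -> V) :=
  forall k, Ck k U f.

(** The transpose of the usual Jacobian matrix: it acts on row vectors from the
    right, like [jacobian]. *)
Definition jac n m (F : 'rV[R]_n -> 'rV[R]_m) (x : 'rV[R]_n) : 'M[R]_(n, m) :=
  \matrix_(i, j) 'D_(delta_mx 0 i) (fun y => F y 0 j) x.

Lemma derive_jac n m (U : set 'rV[R]_n) (F : 'rV[R]_n -> 'rV[R]_m) x v :
  open U -> Ck 1 U F -> U x -> 'D_v F x = v *m jac F x.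
Proof.
move=> oU CF Ux; apply/rowP => j.
rewrite derive_row; last exact: Ck_derivable CF Ux.
rewrite (C1_deriveE _ oU (Ck_C1 ((Ck_rowP _ _ oU).1 CF j)) Ux) mxE.
by apply: eq_bigr => i _; rewrite mxE.
Qed.

Lemma Ck_jac n m k (U : set 'rV[R]_n) (F : 'rV[R]_n -> 'rV[R]_m) i j :
  open U -> Ck k.+1 U F -> Ck k U (fun x => jac F x i j).
Proof.
move=> oU CF.
apply: (@Ck_ext _ _ _ _ ('D_(delta_mx 0 i) (fun y => F y 0 j))) => //.
  by move=> y Uy; rewrite mxE.
exact: Ck_derive ((Ck_rowP _ _ oU).1 CF j).
Qed.

Lemma mulmx_norm_le n m (M : 'M[R]_(n, m)) :
  exists2 C, 0 < C & forall x : 'rV[R]_n, `|x *m M| <= C * `|x|.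
Proof.
exists (\sum_i \sum_j `|M i j| + 1).
  by rewrite ltr_wpDl // sumr_ge0 // => i _; rewrite sumr_ge0.
move=> x; apply: row_norm_le.
  by rewrite mulr_ge0 // addr_ge0 // sumr_ge0 // => i _; rewrite sumr_ge0.
move=> j; rewrite mxE; apply: le_trans (ler_norm_sum _ _ _) _.
rewrite mulrDl mulr_suml mul1r; apply: ler_wpDr => //.
apply: ler_sum => i _; rewrite normrM mulrC; apply: ler_pM => //; last exact: row_norm_coord.
by rewrite (bigD1 j) //= lerDl sumr_ge0.
Qed.

Section InverseFunction.
Context {n : nat} (U : set 'rV[R]_n) (F : 'rV[R]_n -> 'rV[R]_n) (x0 : 'rV[R]_n).
Hypotheses (oU : open U) (CF : smooth U F) (Ux0 : U x0) (J0 : jac F x0 \in unitmx).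

Lemma jac_unit_near : \forall x \near x0, U x /\ jac F x \in unitmx.
Proof.
have c : {for x0, continuous (fun x => \det (jac F x))}.
  by apply: (Ck_cont (k := 0) _ Ux0); apply: Ck_det => // i j; exact: Ck_jac.
have d0 : \det (jac F x0) != 0 by rewrite -unitfE -unitmxE.
apply: filterI; first exact: open_nbhs_nbhs.
have : \forall x \near x0, \det (jac F x) != 0.
  have nn : nbhs (\det (jac F x0)) [set t : R | t != 0].
    by apply: open_nbhs_nbhs; split => //; exact: open_neq.
  exact: (c _ nn).
by apply: filterS => x; rewrite unitmxE unitfE.
Qed.

Let A := jac F x0.
Let H (x : 'rV[R]_n) := x - F x *m invmx A.

(** The derivative of H : x |-> x - F x (jac F x0)^-1 vanishes at x0. *)
Lemma ift_lip : exists2 r, 0 < r & (forall x, ball x0 r x -> U x /\ jac F x \in unitmx) /\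
  forall x y, ball x0 r x -> ball x0 r y -> `|H x - H y| <= 2^-1 * `|x - y|.
Proof.
have C1F : Ck 1 U F := CF 1%N.
have CH : Ck 1 U H.
  apply/Ck_rowP => // j.
  apply: (@Ck_ext _ _ _ _ (fun x => x 0 j + - (F x *m invmx A) 0 j)) => //.
    by move=> y _; rewrite !mxE.
  apply: CkD => //; first exact: Ck_coord.
  apply: CkN => //; apply: (@Ck_mulmx n U oU 1 1 n n F (fun=> invmx A)) => // [i l|i l].
    by rewrite (ord1 i); exact: (Ck_rowP _ _ oU).1 C1F l.
  exact: Ck_cst.
have D0 v : 'D_v H x0 = 0.
  have dF := Ck_derivable (v := v) C1F Ux0.
  have [d1 E1] := derive_mulmxr (invmx A) dF.
  rewrite (deriveB (@derivable_id _ _ x0 v) d1) derive_id E1 (derive_jac _ oU C1F Ux0).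
  by rewrite mulmxK // subrr.
have h0 : 0 < 2^-1 :> R by rewrite invr_gt0.
have [r1 r10 [b1 L]] := local_lipschitz oU CH Ux0 D0 h0.
have [r2 /= r20 b2] := (nbhs_ballP _ _).1 jac_unit_near.
exists (Num.min r1 r2); first by rewrite lt_min r10 r20.
split=> [x bx|x y bx byy]; first by apply: b2; apply: le_ball bx; rewrite ge_min lexx orbT.
by apply: L; [apply: le_ball bx|apply: le_ball byy]; rewrite ge_min lexx.
Qed.

(** The equation F x = y says that x is fixed by x |-> H x + y (jac F x0)^-1,
    which is a contraction of a small closed ball.  The Lipschitz bound on H
    makes the inverse theta Lipschitz; then theta is differentiable with
    derivative (jac F (theta y))^-1, and this formula raises the regularity of
    theta one order at a time. *)
Lemma inverse_function : exists B V (theta : 'rV[R]_n -> 'rV[R]_n),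
  [/\ open B /\ B x0, open V /\ V (F x0), B `<=` U,
      forall x, B x -> V (F x) -> theta (F x) = x &
      smooth V theta /\ forall y, V y -> B (theta y) /\ F (theta y) = y].
Proof.
have [r r0 [br L]] := ift_lip.
pose rho := r / 2.
have rho0 : 0 < rho by rewrite divr_gt0.
have rhor : rho < r by rewrite /rho ltr_pdivrMr // ltr_pMr // ltr1n.
pose q (y : 'rV[R]_n) := (y - F x0) *m invmx A.
pose K := closed_ball x0 rho.
have KE x : K x <-> `|x0 - x| <= rho by rewrite /K closed_ballE.
have Kb x : K x -> ball x0 r x.
  by move=> /KE Kx; rewrite -ball_normE /=; exact: le_lt_trans rhor.
pose V := [set y : 'rV[R]_n | `|q y| < rho / 2].
have cq y : {for y, continuous q}.
  have -> : q = (fun y => y *m invmx A - F x0 *m invmx A).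
    by apply/funext => z; rewrite /q mulmxBl.
  by apply: continuousB; [exact: continuous_mulmxr|exact: cst_continuous].
have oV : open V.
  have -> : V = (fun y => `|q y|) @^-1` [set t | t < rho / 2] by [].
  apply: open_comp; last exact: open_lt.
  move=> y _; apply: (@continuous_comp _ _ _ q (fun z => `|z|)); first exact: cq.
  exact: norm_continuous.
have VF0 : V (F x0) by rewrite /V /= /q subrr mul0mx normr0 divr_gt0.
pose T y x := H x + y *m invmx A.
have TE y x : T y x = x <-> F x = y.
  rewrite /T /H; split=> [E|->]; last by rewrite subrK.
  apply: (can_inj (mulmxKV J0)); apply/eqP; rewrite -subr_eq0; apply/eqP.
  rewrite -/A; move: (F x *m _) (y *m _) E => a b /rowP E.
  by apply/rowP => i; have := E i; rewrite !mxE => Ei; lra.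
have Tq y x : T y x - x0 = (H x - H x0) + q y.
  by rewrite /T /q mulmxBl /H opprB !addrA; apply/rowP => i; rewrite !mxE; ring.
have x0b : ball x0 r x0 by exact: ballxx.
have TK y x : V y -> K x -> K (T y x).
  move=> Vy Kx; apply/KE; rewrite distrC Tq; apply: le_trans (ler_normD _ _) _.
  have -> : rho = 2^-1 * rho + rho / 2 by lra.
  apply: lerD; last exact: ltW.
  apply: le_trans (L _ _ (Kb _ Kx) x0b) _.
  by rewrite ler_wpM2l ?invr_ge0 // distrC; apply/KE.
have Tc y x z : K x -> K z -> `|T y x - T y z| <= 2^-1 * `|x - z|.
  move=> Kx Kz; rewrite /T opprD addrACA subrr addr0.
  by apply: L; exact: Kb.
have bil x z : ball x0 r x -> ball x0 r z -> `|x - z| <= 2 * `|(F x - F z) *m invmx A|.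
  move=> bx bz; have := L x z bx bz.
  have E : x - z = (H x - H z) + (F x - F z) *m invmx A.
    by rewrite mulmxBl /H; apply/rowP => i; rewrite !mxE; ring.
  have := ler_normD (H x - H z) ((F x - F z) *m invmx A); rewrite -E.
  set a := `|x - z|; set b := `|H x - H z|; set c := `|_ *m _|; lra.
have /choice[theta thP] : forall y, exists x : 'rV[R]_n, V y -> ball x0 rho x /\ F x = y.
  move=> y; have [Vy|nV] := pselect (V y); last by exists x0.
  have K0 : K !=set0 by exists x0; apply/KE; rewrite subrr normr0 ltW.
  have [x Kx xT] := fixed_point_half (@closed_ball_closed _ _ x0 rho) K0 (TK y ^~ Vy) (Tc y).
  have Fx : F x = y by apply/TE.
  exists x => _; split => //.
  rewrite -ball_normE /= distrC; apply: le_lt_trans (bil _ _ (Kb _ Kx) x0b) _.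
  by rewrite Fx; move: Vy; rewrite /V /= /q => Vy; rewrite mulrC -ltr_pdivlMr.
have thb y : V y -> ball x0 r (theta y).
  by move=> /thP[+ _]; apply: le_ball; exact: ltW.
have [C C0 HC] := mulmx_norm_le (invmx A).
have thL y z : V y -> V z -> `|theta y - theta z| <= 2 * C * `|y - z|.
  move=> Vy Vz; apply: le_trans (bil _ _ (thb _ Vy) (thb _ Vz)) _.
  by rewrite (thP y Vy).2 (thP z Vz).2 -mulrA ler_wpM2l.
have thc y : V y -> {for y, continuous theta}.
  move=> Vy; apply: continuous_at_dist => e e0.
  have e1 : 0 < e / (2 * C) by rewrite divr_gt0 // mulr_gt0.
  have n1 : \forall z \near y, `|y - z| <= e / (2 * C).
    by apply/nbhs_ballP; exists (e / (2 * C)) => //= z; rewrite -ball_normE /= => /ltW.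
  apply: filterS (filterI (open_nbhs_nbhs (conj oV Vy)) n1) => z [Vz yz].
  apply: le_trans (thL _ _ Vy Vz) _.
  by rewrite mulrC -ler_pdivlMr // mulr_gt0.
have thd y w : V y -> derivable theta y w /\ 'D_w theta y = w *m invmx (jac F (theta y)).
  move=> Vy; pose x := theta y; have [Ux uJ] := br _ (thb _ Vy).
  have C1F : Ck 1 U F := CF 1%N.
  pose G (z : 'rV[R]_n) := F z - z *m jac F x.
  have CG : Ck 1 U G.
    apply/Ck_rowP => // j.
    apply: (@Ck_ext _ _ _ _ (fun z => F z 0 j + - (z *m jac F x) 0 j)) => //.
      by move=> z _; rewrite !mxE.
    apply: CkD => //; first exact: (Ck_rowP _ _ oU).1 C1F j.
    apply: CkN => //; apply: (@Ck_mulmx n U oU 1 1 n n id (fun=> jac F x)) => // [i l|i l].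
      by rewrite (ord1 i); exact: Ck_coord.
    exact: Ck_cst.
  have D0 v : 'D_v G x = 0.
    have dF := Ck_derivable (v := v) C1F Ux.
    have [d1 E1] := derive_mulmxr (jac F x) (@derivable_id _ _ x v).
    by rewrite (deriveB dF d1) E1 derive_id (derive_jac _ oU C1F Ux) subrr.
  have H1 : (fun h : R => h^-1 *: ((theta \o shift y) (h *: w) - theta y) *m jac F x) @ 0^' --> w.
    apply/cvgrPdist_le => e e0.
    pose M := 2 * C * (`|w| + 1).
    have M0 : 0 < M by rewrite /M !mulr_gt0 // ltr_wpDl.
    have eM : 0 < e / M by rewrite divr_gt0.
    have [d d0 [_ Ld]] := local_lipschitz oU CG Ux D0 eM.
    have nb : \forall z \near y, V z /\ ball x d (theta z).
      apply: filterI; first exact: open_nbhs_nbhs.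
      by apply: thc => //; exact: nbhsx_ballx.
    have [d' /= d'0 bd'] := (nbhs_ballP _ _).1 nb.
    near=> h.
    have h0 : h != 0 by near: h; exact: nbhs_dnbhs_neq.
    have hd : `|h| < d' / (`|w| + 1).
      by near: h; apply: dnbhs0_lt; rewrite divr_gt0 // ltr_wpDl.
    have [Vz bz] : V (h *: w + y) /\ ball x d (theta (h *: w + y)).
      apply: bd'; rewrite -ball_normE /= opprD addrCA subrr addr0 normrN normrZ.
      rewrite ltr_pdivlMr ?ltr_wpDl // in hd; apply: le_lt_trans hd.
      by rewrite ler_wpM2l // lerDl.
    rewrite /= -(ler_pM2l (_ : 0 < `|h|)) ?normr_gt0 // -normrZ.
    set z := theta (h *: w + y) in bz *.
    have -> : h *: (w - (h^-1 *: (z - theta y)) *m jac F x) = G z - G x.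
      rewrite scalerBr -scalemxAl scalerA divff // scale1r /G.
      rewrite (thP _ Vz).2 (thP _ Vy).2 mulmxBl -/x.
      by rewrite !opprB !addrA; apply/rowP => i; rewrite !mxE; ring.
    apply: le_trans (Ld _ _ bz (ballxx _ d0)) _.
    apply: (@le_trans _ _ (e / M * (2 * C * (`|h| * `|w|)))).
      apply: ler_wpM2l; first exact: ltW.
      apply: le_trans (thL _ _ Vz Vy) _.
      by rewrite addrK normrZ.
    rewrite [leLHS](_ : _ = `|h| * (e * (`|w| / (`|w| + 1)))); last first.
      rewrite /M; field.
      by rewrite !gt_eqF // ltr_wpDl.
    rewrite ler_pM2l ?normr_gt0 //; apply: ler_piMr; first exact: ltW.
    by rewrite ler_pdivrMr ?ltr_wpDl // mul1r lerDl.
  have H2 : (fun h : R => h^-1 *: ((theta \o shift y) (h *: w) - theta y)) @ 0^'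
     --> w *m invmx (jac F x).
    have -> : (fun h : R => h^-1 *: ((theta \o shift y) (h *: w) - theta y)) =
      (fun v => v *m invmx (jac F x)) \o
        (fun h : R => h^-1 *: ((theta \o shift y) (h *: w) - theta y) *m jac F x).
      by apply/funext => h /=; rewrite mulmxK.
    exact: (cvg_comp _ _ H1 (continuous_mulmxr (M:=invmx (jac F x)) (x := w))).
  by split; [exact: (cvgP _ H2)|exact: (cvg_lim _ H2)].
exists (ball x0 rho), V, theta; split.
- by split; [exact: ball_open|exact: ballxx].
- by [].
- by move=> x bx; apply: (br x _).1; apply: le_ball bx; exact: ltW.
- move=> x bx Vx; have bx' : ball x0 r x by apply: le_ball bx; exact: ltW.
  apply/eqP; rewrite -subr_eq0 -normr_eq0 eq_le normr_ge0 andbT.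
  apply: le_trans (bil _ _ (thb _ Vx) bx') _.
  by rewrite (thP _ Vx).2 subrr mul0mx normr0 mulr0.
- split=> [k|]; last exact: thP.
  elim: k => [|k IH]; first by split=> // y; exact: thc.
  split=> [y|w]; first exact: thc.
  split=> [y Vy|]; first by have [] := thd y w Vy.
  apply/Ck_rowP => // j.
  pose g (x : 'rV[R]_n) := (w *m invmx (jac F x)) 0 j.
  apply: (@Ck_ext _ _ _ _ (g \o theta)) => //.
    by move=> y Vy; have [_ ->] := thd y w Vy.
  apply: (@Ck_comp _ _ _ V (ball x0 rho)) => //.
  + exact: ball_open.
  + by move=> y /thP[].
  + have bU : ball x0 rho `<=` U.
      by move=> x bx; apply: (br x _).1; apply: le_ball bx; exact: ltW.
    apply: Ck_mulmx => //; first exact: ball_open.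
      by move=> a b; apply: Ck_cst; exact: ball_open.
    apply: Ck_invmx => //; first exact: ball_open.
      move=> a b; apply: (Ck_sub bU); exact: Ck_jac.
    by move=> x bx; apply: (br x _).2; apply: le_ball bx; exact: ltW.
Unshelve. all: by end_near. Qed.

End InverseFunction.

(** * Averages along rays and the Poincare lemma *)

Definition int01 (f : R -> R) : R := \int[lebesgue_measure]_(t in `[0%R, 1%R]) f t.

Definition continuous01 (f : R -> R) := forall t : R, 0 <= t <= 1 -> {for t, continuous f}.

Lemma continuous01_within f : continuous01 f -> {within `[0, 1], continuous f}.
Proof.
move=> cf; apply: continuous_in_subspaceT => t; rewrite inE /= in_itv /=; exact: cf.
Qed.

Lemma continuous01_integrable f : continuous01 f ->
  (@lebesgue_measure R).-integrable `[0%R, 1%R] (EFin \o f).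
Proof.
move=> cf; apply: continuous_compact_integrable; first exact: segment_compact.
exact: continuous01_within.
Qed.

Lemma int01D f g : continuous01 f -> continuous01 g ->
  int01 (fun t => f t + g t) = int01 f + int01 g.
Proof. by move=> cf cg; apply: RintegralD => //; exact: continuous01_integrable. Qed.

Lemma int01Z c f : continuous01 f -> int01 (fun t => c * f t) = c * int01 f.
Proof. by move=> cf; apply: RintegralZl => //; exact: continuous01_integrable. Qed.

Lemma int01_sum (I : Type) (r : seq I) (f : I -> R -> R) :
  (forall i, continuous01 (f i)) ->
  int01 (fun t => \sum_(i <- r) f i t) = \sum_(i <- r) int01 (f i).
Proof.
move=> cf; elim: r => [|i r IH].
  have c0 : continuous01 (cst 0) by move=> t _; exact: cst_continuous.
  rewrite [RHS]big_nil -[RHS](mul0r (int01 (cst 0))) -int01Z //.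
  by congr int01; apply/funext => t; rewrite big_nil mul0r.
rewrite big_cons -IH -int01D //; first by congr int01; apply/funext => t; rewrite big_cons.
move=> t t01; elim: r {IH} => [|j r IH].
  by apply: (@eq_continuous_at _ _ (cst 0)); [near=> x; rewrite big_nil|exact: cst_continuous].
apply: (@eq_continuous_at _ _ (fun t => f j t + \sum_(j <- r) f j t)).
  by near=> x; rewrite big_cons.
by apply: continuousD => //; exact: cf.
Unshelve. all: by end_near. Qed.

Lemma int01_FTC (F f : R -> R) : continuous01 f -> (forall t : R, 0 <= t <= 1 -> is_derive t 1 F (f t)) ->
  int01 f = F 1 - F 0.
Proof.
move=> cf dF.
have cF t : 0 <= t <= 1 -> {for t, continuous F}.
  by move=> /dF d; apply/differentiable_continuous/derivable1_diffP; exact: ex_derive.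
have H0 : ((0 : R) <= 0) && ((0 : R) <= 1) by rewrite lexx ler01.
have H1 : ((0 : R) <= 1) && ((1 : R) <= 1) by rewrite lexx ler01.
rewrite /int01 /Rintegral (@continuous_FTC2 R f F 0 1 ltr01).
- by rewrite -EFinB.
- exact: continuous01_within.
- split.
  + move=> t; rewrite in_itv /= => /andP[t0 t1].
    by have := dF t; rewrite !ltW // => /(_ isT) d; exact: ex_derive.
  + by apply: cvg_at_right_filter; exact: cF.
  + by apply: cvg_at_left_filter; exact: cF.
- move=> t; rewrite in_itv /= => /andP[t0 t1].
  by have := dF t; rewrite !ltW // => /(_ isT) d; rewrite derive1E derive_val.
Qed.

Lemma int01_norm_le (M : R) (f : R -> R) : continuous01 f -> (forall t, 0 <= t <= 1 -> `|f t| <= M) ->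
  `|int01 f| <= M.
Proof.
move=> cf fM.
have cn : continuous01 (fun t => `|f t|).
  by move=> t /cf ct; apply: (cvg_comp _ _ ct); exact: norm_continuous.
have cM : continuous01 (cst M) by move=> t _; exact: cst_continuous.
have L1 : `|int01 f| <= int01 (fun t => `|f t|).
  by apply: le_normr_Rintegral => //; exact: continuous01_integrable.
have L2 : int01 (fun t => `|f t|) <= int01 (cst M).
  by apply: le_Rintegral => //; exact: continuous01_integrable.
have L3 : int01 (cst M) = M.
  have dM (t : R) : 0 <= t <= 1 -> is_derive t 1 (M *: (id : R -> R)) (cst M t).
    by move=> _; apply: is_derive_eq; exact: mulr1.
  by rewrite (int01_FTC cM dM) !fctE -[LHS]/(M * 1 - M * 0) mulr1 mulr0 subr0.
by rewrite -L3; exact: le_trans L1 L2.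
Qed.

Section RayAverage.
Context {n : nat} (b : 'rV[R]_n) (r : R).
Let V := ball b r.

(** The weight t ^+ m is there because differentiating x |-> B (b + t (x - b))
    produces one more factor t ([ray_average_derive]). *)
Definition ray_average m (B : 'rV[R]_n -> R) (x : 'rV[R]_n) :=
  int01 (fun t => t ^+ m * B (b + t *: (x - b))).

Lemma ray_ball s t x : ball b s x -> 0 <= t <= 1 -> ball b s (b + t *: (x - b)).
Proof.
move=> bx t01; have s0 : 0 < s by move: bx; rewrite -ball_normE /=; apply: le_lt_trans.
exact: ball_segment bx (ballxx _ s0) t01.
Qed.

Lemma continuous_ray (x : 'rV[R]_n) (t : R) : {for t, continuous (fun t : R => b + t *: (x - b))}.
Proof.
apply: continuousD; first exact: cst_continuous.
by apply: continuousZr_tmp; exact: cvg_id.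
Qed.

Lemma ray_continuous01 m k B x : Ck k V B -> V x ->
  continuous01 (fun t => t ^+ m * B (b + t *: (x - b))).
Proof.
move=> CB Vx t t01; apply: continuousM; first exact: exprn_continuous.
apply: (cvg_comp _ _ (@continuous_ray x t)).
by apply: (Ck_cont CB); exact: ray_ball.
Qed.

(** On a smaller concentric ball, relatively compact in the given one, the
    partial derivatives are bounded. *)
Lemma Ck1_lipschitz (B : 'rV[R]_n -> R) x : Ck 1 V B -> V x ->
  exists s M, [/\ ball b s x, s < r & 0 < M] /\
    forall y z, ball b s y -> ball b s z -> `|B y - B z| <= M * `|y - z|.
Proof.
move=> CB Vx.
have [s bsx sr] : exists2 s, ball b s x & s < r.
  exists ((`|b - x| + r) / 2); move: Vx; rewrite /V -ball_normE /= => h; lra.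
have s0 : 0 < s by move: bsx; rewrite -ball_normE /=; apply: le_lt_trans.
have cK : compact (closed_ball b s).
  apply: bounded_closed_compact; last exact: closed_ball_closed.
  exists (`|b| + s); split; first exact: num_real.
  move=> y hy x'; rewrite closed_ballE // /closed_ball_ /= => bx'; apply: le_trans (ltW hy).
  by rewrite -[x'](subrK b) addrC (le_trans (ler_normD _ _)) // lerD2l distrC.
have KV : closed_ball b s `<=` V.
  by move=> y; rewrite closed_ballE // /V -ball_normE /closed_ball_ /= => /le_lt_trans; exact.
have K0 : closed_ball b s !=set0 by exists b; apply: closed_ballxx.
have /choice[M HM] : forall i : 'I_n, exists M, 0 <= M /\
    forall y, closed_ball b s y -> `|'D_(delta_mx 0 i) B y| <= M.
  move=> i; have CD := Ck_derive (delta_mx 0 i) CB.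
  have cn : {within closed_ball b s, continuous (fun y => `|'D_(delta_mx 0 i) B y|)}.
    apply: continuous_in_subspaceT => y /set_mem Ky.
    apply: (cvg_comp _ _ (Ck_cont CD (KV _ Ky))); exact: norm_continuous.
  have [c /set_mem Kc Hc] := EVT_max_rV K0 cK cn.
  exists (`|'D_(delta_mx 0 i) B c|); split => // y Ky; apply: Hc; exact: mem_set.
exists s, (\sum_i M i + 1); split; first split => //.
  by rewrite ltr_wpDl // sumr_ge0 // => i _; have [] := HM i.
move=> y z by_ bz.
have bs (t : R) : 0 <= t <= 1 -> ball b s (z + t *: (y - z)) by exact: ball_segment.
have sV : ball b s `<=` V by move=> u bu; apply: le_ball bu; exact: ltW.
have dd (t : R) : 0 <= t <= 1 -> derivable B (z + t *: (y - z)) (y - z).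
  by move=> /bs/sV Vs; exact: Ck_derivable CB Vs.
have [t t01 E] := mvt_dir dd.
rewrite [z + (y - z)]addrC subrK in E.
rewrite E (C1_deriveE _ (ball_open b r) (Ck_C1 CB) (sV _ (bs _ t01))).
apply: le_trans (ler_norm_sum _ _ _) _.
rewrite mulrDl mulr_suml; apply: ler_wpDr; first by rewrite mul1r.
apply: ler_sum => i _; rewrite normrM mulrC; apply: ler_pM => //.
  by have [_] := HM i; apply; apply: subset_closed_ball; exact: bs.
exact: row_norm_coord.
Qed.

Lemma ray_average_lipschitz m B x : Ck 1 V B -> V x ->
  exists s M, [/\ ball b s x, s < r & 0 < M] /\
    forall y z, ball b s y -> ball b s z ->
      `|ray_average m B y - ray_average m B z| <= M * `|y - z|.
Proof.
move=> CB Vx; have [s [M [[bsx sr M0] L]]] := Ck1_lipschitz CB Vx.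
exists s, M; split=> // y z by_ bz.
have sV : ball b s `<=` V by move=> u bu; apply: le_ball bu; exact: ltW.
have cy := ray_continuous01 (m := m) CB (sV _ by_).
have cz := ray_continuous01 (m := m) CB (sV _ bz).
rewrite /ray_average -[X in _ + X]mulN1r -int01Z // -int01D //; last first.
  by move=> t t01; apply: continuousM; [exact: cst_continuous|exact: cz].
apply: int01_norm_le.
  move=> t t01; apply: continuousD; first exact: cy.
  by apply: continuousM; [exact: cst_continuous|exact: cz].
move=> t t01; rewrite mulN1r -mulrBr normrM.
have /andP[t0 t1] := t01.
apply: (@le_trans _ _ (1 * (M * (t * `|y - z|)))).
  apply: ler_pM => //; first by rewrite normrX exprn_ile1 // ger0_norm.
  apply: le_trans (L _ _ (ray_ball by_ t01) (ray_ball bz t01)) _.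
  rewrite opprD addrACA subrr add0r -scalerBr opprB addrA subrK normrZ ger0_norm //.
rewrite mul1r ler_pM2l // ler_piMl //.
Qed.

(** Differentiation under the integral sign; the difference quotients converge
    uniformly in t because 'D_v B is Lipschitz near x. *)
Lemma ray_average_derive m B x v : Ck 2 V B -> V x ->
  derivable (ray_average m B) x v /\
  'D_v (ray_average m B) x = ray_average m.+1 ('D_v B) x.
Proof.
move=> CB Vx; have CD := Ck_derive v CB.
have [s [M [[bsx sr M0] L]]] := Ck1_lipschitz CD Vx.
have sV : ball b s `<=` V by move=> u bu; apply: le_ball bu; exact: ltW.
have s0 : 0 < s by move: bsx; rewrite -ball_normE /=; apply: le_lt_trans.
suff H : (fun h : R => h^-1 *: ((ray_average m B \o shift x) (h *: v) - ray_average m B x)) @ 0^'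
   --> ray_average m.+1 ('D_v B) x.
  by split; [exact: (cvgP _ H)|exact: (cvg_lim _ H)].
apply/cvgrPdist_le => e e0.
have [d /= d0 bd] : nbhs_ball x (ball b s).
  by apply/nbhs_ballP; apply: open_nbhs_nbhs; split; [exact: ball_open|].
near=> h.
have h0 : h != 0 by near: h; exact: nbhs_dnbhs_neq.
have v1 : 0 < `|v| + 1 by rewrite ltr_wpDl.
have hd : `|h| < d / (`|v| + 1).
  by near: h; apply: dnbhs0_lt; rewrite divr_gt0.
have he : `|h| < e / (M * (`|v| + 1)).
  by near: h; apply: dnbhs0_lt; rewrite divr_gt0 // mulr_gt0.
have bxh : ball b s (h *: v + x).
  apply: bd; rewrite -ball_normE /= opprD addrCA subrr addr0 normrN normrZ.
  rewrite ltr_pdivlMr // in hd; apply: le_lt_trans hd.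
  by rewrite ler_wpM2l // lerDl.
have c1 := ray_continuous01 (m := m) CB (sV _ bxh).
have c2 := ray_continuous01 (m := m) CB (sV _ bsx).
have c3 := ray_continuous01 (m := m.+1) CD (sV _ bsx).
rewrite distrC -(ler_pM2l (_ : 0 < `|h|)) ?normr_gt0 // -normrM mulrBr.
rewrite -[h^-1 *: _]/(h^-1 * _) mulVKf //= /ray_average.
have c2' : continuous01 (fun t => -1 * (t ^+ m * B (b + t *: (x - b)))).
  by move=> t t01; apply: continuousM; [exact: cst_continuous|exact: c2].
have c12 : continuous01 (fun t => t ^+ m * B (b + t *: (h *: v + x - b)) +
    -1 * (t ^+ m * B (b + t *: (x - b)))).
  by move=> t t01; apply: continuousD; [exact: c1|exact: c2'].
have c3' : continuous01 (fun t => - h * (t ^+ m.+1 * 'D_v B (b + t *: (x - b)))).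
  by move=> t t01; apply: continuousM; [exact: cst_continuous|exact: c3].
rewrite -[- int01 _]mulN1r -[- (h * _)]mulNr -(int01Z _ c2) -(int01Z _ c3).
rewrite -(int01D c1 c2') -(int01D c12 c3').
apply: int01_norm_le.
  by move=> t t01; apply: continuousD; [exact: c12|exact: c3'].
move=> t t01; have /andP[t0 t1] := t01.
pose z := b + t *: (x - b).
have Ez : b + t *: (h *: v + x - b) = z + (t * h) *: v.
  by rewrite /z; apply/rowP => i; rewrite !mxE; ring.
rewrite Ez mulN1r -mulrBr.
have bz : ball b s z by exact: ray_ball bsx t01.
have bz1 : ball b s (z + (t * h) *: v) by rewrite -Ez; exact: ray_ball bxh t01.
have bs (q : R) : 0 <= q <= 1 -> ball b s (z + q *: ((t * h) *: v)).
  move=> q01; have := ball_segment bz1 bz q01.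
  by rewrite (addrC z ((t * h) *: v)) addrK.
have dd (q : R) : 0 <= q <= 1 -> derivable B (z + q *: ((t * h) *: v)) ((t * h) *: v) /\
    'D_((t * h) *: v) B (z + q *: ((t * h) *: v)) = (t * h) * 'D_v B (z + q *: ((t * h) *: v)).
  move=> /bs/sV Vq; have dq := Ck_derivable (v := v) CB Vq.
  by have [] := derivable_scale (t * h) dq.
have [q q01 ->] := mvt_dir (fun q q01 => (dd q q01).1).
have [_ ->] := dd q q01.
rewrite exprS (_ : _ + _ = t ^+ m * (t * h) * ('D_v B (z + q *: ((t * h) *: v)) - 'D_v B z)); last first.
  by move: ('D_v B z) ('D_v B _) => a a'; ring.
rewrite !normrM.
have Lq := L _ _ (bs q q01) bz.
have tm : `|t ^+ m| <= 1 by rewrite normrX exprn_ile1 // ger0_norm.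
apply: (@le_trans _ _ (1 * (1 * `|h|) * (M * (`|h| * `|v|)))).
  apply: ler_pM; rewrite ?mulr_ge0 //.
    apply: ler_pM; rewrite ?mulr_ge0 //.
    by rewrite (ger0_norm t0) ler_wpM2r.
  apply: le_trans Lq _; rewrite ler_pM2l // addrC addKr scalerA normrZ.
  apply: ler_wpM2r => //; rewrite !normrM mulrA ler_piMl // ger0_norm; last by case/andP: q01.
  by rewrite (ger0_norm t0) mulr_ile1 //; case/andP: q01.
rewrite !mul1r ler_pM2l ?normr_gt0 //.
rewrite ltr_pdivlMr ?mulr_gt0 // in he; apply: le_trans (ltW he).
rewrite mulrCA ler_wpM2l // ler_pM2l // lerDl //.
Unshelve. all: by end_near. Qed.

Lemma ray_average_Ck k : forall m B, smooth V B -> Ck k V (ray_average m B).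
Proof.
have oV : open V by exact: ball_open.
have cont m B x : smooth V B -> V x -> {for x, continuous (ray_average m B)}.
  move=> CB Vx; have [s [M [[bsx sr M0] L]]] := ray_average_lipschitz m (CB 1%N) Vx.
  apply: continuous_at_dist => e e0.
  have n1 : \forall z \near x, `|x - z| <= e / M.
    apply/nbhs_ballP; exists (e / M) => //=; first by rewrite divr_gt0.
    by move=> z; rewrite -ball_normE /= => /ltW.
  have n2 : \forall z \near x, ball b s z by apply: open_nbhs_nbhs; split; [exact: ball_open|].
  apply: filterS (filterI n1 n2) => z [xz bz].
  by apply: le_trans (L _ _ bsx bz) _; rewrite mulrC -ler_pdivlMr.
elim: k => [|k IH] m B CB; first by split=> // x Vx; exact: cont.
split=> [x Vx|v]; first exact: cont.
split=> [x Vx|]; first by have [] := ray_average_derive m v (CB 2%N) Vx.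
apply: (Ck_ext oV _ (IH m.+1 ('D_v B) _)) => [y Vy|j].
  by have [_ ->] := ray_average_derive m v (CB 2%N) Vy.
exact: Ck_derive (CB j.+1).
Qed.

End RayAverage.

Section Poincare.
Context {n : nat} (b : 'rV[R]_n) (r : R) (B : 'I_n -> 'rV[R]_n -> R).
Let V := ball b r.
Hypothesis CB : forall i, smooth V (B i).

Definition radial_primitive (x : 'rV[R]_n) : R :=
  \sum_i (x - b) 0 i * ray_average b 0 (B i) x.

Lemma radial_primitive_smooth : smooth V radial_primitive.
Proof.
have oV : open V by exact: ball_open.
move=> k; apply: Ck_sum => // i; apply: CkM => //; last exact: ray_average_Ck.
apply: (@Ck_ext _ _ _ _ (fun x : 'rV[R]_n => x 0 i + - b 0 i)) => //.
  by move=> y _; rewrite !mxE.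
by apply: CkD => //; [exact: Ck_coord|exact: Ck_cst].
Qed.

(** The Poincare lemma on a ball.  Since the form B is closed along the ray, the
    derivative of the primitive along v is the integral over t of the
    derivative of t (B, v) (b + t (x - b)). *)
Lemma radial_primitive_derive x : V x ->
  (forall t : R, 0 <= t <= 1 -> forall u v : 'rV[R]_n,
     'D_u (fun y => \sum_i v 0 i * B i y) (b + t *: (x - b)) =
     'D_v (fun y => \sum_i u 0 i * B i y) (b + t *: (x - b))) ->
  forall v, 'D_v radial_primitive x = \sum_i v 0 i * B i x.
Proof.
move=> Vx closed_ v.
have oV : open V by exact: ball_open.
have Vray (t : R) : 0 <= t <= 1 -> V (b + t *: (x - b)) by move=> t01; exact: ray_ball.
pose Bv (u : 'rV[R]_n) y := \sum_i u 0 i * B i y.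
have CBv u : smooth V (Bv u).
  by move=> k; apply: Ck_sum => // i; apply: CkM => //; [exact: Ck_cst|exact: CB].
have dBv (u w : 'rV[R]_n) y : V y -> 'D_w (Bv u) y = \sum_i u 0 i * 'D_w (B i) y.
  move=> Vy.
  have -> : Bv u = \sum_i (fun y => u 0 i * B i y).
    by apply/funext => z; rewrite /Bv fct_sumE.
  rewrite derive_sum; last first.
    by move=> i; apply: derivableM; [exact: derivable_cst|exact: Ck_derivable (CB i 1%N) Vy].
  apply: eq_bigr => i _; rewrite -[RHS]/(_ *: _) -deriveZ //.
  exact: Ck_derivable (CB i 1%N) Vy.
have c0 i : continuous01 (fun t => B i (b + t *: (x - b))).
  have := ray_continuous01 (m := 0) (CB i 0) Vx.
  by under eq_fun do rewrite expr0 mul1r.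
have c1 i : continuous01 (fun t => t ^+ 1 * 'D_v (B i) (b + t *: (x - b))).
  exact: ray_continuous01 (Ck_derive v (CB i 1%N)) Vx.
have E1 : 'D_v radial_primitive x =
  \sum_i (v 0 i * int01 (fun t => B i (b + t *: (x - b))) +
     (x - b) 0 i * int01 (fun t => t ^+ 1 * 'D_v (B i) (b + t *: (x - b)))).
  have -> : radial_primitive = \sum_i (fun x => (x - b) 0 i * ray_average b 0 (B i) x).
    by apply/funext => z; rewrite /radial_primitive fct_sumE.
  have dc i : derivable (fun x : 'rV[R]_n => (x - b) 0 i) x v /\
     'D_v (fun x : 'rV[R]_n => (x - b) 0 i) x = v 0 i.
    have -> : (fun x : 'rV[R]_n => (x - b) 0 i) = (fun x => x 0 i) - cst (b 0 i).
      by apply/funext => z; rewrite !fctE !mxE.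
    have [d0 E0] := derive_coord x v i; have d1 := derivable_cst (b 0 i) x v.
    split; first exact: derivableB.
    by rewrite (deriveB d0 d1) E0 derive_cst subr0.
  have da i := ray_average_derive 0 v (CB i 2%N) Vx.
  rewrite derive_sum; last by move=> i; apply: derivableM; [exact: (dc i).1|exact: (da i).1].
  apply: eq_bigr => i _; rewrite (deriveM (dc i).1 (da i).1) (dc i).2 (da i).2.
  rewrite addrC /ray_average; congr (_ + _).
  rewrite -[LHS]/(_ * _) mulrC; congr (_ * int01 _).
  by apply/funext => t; rewrite expr0 mul1r.
have E2 : 'D_v radial_primitive x =
   int01 (fun t => Bv v (b + t *: (x - b)) + t * 'D_(x - b) (Bv v) (b + t *: (x - b))).
  rewrite E1.
  have cc0 i : continuous01 (fun t => v 0 i * B i (b + t *: (x - b))).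
    by move=> t t01; apply: continuousM; [exact: cst_continuous|exact: c0].
  have cc1 i : continuous01 (fun t => (x - b) 0 i * (t ^+ 1 * 'D_v (B i) (b + t *: (x - b)))).
    by move=> t t01; apply: continuousM; [exact: cst_continuous|exact: c1].
  have ccc i : continuous01 (fun t => v 0 i * B i (b + t *: (x - b)) +
      (x - b) 0 i * (t ^+ 1 * 'D_v (B i) (b + t *: (x - b)))).
    by move=> t t01; apply: continuousD; [exact: cc0|exact: cc1].
  under eq_bigr => i _ do rewrite -(int01Z _ (c0 i)) -(int01Z _ (c1 i)) -(int01D (cc0 i) (cc1 i)).
  rewrite -(int01_sum _ ccc).
  apply: eq_Rintegral => t; rewrite inE /= in_itv /= => t01.
  rewrite big_split /=; congr (_ + _).
  rewrite -(closed_ t t01 v (x - b)) (dBv _ _ _ (Vray _ t01)) mulr_sumr.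
  by apply: eq_bigr => i _; rewrite expr1 mulrCA.
pose G t := Bv v (b + t *: (x - b)) + t * 'D_(x - b) (Bv v) (b + t *: (x - b)).
have cG : continuous01 G.
  have h0 : continuous01 (fun t => Bv v (b + t *: (x - b))).
    have := ray_continuous01 (m := 0) (CBv v 0) Vx.
    by under eq_fun do rewrite expr0 mul1r.
  have h1 := ray_continuous01 (m := 1) (Ck_derive (x - b) (CBv v 1%N)) Vx.
  move=> t t01; apply: continuousD.
    exact: h0.
  exact: h1.
have dG (t : R) : 0 <= t <= 1 -> is_derive t 1 (fun t : R => t * Bv v (b + t *: (x - b))) (G t).
  move=> t01.
  have d1 := derive_ray (Ck_derivable (v := x - b) (CBv v 1%N) (Vray t t01)).
  have d0 := is_derive_id t (1 : R).
  have [dd dE] := is_deriveM d0 d1.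
  split; first exact: dd.
  by apply: (etrans dE); rewrite addrC /G; congr (_ + _); exact: mulr1.
by rewrite E2 (int01_FTC cG dG) mul1r mul0r subr0 scale1r addrC subrK.
Qed.

End Poincare.

(** * Bump functions *)

(** The function t ^- m exp (- 1 / t), extended by zero.  The powers of t^-1 are
    included so that the family is closed under differentiation. *)
Definition flat (m : nat) (t : R) : R := if 0 < t then t^-1 ^+ m * expR (- t^-1) else 0.

(** From exp s >= s ^+ m.+1 / m.+1! at s = t^-1; this gives continuity and a
    vanishing derivative at 0. *)
Lemma flat_le m (t : R) : 0 < t -> 0 <= flat m t <= m.+1`!%:R * t.
Proof.
move=> t0; rewrite /flat t0 mulr_ge0 ?exprn_ge0 ?expR_ge0 ?invr_ge0 ?(ltW t0) //=.
have ti0 : 0 < t^-1 by rewrite invr_gt0.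
rewrite expRN ler_pdivrMr ?expR_gt0 //.
have := expR_ge1Dxn m (ltW ti0); set E := expR _ => HE.
have f0 : 0 < m.+1`!%:R :> R by rewrite ltr0n fact_gt0.
apply: (@le_trans _ _ (m.+1`!%:R * t * (t^-1 ^+ m.+1 / m.+1`!%:R))).
  by rewrite exprS [leRHS](_ : _ = t^-1 ^+ m) //; field; rewrite !gt_eqF.
by rewrite ler_pM2l ?mulr_gt0 //; apply: le_trans HE; rewrite lerDr.
Qed.

Lemma flat_le0 m (t : R) : t <= 0 -> flat m t = 0.
Proof. by rewrite /flat ltNge => ->. Qed.

Lemma is_derive_flat m (t : R) :
  is_derive t 1 (flat m) (flat m.+2 t - m%:R * flat m.+1 t).
Proof.
case: (ltgtP t 0) => [t0|t0|->].
- rewrite !flat_le0 ?(ltW t0) // mulr0 subr0.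
  apply: (@near_eq_is_derive _ _ _ (cst 0)) (is_derive_cst _ _ _).
  near=> s; rewrite flat_le0 // ltW //; near: s.
  by apply: open_nbhs_nbhs; split; [exact: open_lt|].
- have tn0 : t != 0 by rewrite gt_eqF.
  apply: (@near_eq_is_derive _ _ _ (fun s : R => s^-1 ^+ m * expR (- s^-1))).
    near=> s; rewrite /flat ifT //; near: s.
    by apply: open_nbhs_nbhs; split; [exact: open_gt|].
  have di : is_derive t 1 (fun s : R => s^-1) (- t ^- 2).
    have := @derivableP _ _ _ _ t 1 (derivableV tn0 (@derivable_id _ _ t 1)).
    by rewrite deriveV // derive_id [_ *: _]mulr1.
  have dn : is_derive t 1 (fun s : R => - s^-1) (t ^- 2).
    by have := is_deriveN di; rewrite opprK.
  have de : is_derive t 1 (fun s : R => expR (- s^-1)) (t ^- 2 * expR (- t^-1)).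
    have := @is_derive1_comp _ expR (fun s : R => - s^-1) t _ _ (is_derive_expR (- t^-1)) dn.
    by rewrite mulrC.
  have dX : is_derive t 1 (fun s : R => s^-1 ^+ m) (m%:R * t^-1 ^+ m.-1 * - t ^- 2).
    have := is_deriveX m di; rewrite (_ : _ ^+ m = (fun s : R => s^-1 ^+ m)) //.
    by apply/funext => s; rewrite exprfctE.
  have [dd dE] := is_deriveM dX de.
  split; first exact: dd.
  apply: (etrans dE); rewrite /flat t0; set E := expR _.
  rewrite -[X in X + _ = _]/(t^-1 ^+ m * (t ^- 2 * E)) -[X in _ + X = _]/(E * (m%:R * t^-1 ^+ m.-1 * - t ^- 2)).
  case: m {dX dd dE} => [|m]; first by rewrite !mul0r mulr0 subr0 addr0 expr0 mul1r exprVn.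
  by rewrite -exprVn /= !exprS; ring.
- have e1 := flat_le0 m.+1 (lexx 0); have e2 := flat_le0 m.+2 (lexx 0).
  have e0 := flat_le0 m (lexx 0).
  rewrite e1 e2 mulr0 subr0.
  suff H : (fun h : R => h^-1 *: ((flat m \o shift 0) (h *: 1) - flat m 0)) @ 0^' --> (0 : R).
    by split; [exact: (cvgP _ H)|exact: (cvg_lim _ H)].
  apply/cvgrPdist_le => e ep.
  have f0 : 0 < m.+2`!%:R :> R by rewrite ltr0n fact_gt0.
  near=> h.
  have h0 : h != 0 by near: h; exact: nbhs_dnbhs_neq.
  have he : `|h| < e / m.+2`!%:R by near: h; apply: dnbhs0_lt; rewrite divr_gt0.
  rewrite sub0r normrN /= addr0 [h *: 1]mulr1 e0 subr0.
  case: (ltgtP h 0) h0 => // hs _.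
    by rewrite (flat_le0 _ (ltW hs)) scaler0 normr0 ltW.
  have -> : h^-1 *: flat m h = flat m.+1 h by rewrite /flat hs exprS -mulrA.
  have /andP[f1 f2] := flat_le m.+1 hs.
  rewrite ger0_norm //; apply: (le_trans f2).
  rewrite gtr0_norm // ltr_pdivlMr // in he.
  by rewrite mulrC ltW.
Unshelve. all: by end_near. Qed.

Lemma Ck_flat n k (U : set 'rV[R]_n) (f : 'rV[R]_n -> R) : open U -> smooth U f ->
  forall m, Ck k U (fun x => flat m (f x)).
Proof.
move=> oU Cf.
have cf x m : U x -> {for x, continuous (fun x => flat m (f x))}.
  move=> Ux; apply: (@continuous_comp _ _ _ f (flat m)); first exact: (Ck_cont (Cf 0)).
  apply: differentiable_continuous; apply/derivable1_diffP.
  by have d := is_derive_flat m (f x); exact: ex_derive.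
elim: k => [|k IH] m; first by split=> // x Ux; exact: cf.
split=> [x Ux|v]; first exact: cf.
have dfl x : U x -> derivable (fun x => flat m (f x)) x v /\
   'D_v (fun x => flat m (f x)) x = (flat m.+2 (f x) + - (m%:R * flat m.+1 (f x))) * 'D_v f x.
  move=> Ux.
  have df : derivable f x v := Ck_derivable (Cf 1%N) Ux.
  have d1 : differentiable (fun h : R => f (h *: v + x)) 0.
    by apply/derivable1_diffP; exact: (derivable1P f x v).1 df.
  have dF := is_derive_flat m (f (0 *: v + x)).
  have d2 : differentiable (flat m) ((fun h : R => f (h *: v + x)) 0).
    by apply/derivable1_diffP; exact: ex_derive.
  have d12 := differentiable_comp d1 d2.
  split; first by apply/(derivable1P _ x v).2; apply/derivable1_diffP.
  rewrite -derive1_along.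
  rewrite (_ : (fun h : R => flat m (f (h *: v + x))) = flat m \o (fun h : R => f (h *: v + x))) //.
  have dp : is_derive (0 : R) 1 (fun h : R => f (h *: v + x)) ('D_v f x).
    by split; [exact/derivable1_diffP|exact: derive1_along].
  have [_ E] := is_derive1_comp dF dp.
  by apply: (etrans E); rewrite scale0r add0r.
split=> [x Ux|]; first by have [] := dfl x Ux.
apply: (Ck_ext oU (fun y Uy => esym (dfl y Uy).2)).
apply: CkM => //; last exact: Ck_derive (Cf k.+1).
apply: CkD => //; apply: CkN => //; apply: CkM => //; exact: Ck_cst.
Qed.

(** The Euclidean distance is used since the norm of row vectors, a maximum,
    is not smooth. *)
Definition bump n (c : 'rV[R]_n) (r : R) (x : 'rV[R]_n) : R :=
  flat 0 (r ^+ 2 - \sum_i (x 0 i - c 0 i) ^+ 2).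

Lemma bump_smooth n (c : 'rV[R]_n) r : smooth setT (bump c r).
Proof.
have oT : open [set: 'rV[R]_n] by exact: openT.
move=> k; apply: Ck_flat => // j; apply: CkD => //; first exact: Ck_cst.
apply: CkN => //; apply: Ck_sum => // i.
have Ci : Ck j setT (fun x : 'rV[R]_n => x 0 i - c 0 i).
  by apply: CkD => //; [exact: Ck_coord|exact: Ck_cst].
by apply: (Ck_ext oT _ (CkM oT Ci Ci)) => y _; rewrite expr2.
Qed.

Lemma bump_ge0 n (c : 'rV[R]_n) r x : 0 <= bump c r x.
Proof.
rewrite /bump; set t := _ - _; have [t0|t0] := ltP 0 t.
  by have /andP[] := flat_le 0 t0.
by rewrite flat_le0.
Qed.

Lemma bump_center n (c : 'rV[R]_n) r : 0 < r -> 0 < bump c r c.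
Proof.
move=> r0; rewrite /bump big1 => [|i _]; last by rewrite subrr expr0n.
by rewrite subr0 /flat exprn_gt0 // expr0 mul1r expR_gt0.
Qed.

Lemma bump_support n (c : 'rV[R]_n) r x : 0 < r -> bump c r x != 0 -> `|x - c| <= r.
Proof.
move=> r0; apply: contraNT; rewrite -ltNge => rx; apply/eqP; apply: flat_le0.
rewrite subr_le0.
have [i ri] : exists i, r < `|(x - c) 0 i|.
  apply: contrapT => /forallNP h; move: rx; rewrite ltNge => /negP; apply.
  apply: row_norm_le; first exact: ltW.
  by move=> i; rewrite leNgt; apply/negP; exact: h.
rewrite (bigD1 i) //=; apply: ler_wpDr; first by apply: sumr_ge0 => j _; rewrite sqr_ge0.
move: ri; rewrite !mxE => ri; rewrite -[leRHS]real_normK ?num_real //.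
by rewrite ler_pXn2r ?nnegrE // ltW.
Qed.

(** * Smooth germs on the half-space *)

Notation hs := (@halfspace R _).

(** Smoothness of the germ at x of a function on the half-space: the function
    extends smoothly across the boundary. *)
Definition hsmooth n (V : normedModType R) (f : 'rV[R]_n -> V) (x : 'rV[R]_n) :=
  exists U g, [/\ open U, U x, smooth U g & forall y, U y -> hs y -> g y = f y].

(** From a point of the half-space one can move a little in the direction v or
    in the direction - v, so the limit that defines [hderive] is taken along a
    proper filter. *)
Lemma hs_filter n (x v : 'rV[R]_n) : hs x ->
  ProperFilter (within [set t : R | hs (x + t *: v)] 0^').
Proof.
move=> hx; split; last exact: within_filter.
rewrite /within /= => -[e /= e0 H].
have [pos|] := pselect (forall k : 'I_n, val k = 0%N -> 0 <= v 0 k).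
  apply: (H (e / 2)) => /=; first by rewrite sub0r normrN gtr0_norm ?divr_gt0 // ltr_pdivrMr // ltr_pMr // ltr1n.
    by rewrite gt_eqF // divr_gt0.
  move=> k k0; rewrite !mxE addr_ge0 //; first exact: hx.
  by rewrite mulr_ge0 ?pos // divr_ge0 // ltW.
move=> /existsNP[k /not_implyP[k0 /negP]]; rewrite -ltNge => vk.
apply: (H (- (e / 2))) => /=.
- by rewrite sub0r opprK gtr0_norm ?divr_gt0 // ltr_pdivrMr // ltr_pMr // ltr1n.
- by rewrite oppr_eq0 gt_eqF // divr_gt0.
- move=> l l0; have -> : l = k by apply: val_inj; rewrite k0 l0.
  rewrite !mxE addr_ge0 //; first exact: hx.
  by rewrite mulNr -mulrN mulr_ge0 // ?oppr_ge0 ?divr_ge0 // ltW.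
Qed.

(** The derivative in the half-space can be computed on any extension; every
    rule below is obtained from the corresponding rule on an open set. *)
Lemma hderiveE n (V : normedModType R) (f g : 'rV[R]_n -> V) (U : set 'rV[R]_n) x v :
  hs x -> open U -> U x -> derivable g x v ->
  (forall y, U y -> hs y -> g y = f y) -> hderive f x v = 'D_v g x.
Proof.
move=> hx oU Ux dg gf; rewrite /hderive.
have PF := hs_filter v hx.
apply: cvg_lim => //.
have dgw : (fun t : R => t^-1 *: ((g \o shift x) (t *: v) - g x)) @
    within [set t : R | hs (x + t *: v)] 0^' --> 'D_v g x.
  by apply: cvg_trans dg; apply: cvg_app; exact: cvg_within.
apply: (cvg_trans _ dgw); apply: near_eq_cvg.
have c : {for 0, continuous (fun t : R => x + t *: v)}.
  apply: continuousD; first exact: cst_continuous.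
  by apply: continuousZr_tmp; exact: cvg_id.
have nU : \forall t \near (0 : R), U (x + t *: v).
  by apply: c; rewrite scale0r addr0; exact: open_nbhs_nbhs.
rewrite /within /=; apply: (filterS _ (nbhs_dnbhs nU)) => t Ut ht.
by rewrite /= [t *: v + x]addrC gf // gf.
Qed.

Section HalfSpace.
Context {n : nat}.
Implicit Types x v : 'rV[R]_n.

Lemma hsmooth_eq (V : normedModType R) (f g : 'rV[R]_n -> V) x :
  (\forall y \near x, hs y -> f y = g y) -> hsmooth f x -> hsmooth g x.
Proof.
move=> fg [U [h [oU Ux Ch hf]]].
have := open_nbhs_nbhs (conj oU Ux) => /(filterI fg) /nbhs_ballP[e /= e0 be].
exists (ball x e), h; split.
- exact: ball_open.
- exact: ballxx.
- by move=> k; apply: Ck_sub (Ch k) => y /be[].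
- by move=> y /be[E Uy] hy; rewrite -E // hf.
Qed.

Lemma hderive_eq (V : normedModType R) (f g : 'rV[R]_n -> V) x v : hs x ->
  (\forall y \near x, hs y -> f y = g y) -> hsmooth f x -> hderive f x v = hderive g x v.
Proof.
move=> hx fg [U [h [oU Ux Ch hf]]].
have := open_nbhs_nbhs (conj oU Ux) => /(filterI fg) /nbhs_ballP[e /= e0 be].
have dh := Ck_derivable (v := v) (Ch 1%N) Ux.
rewrite (hderiveE hx oU Ux dh hf).
apply: esym; apply: (hderiveE hx (ball_open x e) (ballxx _ e0) dh) => y /be[E Uy] hy.
by rewrite -E // hf.
Qed.

Lemma hsmooth_derive (V : normedModType R) (f : 'rV[R]_n -> V) x v :
  hsmooth f x -> hsmooth (fun y => hderive f y v) x.
Proof.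
move=> [U [h [oU Ux Ch hf]]]; exists U, ('D_v h); split => //.
  by move=> k; exact: Ck_derive (Ch k.+1).
by move=> y Uy hy; rewrite (hderiveE hy oU Uy (Ck_derivable (Ch 1%N) Uy) hf).
Qed.

Lemma hsmooth_cst (V : normedModType R) (c : V) x : hsmooth (fun=> c) x.
Proof.
by exists setT, (fun=> c); split => //; [exact: openT|move=> k; apply: Ck_cst; exact: openT].
Qed.

Lemma hderive_cst (V : normedModType R) (c : V) x v : hs x -> hderive (fun=> c) x v = 0.
Proof.
by move=> hx; rewrite (@hderiveE _ _ _ (cst c) setT) ?derive_cst //; exact: openT.
Qed.

Lemma hsmooth_coord i x : hsmooth (fun y : 'rV[R]_n => y 0 i) x.
Proof.
exists setT, (fun y : 'rV[R]_n => y 0 i); split => //; first exact: openT.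
by move=> k; apply: Ck_coord; exact: openT.
Qed.

Lemma hderive_coord i x v : hs x -> hderive (fun y : 'rV[R]_n => y 0 i) x v = v 0 i.
Proof.
move=> hx; have [d E] := derive_coord x v i.
by rewrite (@hderiveE _ _ _ (fun y : 'rV[R]_n => y 0 i) setT) ?E //; exact: openT.
Qed.

Lemma hsmooth_common (V W : normedModType R) (f : 'rV[R]_n -> V) (g : 'rV[R]_n -> W) x :
  hsmooth f x -> hsmooth g x -> exists U f1 g1,
  [/\ open U, U x, smooth U f1 /\ smooth U g1 & forall y, U y -> hs y -> f1 y = f y /\ g1 y = g y].
Proof.
move=> [U [f1 [oU Ux C1' E1]]] [U' [g1 [oU' Ux' C2 E2]]].
exists (U `&` U'), f1, g1; split; [exact: openI|by []| |].
  split=> k; first by apply: Ck_sub (C1' k) => y [].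
  by apply: Ck_sub (C2 k) => y [].
by move=> y [Uy Uy'] hy; rewrite E1 // E2.
Qed.

Lemma hsmoothD (V : normedModType R) (f g : 'rV[R]_n -> V) x : hsmooth f x -> hsmooth g x ->
  hsmooth (fun y => f y + g y) x.
Proof.
move=> Hf Hg; have [U [f1 [g1 [oU Ux [C1' C2] E]]]] := hsmooth_common Hf Hg.
exists U, (fun y => f1 y + g1 y); split => //; first by move=> k; exact: CkD.
by move=> y Uy hy; have [-> ->] := E y Uy hy.
Qed.

Lemma hderiveD (V : normedModType R) (f g : 'rV[R]_n -> V) x v : hs x ->
  hsmooth f x -> hsmooth g x ->
  hderive (fun y => f y + g y) x v = hderive f x v + hderive g x v.
Proof.
move=> hx Hf Hg; have [U [f1 [g1 [oU Ux [C1' C2] E]]]] := hsmooth_common Hf Hg.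
have d1 := Ck_derivable (v := v) (C1' 1%N) Ux; have d2 := Ck_derivable (v := v) (C2 1%N) Ux.
rewrite (hderiveE hx oU Ux d1 (fun y Uy hy => (E y Uy hy).1)).
rewrite (hderiveE hx oU Ux d2 (fun y Uy hy => (E y Uy hy).2)).
rewrite (hderiveE hx oU Ux (derivableD d1 d2)) ?deriveD //.
by move=> y Uy hy; rewrite fctE; have [-> ->] := E y Uy hy.
Qed.

Lemma hsmoothM (f g : 'rV[R]_n -> R) x : hsmooth f x -> hsmooth g x ->
  hsmooth (fun y => f y * g y) x.
Proof.
move=> Hf Hg; have [U [f1 [g1 [oU Ux [C1' C2] E]]]] := hsmooth_common Hf Hg.
exists U, (fun y => f1 y * g1 y); split => //; first by move=> k; exact: CkM.
by move=> y Uy hy; have [-> ->] := E y Uy hy.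
Qed.

Lemma hderiveM (f g : 'rV[R]_n -> R) x v : hs x ->
  hsmooth f x -> hsmooth g x ->
  hderive (fun y => f y * g y) x v = hderive f x v * g x + f x * hderive g x v.
Proof.
move=> hx Hf Hg; have [U [f1 [g1 [oU Ux [C1' C2] E]]]] := hsmooth_common Hf Hg.
have d1 := Ck_derivable (v := v) (C1' 1%N) Ux; have d2 := Ck_derivable (v := v) (C2 1%N) Ux.
rewrite (hderiveE hx oU Ux d1 (fun y Uy hy => (E y Uy hy).1)).
rewrite (hderiveE hx oU Ux d2 (fun y Uy hy => (E y Uy hy).2)).
rewrite (hderiveE hx oU Ux (derivableM d1 d2)) ?(deriveM d1 d2).
  by have [<- <-] := E x Ux hx; rewrite addrC; congr (_ + _); exact: mulrC.
by move=> y Uy hy; rewrite fctE; have [-> ->] := E y Uy hy.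
Qed.

Lemma hsmoothV (f : 'rV[R]_n -> R) x : hs x -> hsmooth f x -> f x != 0 ->
  hsmooth (fun y => (f y)^-1) x.
Proof.
move=> hx [U [h [oU Ux Ch hf]]] fx.
have cx : {for x, continuous h} := Ck_cont (Ch 0) Ux.
have hx0 : h x != 0 by rewrite hf.
have nn : nbhs (h x) [set t : R | t != 0] by apply: open_nbhs_nbhs; split => //; exact: open_neq.
have := cx _ nn => /(filterI (open_nbhs_nbhs (conj oU Ux))) /nbhs_ballP[e /= e0 be].
exists (ball x e), (fun y => (h y)^-1); split.
- exact: ball_open.
- exact: ballxx.
- move=> k; apply: CkV; [exact: ball_open|by move=> y /be[]|].
  by apply: Ck_sub (Ch k) => y /be[].
- by move=> y /be[Uy _] hy; rewrite hf.
Qed.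

Lemma hsmooth_sum (V : normedModType R) (I : Type) (r : seq I) (P : pred I) (F : I -> 'rV[R]_n -> V) x :
  (forall i, P i -> hsmooth (F i) x) -> hsmooth (fun y => \sum_(i <- r | P i) F i y) x.
Proof.
move=> HF; elim: r => [|i r IH].
  by apply: hsmooth_eq (hsmooth_cst (0 : V) x); near=> y => _; rewrite big_nil.
have [Pi|nPi] := boolP (P i).
  by apply: hsmooth_eq (hsmoothD (HF i Pi) IH); near=> y => _; rewrite big_cons Pi.
by apply: hsmooth_eq IH; near=> y => _; rewrite big_cons (negbTE nPi).
Unshelve. all: by end_near. Qed.

Lemma hderive_sum (V : normedModType R) (I : Type) (r : seq I) (F : I -> 'rV[R]_n -> V) x v : hs x ->
  (forall i, hsmooth (F i) x) ->
  hderive (fun y => \sum_(i <- r) F i y) x v = \sum_(i <- r) hderive (F i) x v.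
Proof.
move=> hx HF; elim: r => [|i r IH].
  rewrite [RHS]big_nil -[RHS](hderive_cst (0 : V) v hx).
  apply: esym; apply: hderive_eq => //; last exact: hsmooth_cst.
  by near=> y => _; rewrite big_nil.
rewrite big_cons -IH -hderiveD //; last exact: hsmooth_sum.
apply: esym; apply: hderive_eq => //; last by apply: hsmoothD => //; exact: hsmooth_sum.
by near=> y => _; rewrite big_cons.
Unshelve. all: by end_near. Qed.

Lemma hsmooth_rowP m (g : 'rV[R]_n -> 'rV[R]_m) x :
  hsmooth g x <-> forall j, hsmooth (fun y => g y 0 j) x.
Proof.
split=> [[U [h [oU Ux Ch hf]]] j|].
  exists U, (fun y => h y 0 j); split => //.
    by move=> k; exact: (Ck_rowP _ _ oU).1 (Ch k) j.
  by move=> y Uy hy; rewrite hf.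
move=> /choice[U /choice[h H]].
have nU j : \forall y \near x, U j y by have [oU Ux _ _] := H j; exact: open_nbhs_nbhs.
have {nU}nU : \forall y \near x, forall j, U j y by exact: (@filter_forall _ _ _ (nbhs x) _ nU).
have [e /= e0 be] := (nbhs_ballP _ _).1 nU.
have ob := ball_open x e.
exists (ball x e), (fun y => \row_j h j y); split => //.
- exact: ballxx.
- move=> k; apply/Ck_rowP => // j.
  have [_ _ Ch _] := H j.
  have Cb : Ck k (ball x e) (h j) by apply: Ck_sub (Ch k) => y /be.
  by apply: (Ck_ext ob _ Cb) => y _; rewrite mxE.
- by move=> y /be Uy hy; apply/rowP => j; rewrite mxE; have [_ _ _ ->] := H j.
Qed.

Lemma hderive_row m (g : 'rV[R]_n -> 'rV[R]_m) x v j : hs x -> hsmooth g x ->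
  hderive g x v 0 j = hderive (fun y => g y 0 j) x v.
Proof.
move=> hx [U [h [oU Ux Ch hf]]].
have dh := Ck_derivable (v := v) (Ch 1%N) Ux.
have dj := Ck_derivable (v := v) ((Ck_rowP _ _ oU).1 (Ch 1%N) j) Ux.
rewrite (hderiveE hx oU Ux dh hf) (derive_row _ dh).
apply: esym; apply: (hderiveE hx oU Ux dj) => y Uy hy.
by rewrite hf.
Qed.

Lemma hderive_sum_coord (f : 'rV[R]_n -> R) x v : hs x -> hsmooth f x ->
  hderive f x v = \sum_i v 0 i * hderive f x (delta_mx 0 i).
Proof.
move=> hx [U [h [oU Ux Ch hf]]].
rewrite (hderiveE hx oU Ux (Ck_derivable (v := v) (Ch 1%N) Ux) hf).
rewrite (C1_deriveE _ oU (Ck_C1 (Ch 1%N)) Ux); apply: eq_bigr => i _.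
by rewrite (hderiveE hx oU Ux (Ck_derivable (Ch 1%N) Ux) hf).
Qed.

Lemma hderive_sym (f : 'rV[R]_n -> R) x u v : hs x -> hsmooth f x ->
  hderive (fun y => hderive f y u) x v = hderive (fun y => hderive f y v) x u.
Proof.
move=> hx [U [h [oU Ux Ch hf]]].
have D w y : U y -> hs y -> 'D_w h y = hderive f y w.
  by move=> Uy hy; rewrite (hderiveE hy oU Uy (Ck_derivable (Ch 1%N) Uy) hf).
rewrite (hderiveE hx oU Ux (Ck_derivable (v := v) (Ck_derive u (Ch 2%N)) Ux) (D u)).
rewrite (hderiveE hx oU Ux (Ck_derivable (v := u) (Ck_derive v (Ch 2%N)) Ux) (D v)).
exact: derive_sym oU (Ch 2%N) Ux.
Qed.

Lemma hsmooth_continuous (V : normedModType R) (f : 'rV[R]_n -> V) x e : hs x -> hsmooth f x ->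
  0 < e -> \forall y \near x, hs y -> `|f x - f y| < e.
Proof.
move=> hx [U [h [oU Ux Ch hf]]] e0.
have /cvgrPdist_lt/(_ e e0) c : {for x, continuous h} := Ck_cont (Ch 0) Ux.
apply: filterS (filterI c (open_nbhs_nbhs (conj oU Ux))) => y [cy Uy] hy.
by rewrite -!hf.
Qed.

End HalfSpace.

Lemma hsmooth_comp n m (f : 'rV[R]_m -> R) (p : 'rV[R]_n -> 'rV[R]_m) x : hs x ->
  (\forall y \near x, hs y -> hs (p y)) -> hsmooth p x -> hsmooth f (p x) ->
  hsmooth (f \o p) x.
Proof.
move=> hx hp [U [q [oU Ux Cq qp]]] [W [h [oW Wx Ch hf]]].
have cq : {for x, continuous q} := Ck_cont (Cq 0) Ux.
have Wq : nbhs (q x) W by rewrite qp //; exact: open_nbhs_nbhs.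
have := cq _ Wq => /(filterI (open_nbhs_nbhs (conj oU Ux))) /(filterI hp) /nbhs_ballP[e /= e0 be].
have ob := ball_open x e.
exists (ball x e), (h \o q); split => //.
- exact: ballxx.
- move=> k; apply: (Ck_comp ob oW) => //; first by move=> y /be[_ []].
  by apply: Ck_sub (Cq k) => y /be[_ []].
- move=> y /be[hpy [Uy Wy]] hy /=; have Wq' : W (q y) by [].
  by rewrite qp // in Wq' *; apply: hf => //; exact: hpy.
Qed.

Lemma hderive_comp n m (f : 'rV[R]_m -> R) (p : 'rV[R]_n -> 'rV[R]_m) x v : hs x ->
  (\forall y \near x, hs y -> hs (p y)) -> hsmooth p x -> hsmooth f (p x) ->
  hderive (f \o p) x v = hderive f (p x) (hderive p x v).
Proof.
move=> hx hp [U [q [oU Ux Cq qp]]] [W [h [oW Wx Ch hf]]].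
have cq : {for x, continuous q} := Ck_cont (Cq 0) Ux.
have Wq : nbhs (q x) W by rewrite qp //; exact: open_nbhs_nbhs.
have := cq _ Wq => /(filterI (open_nbhs_nbhs (conj oU Ux))) /(filterI hp) /nbhs_ballP[e /= e0 be].
have ob := ball_open x e.
have hpx : hs (p x) by have [+ _] := be x (ballxx _ e0); apply.
have dq := Ck_derivable (v := v) (Cq 1%N) Ux.
rewrite (hderiveE hx oU Ux dq qp).
rewrite (hderiveE hpx oW Wx (Ck_derivable (Ch 1%N) Wx) hf).
have Wqx : W (q x) by rewrite qp.
have [dhq E] := derive_comp oW (Ck_C1 (Ch 1%N)) Wqx dq.
rewrite (hderiveE hx ob (ballxx _ e0) dhq) ?E ?qp //.
move=> y /be[hpy [Uy Wy]] hy /=; have Wq' : W (q y) by [].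
by rewrite qp // in Wq' *; apply: hf => //; exact: hpy.
Qed.

Lemma hsmooth_comp_row n m l (f : 'rV[R]_m -> 'rV[R]_l) (p : 'rV[R]_n -> 'rV[R]_m) x : hs x ->
  (\forall y \near x, hs y -> hs (p y)) -> hsmooth p x -> hsmooth f (p x) ->
  hsmooth (f \o p) x.
Proof.
move=> hx hp Sp /hsmooth_rowP Sf; apply/hsmooth_rowP => j.
exact: (hsmooth_comp hx hp Sp (Sf j)).
Qed.

Lemma hderive_comp_row n m l (f : 'rV[R]_m -> 'rV[R]_l) (p : 'rV[R]_n -> 'rV[R]_m) x v : hs x ->
  (\forall y \near x, hs y -> hs (p y)) -> hsmooth p x -> hsmooth f (p x) ->
  hderive (f \o p) x v = hderive f (p x) (hderive p x v).
Proof.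
move=> hx hp Sp Sf; apply/rowP => j.
rewrite hderive_row //; last exact: hsmooth_comp_row.
have hpx := nbhs_singleton hp hx.
rewrite hderive_row //.
exact: (hderive_comp v hx hp Sp ((hsmooth_rowP _ _).1 Sf j)).
Qed.

Lemma hderive_linear n m (f : 'rV[R]_n -> 'rV[R]_m) x : hs x -> hsmooth f x ->
  linear (hderive f x).
Proof.
move=> hx Sf a u v; apply/rowP => j.
have Sj := (hsmooth_rowP _ _).1 Sf j.
rewrite !mxE !hderive_row // !(hderive_sum_coord _ hx Sj).
rewrite mulr_sumr -big_split /=; apply: eq_bigr => i _.
by rewrite !mxE mulrDl mulrA.
Qed.

Lemma hsmooth_prod n (I : Type) (r : seq I) (P : pred I) (F : I -> 'rV[R]_n -> R) x :
  (forall i, P i -> hsmooth (F i) x) -> hsmooth (fun y => \prod_(i <- r | P i) F i y) x.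
Proof.
move=> HF; elim: r => [|i r IH].
  by apply: hsmooth_eq (hsmooth_cst (1 : R) x); near=> y => _; rewrite big_nil.
have [Pi|nPi] := boolP (P i).
  by apply: hsmooth_eq (hsmoothM (HF i Pi) IH); near=> y => _; rewrite big_cons Pi.
by apply: hsmooth_eq IH; near=> y => _; rewrite big_cons (negbTE nPi).
Unshelve. all: by end_near. Qed.

Lemma hsmooth_invmx n m (A : 'rV[R]_n -> 'M[R]_m) x : hs x ->
  (forall i j, hsmooth (fun y => A y i j) x) -> A x \in unitmx ->
  forall i j, hsmooth (fun y => invmx (A y) i j) x.
Proof.
move=> hx SA uA i j.
have Sdet l (B : 'rV[R]_n -> 'M[R]_l) : (forall a b, hsmooth (fun y => B y a b) x) ->
    hsmooth (fun y => \det (B y)) x.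
  move=> SB; rewrite /determinant; apply: hsmooth_sum => s _; apply: hsmoothM; first exact: hsmooth_cst.
  by apply: hsmooth_prod => a _; exact: SB.
have SD := Sdet _ _ SA.
have d0 : \det (A x) != 0 by rewrite -unitfE -unitmxE.
have nu : \forall y \near x, hs y -> A y \in unitmx.
  have e0 : 0 < `|\det (A x)| by rewrite normr_gt0.
  apply: filterS (hsmooth_continuous hx SD e0) => y H hy.
  rewrite unitmxE unitfE; apply: contraTneq (H hy) => ->.
  by rewrite subr0 ltxx.
apply: (@hsmooth_eq _ _ (fun y => (\det (A y))^-1 * ((-1) ^+ (j + i) * \det (row' j (col' i (A y)))))).
  by apply: filterS nu => y H hy; rewrite /invmx (H hy) !mxE.
apply: hsmoothM; first exact: hsmoothV.
apply: hsmoothM; first exact: hsmooth_cst.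
apply: Sdet => a b.
by apply: hsmooth_eq (SA (lift j a) (lift i b)); near=> y => _; rewrite !mxE.
Unshelve. all: by end_near. Qed.

Definition smooth_at n (V : normedModType R) (f : 'rV[R]_n -> V) x :=
  exists2 U, open U /\ U x & smooth U f.

Lemma smooth_at_comp n m (f : 'rV[R]_m -> R) (p : 'rV[R]_n -> 'rV[R]_m) x :
  smooth_at p x -> smooth_at f (p x) -> smooth_at (f \o p) x.
Proof.
move=> [U [oU Ux] Cp] [V [oV Vx] Cf].
have cp : {for x, continuous p} := Ck_cont (Cp 0) Ux.
have nV : nbhs (p x) V by exact: open_nbhs_nbhs.
have [e /= e0 be] := (nbhs_ballP _ _).1 (filterI (open_nbhs_nbhs (conj oU Ux)) (cp _ nV)).
have ob := ball_open x e.
exists (ball x e); first by split => //; exact: ballxx.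
move=> k; apply: (Ck_comp ob oV) => //; first by move=> y /be[].
by apply: Ck_sub (Cp k) => y /be[].
Qed.

Lemma smooth_at_hsmooth n (V : normedModType R) (f : 'rV[R]_n -> V) x : smooth_at f x -> hsmooth f x.
Proof. by move=> [U [oU Ux] Cf]; exists U, f. Qed.

Lemma smooth_at_comp_row n m l (f : 'rV[R]_m -> 'rV[R]_l) (p : 'rV[R]_n -> 'rV[R]_m) x :
  smooth_at p x -> smooth_at f (p x) -> smooth_at (f \o p) x.
Proof.
move=> [U [oU Ux] Cp] [V [oV Vx] Cf].
have cp : {for x, continuous p} := Ck_cont (Cp 0) Ux.
have nV : nbhs (p x) V by exact: open_nbhs_nbhs.
have [e /= e0 be] := (nbhs_ballP _ _).1 (filterI (open_nbhs_nbhs (conj oU Ux)) (cp _ nV)).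
have ob := ball_open x e.
exists (ball x e); first by split => //; exact: ballxx.
move=> k; apply/Ck_rowP => // j.
apply: (Ck_comp (f := fun y => f y 0 j) ob oV).
- by move=> y /be[].
- exact: (Ck_rowP _ _ oV).1 (Cf k) j.
- by apply: Ck_sub (Cp k) => y /be[].
Qed.

Lemma hs_segment n (x y : 'rV[R]_n) (t : R) : hs x -> hs y -> 0 <= t <= 1 -> hs (x + t *: (y - x)).
Proof.
move=> hx hy /andP[t0 t1] l l0; rewrite !mxE.
have := hx l l0; have := hy l l0; move: (x 0 l) (y 0 l) => a b b0 a0.
have : 0 <= (1 - t) * a + t * b by rewrite addr_ge0 // mulr_ge0 // subr_ge0.
by congr (0 <= _); ring.
Qed.

(** * Charts and differentials *)

Lemma hderive_locally_cst n (V : normedModType R) (f : 'rV[R]_n -> V) x u : hs x ->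
  (\forall t \near (0 : R), hs (x + t *: u) -> f (x + t *: u) = f x) -> hderive f x u = 0.
Proof.
move=> hx fc; rewrite /hderive; have PF := hs_filter u hx; apply: cvg_lim => //.
have c0 : (fun=> (0 : V)) @ within [set t : R | hs (x + t *: u)] 0^' --> (0 : V).
  exact: cvg_cst.
apply: (cvg_trans _ c0); apply: near_eq_cvg; rewrite /within /=.
by apply: (filterS _ (nbhs_dnbhs fc)) => t /= H ht; rewrite H // subrr scaler0.
Qed.

Lemma near_line n (x u : 'rV[R]_n) (P : set 'rV[R]_n) :
  (\forall y \near x, P y) -> \forall t \near (0 : R), P (x + t *: u).
Proof.
move=> nP.
have c : {for (0 : R), continuous (fun t : R => x + t *: u)}.
  apply: continuousD; first exact: cst_continuous.
  by apply: continuousZr_tmp; exact: cvg_id.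
by apply: c; rewrite scale0r addr0.
Qed.

Lemma hs_interior n (x : 'rV[R]_n) : (forall k : 'I_n, val k = 0%N -> 0 < x 0 k) ->
  \forall y \near x, hs y.
Proof.
move=> xp.
have nk (k : 'I_n) : nbhs x [set y : 'rV[R]_n | val k = 0%N -> 0 <= y 0 k].
  have [k0|kn] := eqVneq (val k) 0%N; last first.
    by apply: (filterS _ (@filterT _ (nbhs x) _)) => y _ k0; rewrite k0 eqxx in kn.
  have nn : nbhs (x 0 k) [set t : R | 0 < t].
    by apply: open_nbhs_nbhs; split; [exact: open_gt|exact: xp].
  have nc : nbhs x [set y : 'rV[R]_n | 0 < y 0 k] := @coord_at _ x k _ nn.
  by apply: filterS nc => y /= y0 _; exact: ltW.
exact: (@filter_forall _ _ _ (nbhs x) _ nk).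
Qed.

(** Applied to the coordinate that defines the boundary, this shows that a smooth
    map touching the boundary at an interior point is tangent to it there. *)
Lemma hderive_at_min n (f : 'rV[R]_n -> R) (x u : 'rV[R]_n) :
  (forall k : 'I_n, val k = 0%N -> 0 < x 0 k) -> hsmooth f x ->
  (\forall y \near x, hs y -> f x <= f y) -> hderive f x u = 0.
Proof.
move=> xp [U [g [oU Ux Cg gf]]] fmin.
have hn := hs_interior xp; have hx := nbhs_singleton hn.
rewrite (hderiveE hx oU Ux (Ck_derivable (v := u) (Cg 1%N) Ux) gf).
have n1 : \forall y \near x, U y /\ g x <= g y.
  apply: filterS (filterI (open_nbhs_nbhs (conj oU Ux)) (filterI hn fmin)) => y [Uy [hy fy]].
  by split=> //; rewrite !gf //; exact: fy.
have [e /= e0 be] := (nbhs_ballP _ _).1 (near_line u n1).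
have be' (t : R) : t \in `](- e), e[%R -> U (x + t *: u) /\ g x <= g (x + t *: u).
  by rewrite in_itv /= => te; apply: be; rewrite /ball /= sub0r normrN ltr_norml.
have dr (t : R) : t \in `](- e), e[%R ->
    is_derive t 1 (fun s : R => g (x + s *: u)) ('D_u g (x + t *: u)).
  by move=> /be'[Ut _]; apply: derive_ray; exact: Ck_derivable (Cg 1%N) Ut.
have h0 : 0 \in `](- e), e[%R by rewrite in_itv /= oppr_lt0 e0.
have ee : - e <= e by rewrite ge0_cp ?ltW.
have := @derive1_at_min _ (fun s : R => g (x + s *: u)) (- e) e 0 ee.
move=> /(_ (fun t te => @ex_derive _ _ _ _ _ _ _ (dr t te)) h0) H.
have gm t : t \in `](- e), e[%R -> g (x + 0 *: u) <= g (x + t *: u).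
  by move=> te; rewrite scale0r addr0; exact: (be' t te).2.
have E1 := @derive_val _ _ _ _ _ _ _ (H gm).
have E2 := @derive_val _ _ _ _ _ _ _ (dr 0 h0).
rewrite scale0r addr0 in E2.
exact: etrans (esym E2) E1.
Qed.

Section Charts.
Context {n : nat} {M : manifold R n}.
Implicit Types (p q : M) (i j : index M).

Lemma coord_hs i p : dom i p -> hs (coord i p).
Proof.
move=> dp; have [U _ E] := coord_image i.
by have [] : (U `&` @halfspace R n) (coord i p) by rewrite -E; exists p.
Qed.

Lemma chart_near i p : dom i p ->
  \forall y \near coord i p, hs y -> dom i (param i y) /\ coord i (param i y) = y.
Proof.
move=> dp; have [U oU E] := coord_image i.
have [Ux _] : (U `&` @halfspace R n) (coord i p) by rewrite -E; exists p.
apply: filterS (open_nbhs_nbhs (conj oU Ux)) => y Uy hy.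
have [q dq <-] : (coord i @` dom i) y by rewrite E.
by rewrite coordK ?inE.
Qed.

Lemma param_near i p (P : set M) : dom i p -> (\forall q \near p, P q) ->
  \forall y \near coord i p, hs y -> P (param i y).
Proof.
move=> dp nP; have [U oU E] := coord_image i.
have [Ux _] : (U `&` @halfspace R n) (coord i p) by rewrite -E; exists p.
have C : param i @ within (coord i @` dom i) (nbhs (coord i p)) --> param i (coord i p).
  exact: (subspace_continuousP _ _).1 (@param_continuous _ _ M i) (coord i p) (ex_intro2 _ _ p dp erefl).
rewrite coordK ?inE // in C; have H : \forall y \near coord i p, (coord i @` dom i) y -> P (param i y) := C _ nP.
apply: filterS (filterI H (open_nbhs_nbhs (conj oU Ux))) => y [Hy Uy] hy.
by apply: Hy; rewrite E.
Qed.

Lemma coord_cont i p : dom i p -> {for p, continuous (coord i)}.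
Proof.
move=> dp; have := @coord_continuous _ _ M i.
by rewrite continuous_open_subspace; [apply; rewrite inE|exact: dom_open].
Qed.

Lemma coord_near i p (P : set 'rV[R]_n) : dom i p ->
  (\forall y \near coord i p, P y) -> \forall q \near p, P (coord i q).
Proof. by move=> dp nP; exact: (coord_cont dp nP). Qed.

Lemma dom_near i p : dom i p -> \forall q \near p, dom i q.
Proof. by move=> dp; apply: open_nbhs_nbhs; split => //; exact: dom_open. Qed.

End Charts.

Lemma smooth_on_hsmooth n (V : normedModType R) (A : set 'rV[R]_n) (f : 'rV[R]_n -> V) x :
  smooth_on A f -> A x -> (\forall y \near x, hs y -> A y) -> hsmooth f x.
Proof.
move=> S Ax nA; have [U [g [oU Ux Cg E]]] := S x Ax.
have [e /= e0 be] := (nbhs_ballP _ _).1 (filterI nA (open_nbhs_nbhs (conj oU Ux))).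
exists (ball x e), g; split; [exact: ball_open|exact: ballxx| |].
  by move=> k; apply: Ck_sub (Cg k) => y /be[].
by move=> y /be[Ay Uy] hy; apply: E; rewrite inE; split => //; exact: Ay.
Qed.

Lemma id_smooth n (M : manifold R n) : smooth_map (@id M).
Proof.
split=> [x|i j]; first exact: cvg_id.
exact: transition_smooth.
Qed.

Section SmoothMaps.
Context {m n : nat} {M : manifold R m} {N : manifold R n} (f : M -> N).
Hypothesis Sf : smooth_map f.
Implicit Types (i : index M) (j : index N) (p : M).

Lemma map_near p (P : set N) : (\forall q \near f p, P q) -> \forall q \near p, P (f q).
Proof. by move=> nP; exact: (Sf.1 p _ nP). Qed.

Lemma rep_hsmooth i j p : dom i p -> dom j (f p) ->
  hsmooth (coord j \o f \o param i) (coord i p).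
Proof.
move=> dp df; apply: smooth_on_hsmooth (Sf.2 i j) _ _; first by exists p.
have n1 := param_near dp (map_near (dom_near df)).
apply: filterS (filterI n1 (chart_near dp)) => y [H1 H2] hy.
by have [H3 H4] := H2 hy; exists (param i y) => //; split => //; exact: H1.
Qed.

Lemma rep_hs i j p : dom i p -> dom j (f p) ->
  \forall y \near coord i p, hs y -> hs ((coord j \o f \o param i) y).
Proof.
move=> dp df; have n1 := param_near dp (map_near (dom_near df)).
by apply: filterS n1 => y H1 hy; apply: coord_hs; exact: H1.
Qed.

Lemma rep_at i j p : dom i p -> (coord j \o f \o param i) (coord i p) = coord j (f p).
Proof. by move=> dp /=; rewrite coordK ?inE. Qed.

Lemma dmap_linear i j p : dom i p -> dom j (f p) -> linear (dmap f i j p).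
Proof.
by move=> dp df; apply: hderive_linear; [exact: coord_hs|exact: rep_hsmooth].
Qed.

Lemma dmapE i j p u : dom i p -> dom j (f p) -> dmap f i j p u = u *m jacobian f i j p.
Proof.
move=> dp df; have L := dmap_linear dp df.
pose D : {linear 'rV[R]_m -> 'rV[R]_n} := HB.pack (dmap f i j p) (GRing.isLinear.Build _ _ _ _ _ L).
rewrite -[dmap f i j p u]/(D u) {1}[u]row_sum_delta linear_sum mulmx_sum_row.
by apply: eq_bigr => k _; rewrite linearZ /= rowK.
Qed.

Lemma hderive_pullback (h : N -> R) i j p u : dom i p -> dom j (f p) ->
  hsmooth (h \o param j) (coord j (f p)) ->
  hsmooth (h \o f \o param i) (coord i p) /\
  hderive (h \o f \o param i) (coord i p) u =
  hderive (h \o param j) (coord j (f p)) (dmap f i j p u).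
Proof.
move=> dp df Sh.
have hx := coord_hs dp.
have nE : \forall y \near coord i p, hs y ->
    ((h \o param j) \o (coord j \o f \o param i)) y = (h \o f \o param i) y.
  have n1 := param_near dp (map_near (dom_near df)).
  by apply: filterS n1 => y H1 hy /=; rewrite coordK // inE; exact: H1.
have Sr := rep_hsmooth dp df; have hr := rep_hs dp df.
rewrite -(rep_at _ dp) in Sh.
have Sc := hsmooth_comp hx hr Sr Sh.
split; first exact: hsmooth_eq nE Sc.
by rewrite -(hderive_eq u hx nE Sc) (hderive_comp u hx hr Sr Sh) (rep_at _ dp).
Qed.

End SmoothMaps.

Lemma dmap_comp m n l (M : manifold R m) (N : manifold R n) (P : manifold R l)
    (f : M -> N) (g : N -> P) (i : index M) (j : index N) (k : index P) p u :
  smooth_map f -> smooth_map g -> dom i p -> dom j (f p) -> dom k (g (f p)) ->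
  dmap (g \o f) i k p u = dmap g j k (f p) (dmap f i j p u).
Proof.
move=> Sf Sg dp df dg; have hx := coord_hs dp.
have nE : \forall y \near coord i p, hs y ->
    ((coord k \o g \o param j) \o (coord j \o f \o param i)) y = (coord k \o (g \o f) \o param i) y.
  have n1 := param_near dp (map_near Sf (dom_near df)).
  by apply: filterS n1 => y H1 hy /=; rewrite coordK // inE; exact: H1.
have Sr := rep_hsmooth Sf dp df; have hr := rep_hs Sf dp df.
have Sh := rep_hsmooth Sg df dg; rewrite -(rep_at f j dp) in Sh.
have Sc := hsmooth_comp_row hx hr Sr Sh.
rewrite /dmap -(hderive_eq u hx nE Sc).
by rewrite (hderive_comp_row u hx hr Sr Sh) (rep_at f j dp).
Qed.

Lemma dmap_id n (M : manifold R n) (i : index M) p u : dom i p -> dmap id i i p u = u.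
Proof.
move=> dp; have hx := coord_hs dp.
have nE : \forall y \near coord i p, hs y -> id y = (coord i \o id \o param i) y.
  by apply: filterS (chart_near dp) => y H hy /=; rewrite (H hy).2.
have Sid : hsmooth (@id 'rV[R]_n) (coord i p).
  by apply/hsmooth_rowP => j; exact: hsmooth_coord.
rewrite /dmap -(hderive_eq u hx nE Sid); apply/rowP => j.
by rewrite hderive_row // hderive_coord.
Qed.

Lemma dmap_idK n (M : manifold R n) (i j : index M) p u : dom i p -> dom j p ->
  dmap id j i p (dmap id i j p u) = u.
Proof.
move=> di dj; have := dmap_comp (f := @id M) (g := @id M) u (id_smooth M) (id_smooth M) di dj di.
by rewrite dmap_id.
Qed.

(** Being a boundary point does not depend on the chart.  If p were interior in
    the chart i, the first coordinate of another chart, which vanishes at p,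
    would have a minimum there, and the change of coordinates would not be
    invertible. *)
Lemma boundary_coord n (M : manifold R n.+1) (i : index M) p :
  boundary p -> dom i p -> coord i p 0 0 = 0.
Proof.
move=> [j [k [dj k0 pk]]] di.
have {k0}k0 : k = 0 by apply: val_inj.
rewrite k0 in pk.
apply/eqP; apply: contraT => xn.
have hx := coord_hs di.
have xp (l : 'I_n.+1) : val l = 0%N -> 0 < coord i p 0 l.
  by move=> l0; rewrite (_ : l = 0) ?lt_def ?xn ?hx //; exact: val_inj.
have Sid := id_smooth M.
have Sr := rep_hsmooth Sid di dj; have hr := rep_hs Sid di dj.
have D0 u : dmap id i j p u 0 0 = 0.
  rewrite /dmap hderive_row //; apply: hderive_at_min => //.
    exact: (hsmooth_rowP _ _).1 Sr 0.
  by apply: filterS hr => y H hy; rewrite /= coordK ?inE // pk; exact: H.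
have := congr1 (fun r : 'rV[R]_n.+1 => r 0 0) (dmap_idK (delta_mx 0 0) dj di).
by rewrite D0 mxE eqxx /= => /eqP; rewrite eq_sym oner_eq0.
Qed.

(** The first coordinate of f vanishes at q, an interior point, hence has a minimum
    there. *)
Lemma dmap_boundary m n (N : manifold R m) (M : manifold R n.+1) (f : N -> M) :
  boundary (M:=N) = set0 -> smooth_map f -> range f `<=` boundary (M:=M) ->
  forall (k : index N) (i : index M) q u, dom k q -> dom i (f q) -> dmap f k i q u 0 0 = 0.
Proof.
move=> bN Sf fb k i q u dk di; have hx := coord_hs dk.
have Sr := rep_hsmooth Sf dk di; have hr := rep_hs Sf dk di.
rewrite /dmap hderive_row //; apply: hderive_at_min.
- move=> l l0; rewrite lt_def hx // andbT; apply/eqP => e0.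
  have : boundary (M:=N) q by exists k, l.
  by rewrite bN.
- exact: (hsmooth_rowP _ _).1 Sr 0.
- apply: filterS hr => y H hy; rewrite /= coordK ?inE //.
  rewrite (boundary_coord (fb _ (ex_intro2 _ _ q I erefl)) di).
  exact: H.
Qed.

Lemma vfield_hsmooth n (M : manifold R n) (W : set M) (v : vfield M) (i : index M) p :
  open W -> is_vfield W v -> W p -> dom i p -> hsmooth (fun x => v i (param i x)) (coord i p).
Proof.
move=> oW [_ S] Wp dp; apply: smooth_on_hsmooth (S i) _ _; first by exists p.
have nW : \forall q \near p, W q by apply: open_nbhs_nbhs.
apply: filterS (filterI (param_near dp nW) (chart_near dp)) => y [H1 H2] hy.
by have [H3 H4] := H2 hy; exists (param i y) => //; split => //; exact: H1.
Qed.

Lemma dmap_transition m n (M : manifold R m) (N : manifold R n) (f : M -> N) (k k' : index M)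
   (i : index N) q u : smooth_map f -> dom k q -> dom k' q -> dom i (f q) ->
  dmap f k i q (dmap id k' k q u) = dmap f k' i q u.
Proof.
by move=> Sf dk dk' di; rewrite -(dmap_comp (f := @id M) (g := f) u (id_smooth M) Sf dk' dk di).
Qed.

Lemma dmap_transition_r m n (M : manifold R m) (N : manifold R n) (f : M -> N) (k : index M)
   (i i' : index N) q u : smooth_map f -> dom k q -> dom i (f q) -> dom i' (f q) ->
  dmap id i i' (f q) (dmap f k i q u) = dmap f k i' q u.
Proof.
by move=> Sf dk di di'; rewrite -(dmap_comp (f := f) (g := @id N) u Sf (id_smooth N) dk di di').
Qed.

(** * Two-forms and Hamiltonian vector fields *)

(** The orthogonal of a plane for a nondegenerate form on a 4-dimensional space
    is a plane, so an isotropic plane is equal to its orthogonal. *)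
Lemma isotropic_max (W : 'M[R]_4) (J : 'M[R]_(2, 4)) (x : 'rV[R]_4) :
  W \in unitmx -> row_free J -> J *m W *m J^T = 0 -> x *m W *m J^T = 0 ->
  exists u, x = u *m J.
Proof.
move=> uW fJ JJ xJ.
pose K := kermx (W *m J^T).
have rJ : \rank J = 2%N by apply/eqP.
have rK : \rank K = 2%N.
  rewrite mxrank_ker eqmxMfull ?mxrank_tr ?rJ //.
  by rewrite row_full_unit.
have JK : (J <= K)%MS by apply/sub_kermxP; rewrite mulmxA.
have KJ : (K <= J)%MS by rewrite -(mxrank_leqif_sup JK) rJ rK.
have xK : (x <= K)%MS by apply/sub_kermxP; rewrite mulmxA.
by have /submxP[u ->] := submx_trans xK KJ; exists u.
Qed.

Section TwoForms.
Context {n : nat} {X : manifold R n} (w : form2 X).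
Hypothesis Fw : is_form2 w.
Implicit Types (i : index X) (p : X).

Definition form_mx i p : 'M[R]_n := \matrix_(a, b) w i p (delta_mx 0 a) (delta_mx 0 b).

Lemma form2_suml i p x y : dom i p -> w i p x y = \sum_a x 0 a * w i p (delta_mx 0 a) y.
Proof.
move=> dp; have [L _ _ _] := Fw; have {}L := L i p y dp.
pose D : {scalar 'rV[R]_n} := HB.pack (fun u => w i p u y) (GRing.isLinear.Build _ _ _ _ _ L).
rewrite -[w i p x y]/(D x) {1}[x]row_sum_delta linear_sum.
by apply: eq_bigr => k _; rewrite linearZ.
Qed.

Lemma form2_anti i p x y : dom i p -> w i p x y = - w i p y x.
Proof. by move=> dp; have [_ A _ _] := Fw; exact: A. Qed.

Lemma form2_sumr i p x y : dom i p -> w i p x y = \sum_b y 0 b * w i p x (delta_mx 0 b).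
Proof.
move=> dp; rewrite form2_anti // (form2_suml _ _ dp) -sumrN.
by apply: eq_bigr => b _; rewrite -mulrN -form2_anti.
Qed.

Lemma form2E i p x y : dom i p -> w i p x y = (x *m form_mx i p *m y^T) 0 0.
Proof.
move=> dp; rewrite (form2_sumr _ _ dp) mxE; apply: eq_bigr => b _.
rewrite mulrC (form2_suml _ _ dp) !mxE; congr (_ * _); apply: eq_bigr => a _.
by rewrite mxE.
Qed.

Lemma form2D i p x x' y : dom i p -> w i p (x + x') y = w i p x y + w i p x' y.
Proof. by move=> dp; rewrite !form2E // !mulmxDl mxE. Qed.

Lemma form2Dr i p x y y' : dom i p -> w i p x (y + y') = w i p x y + w i p x y'.
Proof. by move=> dp; rewrite !form2E // linearD /= mulmxDr mxE. Qed.

Lemma form2Zr i p x y c : dom i p -> w i p x (c *: y) = c * w i p x y.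
Proof. by move=> dp; rewrite !form2E // linearZ /= -scalemxAr mxE. Qed.

Lemma form2_alt i p x : dom i p -> w i p x x = 0.
Proof.
move=> dp; have := form2_anti x x dp; move: (w i p x x) => a e.
by lra.
Qed.

Lemma form2_hsmooth i p u u' : dom i p -> hsmooth (fun x => w i (param i x) u u') (coord i p).
Proof.
move=> dp; have [_ _ _ S] := Fw; apply: smooth_on_hsmooth (S i u u') _ _; first by exists p.
by apply: filterS (chart_near dp) => y H hy; exists (param i y); have [] := H hy.
Qed.

(** Writing the contraction as a finite sum of products of smooth functions
    makes it accessible to the rules for sums and products. *)
Lemma contract_near i p (V : 'rV[R]_n -> 'rV[R]_n) u : dom i p ->
  \forall x \near coord i p, hs x ->
   \sum_a V x 0 a * w i (param i x) (delta_mx 0 a) u = w i (param i x) (V x) u.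
Proof.
move=> dp; apply: filterS (chart_near dp) => x H hx.
by rewrite [RHS](form2_suml _ _ (H hx).1).
Qed.

Lemma contract_hsmooth i p (V : 'rV[R]_n -> 'rV[R]_n) u : dom i p ->
  hsmooth V (coord i p) -> hsmooth (fun x => w i (param i x) (V x) u) (coord i p).
Proof.
move=> dp SV; apply: hsmooth_eq (contract_near V u dp) _.
apply: hsmooth_sum => a _; apply: hsmoothM; last exact: form2_hsmooth.
exact: (hsmooth_rowP _ _).1 SV a.
Qed.

Lemma contract_hderive i p (V : 'rV[R]_n -> 'rV[R]_n) u a : dom i p ->
  hsmooth V (coord i p) ->
  hderive (fun x => w i (param i x) (V x) u) (coord i p) a =
  hderive (fun x => w i (param i x) (V (coord i p)) u) (coord i p) a
   + w i p (hderive V (coord i p) a) u.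
Proof.
move=> dp SV; have hx := coord_hs dp; have SVj j := (hsmooth_rowP _ _).1 SV j.
have Sw k := form2_hsmooth (delta_mx 0 k) u dp.
have S1 k : hsmooth (fun x => V x 0 k * w i (param i x) (delta_mx 0 k) u) (coord i p).
  exact: hsmoothM.
have S2 k : hsmooth (fun x => V (coord i p) 0 k * w i (param i x) (delta_mx 0 k) u) (coord i p).
  by apply: hsmoothM => //; exact: hsmooth_cst.
have SS1 : hsmooth (fun x => \sum_k V x 0 k * w i (param i x) (delta_mx 0 k) u) (coord i p).
  exact: hsmooth_sum.
have SS2 : hsmooth (fun x => \sum_k V (coord i p) 0 k * w i (param i x) (delta_mx 0 k) u) (coord i p).
  exact: hsmooth_sum.
rewrite -(hderive_eq a hx (contract_near V u dp) SS1).
rewrite -(hderive_eq a hx (contract_near (fun=> V (coord i p)) u dp) SS2).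
rewrite !hderive_sum // (form2_suml _ _ dp) -big_split /=; apply: eq_bigr => k _.
rewrite hderiveM // hderiveM //; last exact: hsmooth_cst.
by rewrite hderive_cst // mul0r add0r coordK ?inE // hderive_row // addrC.
Qed.

(** Cartan's formula for a closed 2-form: L_v w = d (w(v, .)). *)
Lemma lie_derivative_cartan i p (v : vfield X) a b : dom i p ->
  (forall u u' t, d2 w i p u u' t = 0) ->
  hsmooth (fun x => v i (param i x)) (coord i p) ->
  lie_derivative v w i p a b = d1 (fun i p u => w i p (v i p) u) i p a b.
Proof.
move=> dp dw Sv; have hx := coord_hs dp.
have C := @contract_hderive i p (fun x => v i (param i x)) _ _ dp Sv.
rewrite /lie_derivative /d1 !C coordK ?inE //.
have := dw (v i p) a b; rewrite /d2.
have -> : hderive (fun x => w i (param i x) b (v i p)) (coord i p) a =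
   - hderive (fun x => w i (param i x) (v i p) b) (coord i p) a.
  rewrite -[RHS]mulN1r.
  have S0 := form2_hsmooth (v i p) b dp.
  have Sc := hsmooth_cst (-1 : R) (coord i p).
  have -> : -1 * hderive (fun x => w i (param i x) (v i p) b) (coord i p) a =
     hderive (fun x => -1 * w i (param i x) (v i p) b) (coord i p) a.
    by rewrite hderiveM // hderive_cst // mul0r add0r.
  apply: esym; apply: hderive_eq => //; last exact: hsmoothM.
  apply: filterS (chart_near dp) => y H hy.
  by rewrite mulN1r [RHS]form2_anti //; exact: (H hy).1.
rewrite [w i p a (hderive _ _ _)](form2_anti _ _ dp).
by move=> E; lra.
Qed.

Hypothesis nd : forall i p u, dom i p -> (forall u', w i p u u' = 0) -> u = 0.

Lemma form_mx_unit i p : dom i p -> form_mx i p \in unitmx.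
Proof.
move=> dp; rewrite -row_free_unit; apply: inj_row_free => x xW.
by apply: (nd dp) => u'; rewrite form2E // xW mul0mx mxE.
Qed.

Lemma form2_inj i p x x' : dom i p -> (forall u, w i p x u = w i p x' u) -> x = x'.
Proof.
move=> dp E; apply/eqP; rewrite -subr_eq0; apply/eqP; apply: (nd dp) => u.
have -> : w i p (x - x') u = w i p x u - w i p x' u.
  by rewrite !form2E // !mulmxBl [LHS]mxE [X in _ + X]mxE.
by rewrite E subrr.
Qed.

Definition dfun (h : X -> R) i p u := hderive (h \o param i) (coord i p) u.

(** The field X_h with w(X_h, .) = dh, see [hamiltonianE]. *)
Definition hamiltonian (h : X -> R) : vfield X := fun i p =>
  (\row_k dfun h i p (delta_mx 0 k)) *m invmx (form_mx i p).

Lemma hamiltonianE h i p u : dom i p -> hsmooth (h \o param i) (coord i p) ->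
  w i p (hamiltonian h i p) u = dfun h i p u.
Proof.
move=> dp Sh; rewrite form2E // /hamiltonian mulmxKV ?form_mx_unit //.
rewrite mxE /dfun (hderive_sum_coord _ (coord_hs dp) Sh); apply: eq_bigr => k _.
by rewrite !mxE mulrC.
Qed.

End TwoForms.

(** * Adding a Hamiltonian vector field to a Liouville field *)

Lemma mx_entry m n (M : 'M[R]_(m, n)) a b :
  ((delta_mx 0 a : 'rV[R]_m) *m M *m (delta_mx 0 b : 'rV[R]_n)^T) 0 0 = M a b.
Proof. by rewrite -rowE trmx_delta -colE !mxE. Qed.

Section Modification.
Context {X : manifold R 4} (w : form2 X).
Hypothesis Sw : symplectic w.
Variables (s : R) (Y : manifold R 3) (o : orientation Y) (xi : plane_field Y) (f : Y -> X).
Variables (W : set X) (v : vfield X).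
Hypothesis Lv : liouville_near w s o xi f W v.
Hypothesis cY : closed_manifold Y.
Hypothesis Sf : smooth_map f.
Hypothesis fb : range f `<=` boundary (M:=X).
Context {L : manifold R 2} (iota : L -> X).
Hypothesis Iiota : immersion iota.
Hypothesis Lag : lagrangian w iota.
Variables (W' : set X) (h : X -> R).
Hypotheses (oW' : open W') (W'W : W' `<=` W) (fW' : range f `<=` W').
Hypothesis Sh : forall p i, W' p -> dom i p -> hsmooth (h \o param i) (coord i p).
Hypothesis hb : forall p, W' p -> boundary p -> h p = 0.
Hypothesis hL : forall q k i, W' (iota q) -> dom k q -> dom i (iota q) -> forall u,
  hderive (h \o iota \o param k) (coord k q) u =
  - w i (iota q) (v i (iota q)) (dmap iota k i q u).

Let Fw : is_form2 w := let: And3 H _ _ := Sw in H.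
Let dw : forall i p u u' t, dom i p -> d2 w i p u u' t = 0 := let: And3 _ H _ := Sw in H.
Let nd : forall i p u, dom i p -> (forall u', w i p u u' = 0) -> u = 0 := let: And3 _ _ H := Sw in H.

Let Sv i p (Wp : W p) (dp : dom i p) : hsmooth (fun x => v i (param i x)) (coord i p) :=
  let: And5 oW Vv _ _ _ := Lv in vfield_hsmooth oW.1 Vv Wp dp.

Let v' : vfield X := fun i p => v i p + hamiltonian w h i p.

Lemma modified_contract i p u : W' p -> dom i p ->
  w i p (v' i p) u = w i p (v i p) u + dfun h i p u.
Proof.
by move=> Wp dp; rewrite /v' form2D // (hamiltonianE Fw nd) //; exact: Sh.
Qed.

Lemma hamiltonian_hsmooth i p : W' p -> dom i p ->
  hsmooth (fun x => hamiltonian w h i (param i x)) (coord i p).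
Proof.
move=> Wp dp; have hx := coord_hs dp; apply/hsmooth_rowP => j.
have uW := form_mx_unit Fw nd dp.
have nW' : \forall q \near p, W' q by apply: open_nbhs_nbhs.
have SW a b : hsmooth (fun x => form_mx w i (param i x) a b) (coord i p).
  apply: hsmooth_eq (form2_hsmooth Fw (delta_mx 0 a) (delta_mx 0 b) dp).
  by near=> y => _; rewrite mxE.
rewrite -(coordK (i := i) (x := p)) ?inE // in uW.
have Si := hsmooth_invmx hx SW uW.
apply: (@hsmooth_eq _ _ (fun y => \sum_k hderive (h \o param i) y (delta_mx 0 k) *
          invmx (form_mx w i (param i y)) k j)).
  apply: filterS (chart_near dp) => y H hy.
  by rewrite mxE; apply: eq_bigr => k _; rewrite mxE /dfun (H hy).2.
apply: hsmooth_sum => k _; apply: hsmoothM => //.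
by apply: hsmooth_derive; exact: Sh.
Unshelve. all: by end_near. Qed.

Lemma modified_hsmooth i p : W' p -> dom i p ->
  hsmooth (fun x => v' i (param i x)) (coord i p).
Proof.
move=> Wp dp; apply: hsmoothD; last exact: hamiltonian_hsmooth.
by apply: Sv => //; exact: W'W.
Qed.

Lemma hsmooth_smooth_on (V : normedModType R) i (P : set X) (F : 'rV[R]_4 -> V) : open P ->
  (forall p, P p -> dom i p -> hsmooth F (coord i p)) -> smooth_on (coord i @` (dom i `&` P)) F.
Proof.
move=> oP SF _ [p [dp Pp] <-]; have [U [g [oU Ux Cg gF]]] := SF p Pp dp.
exists U, g; split => // y; rewrite inE => -[Uy [q [dq _] qy]].
by apply: gF => //; rewrite -qy; exact: coord_hs.
Qed.

Lemma modified_vfield : is_vfield W' v'.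
Proof.
have [_ [vT _] _ _ _] := Lv.
split=> [i j p Wp di dj|i].
  apply: (form2_inj Fw nd dj) => u.
  have {1 2}<- := dmap_idK u dj di.
  set u' := dmap id j i p u.
  have [_ _ wT _] := Fw.
  have E1 := modified_contract (dmap id i j p u') Wp dj.
  have E2 := wT i j p (v' i p) u' di dj.
  have E3 := modified_contract u' Wp di.
  have E4 := wT i j p (v i p) u' di dj.
  have E5 : dfun h i p u' = dfun h j p (dmap id i j p u').
    have [_ E5] := hderive_pullback (h := h) (id_smooth X) u' di dj (Sh Wp dj).
    by rewrite /dfun; exact: E5.
  have Ev := congr1 (fun z => w j p z (dmap id i j p u')) (vT i j p (W'W Wp) di dj).
  have E6 := congr2 +%R (etrans Ev (esym E4)) (esym E5).
  exact: (etrans E1 (etrans E6 (etrans (esym E3) E2))).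
by apply: hsmooth_smooth_on => // p Wp dp; exact: modified_hsmooth.
Qed.

(** The two contractions differ by dh, whose differential vanishes by the
    symmetry of second derivatives. *)
Lemma modified_liouville i p a b : W' p -> dom i p ->
  lie_derivative v' w i p a b = w i p a b.
Proof.
move=> Wp dp; have hx := coord_hs dp.
have [_ _ Lw _ _] := Lv; have Wp' := W'W Wp.
have dwp u u' t : d2 w i p u u' t = 0 by exact: dw.
rewrite (lie_derivative_cartan Fw a b dp dwp (modified_hsmooth Wp dp)).
rewrite -[RHS](Lw i p a b Wp' dp) (lie_derivative_cartan Fw a b dp dwp (Sv Wp' dp)).
have nW' : \forall q \near p, W' q by apply: open_nbhs_nbhs.
have nE u : \forall y \near coord i p, hs y ->
   w i (param i y) (v i (param i y)) u + hderive (h \o param i) y u =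
   w i (param i y) (v' i (param i y)) u.
  apply: filterS (filterI (param_near dp nW') (chart_near dp)) => y [H1 H2] hy.
  have [H3 H4] := H2 hy.
  by rewrite modified_contract //; [rewrite /dfun H4|exact: H1].
have S1 u := contract_hsmooth Fw u dp (Sv Wp' dp).
have S2 u := hsmooth_derive u (Sh Wp dp).
have E u c : hderive (fun y => w i (param i y) (v' i (param i y)) u) (coord i p) c =
   hderive (fun y => w i (param i y) (v i (param i y)) u) (coord i p) c +
   hderive (fun y => hderive (h \o param i) y u) (coord i p) c.
  by rewrite -(hderive_eq c hx (nE u)) ?hderiveD //; exact: hsmoothD.
rewrite /d1 !E (hderive_sym a b hx (Sh Wp dp)).
by rewrite opprD addrACA subrr addr0.
Qed.

Lemma dfun_boundary i p (t : 'rV[R]_4) : W' p -> boundary p -> dom i p -> t 0 0 = 0 -> dfun h i p t = 0.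
Proof.
move=> Wp bp dp t0; have hx := coord_hs dp.
apply: hderive_locally_cst => //.
have x0 := boundary_coord bp dp.
have nW' : \forall q \near p, W' q by apply: open_nbhs_nbhs.
have nn : \forall y \near coord i p, (hs y -> W' (param i y)) /\
    (hs y -> dom i (param i y) /\ coord i (param i y) = y).
  exact: filterI (param_near dp nW') (chart_near dp).
apply: filterS (near_line t nn) => c [H1 H2] hy; have [H3 H4] := H2 hy.
have bq : boundary (param i (coord i p + c *: t)).
  by exists i, 0; split => //; rewrite H4 !mxE x0 t0 mulr0 addr0.
have -> : (h \o param i) (coord i p) = 0 by rewrite /= coordK ?inE // hb.
by apply: hb => //; exact: H1.
Qed.

(** Let V be the Hamiltonian field at a boundary point.  If V were transverse to
    the boundary, every vector would be the sum of a multiple of V and of a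
    vector t tangent to the boundary; but w(V, V) = 0 and w(V, t) = dh(t) = 0,
    so V would lie in the kernel of w. *)
Lemma hamiltonian_tangent i p : W' p -> boundary p -> dom i p -> hamiltonian w h i p 0 0 = 0.
Proof.
move=> Wp bp dp; set V := hamiltonian w h i p.
apply/eqP; apply: contraT => c0.
have V0 : V = 0.
  apply: (nd dp) => u.
  have -> : u = (u 0 0 / V 0 0) *: V + (u - (u 0 0 / V 0 0) *: V) by rewrite addrC subrK.
  rewrite form2Dr // form2Zr // form2_alt // mulr0 add0r (hamiltonianE Fw nd) //; last exact: Sh.
  apply: dfun_boundary => //.
  by rewrite [LHS]mxE [X in _ + X]mxE [X in _ - X]mxE divfK // subrr.
by move: c0; rewrite V0 mxE eqxx.
Qed.

Lemma modified_liouville_near : liouville_near w s o xi f W' v'.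
Proof.
have [_ _ _ sv [a Ca aE]] := Lv.
split=> //.
- exact: modified_vfield.
- exact: modified_liouville.
- move=> q i di; have -> : v' i (f q) 0 0 = v i (f q) 0 0.
    rewrite /v' [LHS]mxE hamiltonian_tangent ?addr0 //.
      by apply: fW'; exists q.
    by apply: fb; exists q.
  exact: sv.
- exists a => // q k i u dk di; rewrite modified_contract //; last by apply: fW'; exists q.
  rewrite (aE q k i u dk di) dfun_boundary ?addr0 //.
  + by apply: fW'; exists q.
  + by apply: fb; exists q.
  + exact: (dmap_boundary cY.2 Sf fb).
Qed.

(** By the choice of h, v' is w-orthogonal to the tangent plane of L, which is
    a maximal isotropic subspace. *)
Lemma modified_tangent : tangent_to iota W' v'.
Proof.
move=> q k i Wq dk di.
have [Si inj] := Iiota.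
pose J : 'M[R]_(2, 4) := jacobian iota k i q.
have JE u : dmap iota k i q u = u *m J by exact: dmapE.
have fJ : row_free J.
  apply: inj_row_free => x xJ.
  by apply: (inj q k i dk di); rewrite !JE xJ mul0mx.
have uW := form_mx_unit Fw nd di.
have JJ : J *m form_mx w i (iota q) *m J^T = 0.
  apply/matrixP => a b; rewrite [RHS]mxE -[LHS]/((J *m form_mx w i (iota q) *m J^T) a b).
  have := Lag (delta_mx 0 a) (delta_mx 0 b) dk di; rewrite !JE form2E //.
  by rewrite trmx_mul !mulmxA => E; rewrite -[LHS]mx_entry !mulmxA.
have xJ : v' i (iota q) *m form_mx w i (iota q) *m J^T = 0.
  apply/rowP => b; rewrite [RHS]mxE.
  have := modified_contract (dmap iota k i q (delta_mx 0 b)) Wq di.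
  have [_ E] := hderive_pullback (h := h) Si (delta_mx 0 b) dk di (Sh Wq di).
  rewrite /dfun -E (hL Wq dk di) subrr JE form2E // trmx_mul mulmxA trmx_delta -colE mxE.
  by [].
have [u E] := isotropic_max uW fJ JJ xJ.
by exists u; rewrite JE.
Qed.

End Modification.

(** * The Liouville form on a Lagrangian surface *)

Section PullbackForm.
Context {X : manifold R 4} (w : form2 X).
Hypothesis Sw : symplectic w.
Variables (W : set X) (v : vfield X).
Hypothesis oW : open W.
Hypothesis Vv : is_vfield W v.
Hypothesis Lv : forall (i : index X) p a b, W p -> dom i p -> lie_derivative v w i p a b = w i p a b.
Context {L : manifold R 2} (iota : L -> X).
Hypothesis Si : smooth_map iota.
Hypothesis Lag : lagrangian w iota.

Let Fw : is_form2 w := let: And3 H _ _ := Sw in H.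
Let dw : forall i p u u' t, dom i p -> d2 w i p u u' t = 0 := let: And3 _ H _ := Sw in H.

(** The components of the Liouville form w(v, .) in the chart i. *)
Definition primitive_coef i a (z : 'rV[R]_4) : R :=
  w i (param i z) (v i (param i z)) (delta_mx 0 a).

Lemma primitive_coef_hsmooth i p a : W p -> dom i p -> hsmooth (primitive_coef i a) (coord i p).
Proof. by move=> Wp dp; apply: contract_hsmooth => //; exact: (vfield_hsmooth oW Vv). Qed.

(** The Liouville form is a primitive of w. *)
Lemma primitive_closed i p (U V : 'rV[R]_4) : W p -> dom i p ->
  (\sum_a V 0 a * hderive (primitive_coef i a) (coord i p) U) -
  (\sum_a U 0 a * hderive (primitive_coef i a) (coord i p) V) = w i p U V.
Proof.
move=> Wp dp; have hx := coord_hs dp.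
have dwp u u' t : d2 w i p u u' t = 0 by exact: dw.
rewrite -[RHS](Lv U V Wp dp) (lie_derivative_cartan Fw U V dp dwp (vfield_hsmooth oW Vv Wp dp)).
have S0 a := primitive_coef_hsmooth a Wp dp.
have S1 T a : hsmooth (fun z => T 0 a * primitive_coef i a z) (coord i p).
  by apply: hsmoothM => //; exact: hsmooth_cst.
have E T T' : hderive (fun z => w i (param i z) (v i (param i z)) T) (coord i p) T' =
   \sum_a T 0 a * hderive (primitive_coef i a) (coord i p) T'.
  have nE : \forall z \near coord i p, hs z ->
      \sum_a T 0 a * primitive_coef i a z = w i (param i z) (v i (param i z)) T.
    apply: filterS (chart_near dp) => z H hz.
    by rewrite [RHS](form2_sumr Fw _ _ (H hz).1).
  have SS : hsmooth (fun z => \sum_a T 0 a * primitive_coef i a z) (coord i p).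
    by apply: hsmooth_sum => a _.
  rewrite -(hderive_eq T' hx nE SS) hderive_sum //; apply: eq_bigr => a _.
  by rewrite hderiveM //; [rewrite hderive_cst // mul0r add0r|exact: hsmooth_cst].
by rewrite /d1 !E.
Qed.

Section AtPoint.
Variables (k : index L) (i : index X).
Let phi := coord i \o iota \o param k.

(** The pullback of the Liouville form to L, in the charts k and i, evaluated on
    the constant field u. *)
Definition pullback (u : 'rV[R]_2) (x : 'rV[R]_2) : R :=
  \sum_a primitive_coef i a (phi x) * hderive (fun x => phi x 0 a) x u.

Variables (q : L).
Hypotheses (dk : dom k q) (di : dom i (iota q)) (Wq : W (iota q)).

Let hx := coord_hs dk.
Let Sr := rep_hsmooth Si dk di.
Let hr := rep_hs Si dk di.
Let Sa a := (hsmooth_rowP _ _).1 Sr a.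

Let Sc a : hsmooth (primitive_coef i a \o phi) (coord k q).
Proof.
apply: (hsmooth_comp hx hr Sr); rewrite rep_at //.
exact: primitive_coef_hsmooth.
Qed.

Lemma pullback_hsmooth u : hsmooth (pullback u) (coord k q).
Proof.
apply: hsmooth_sum => a _; apply: hsmoothM; first exact: Sc.
exact: hsmooth_derive.
Qed.

Lemma pullbackE u : pullback u (coord k q) = w i (iota q) (v i (iota q)) (dmap iota k i q u).
Proof.
rewrite (form2_sumr Fw _ _ di) /pullback /primitive_coef.
apply: eq_bigr => a _; rewrite /phi rep_at // coordK ?inE // mulrC.
by rewrite -[in LHS](hderive_row u a hx Sr).
Qed.

Lemma pullback_linear u : pullback u (coord k q) = \sum_l u 0 l * pullback (delta_mx 0 l) (coord k q).
Proof.
under [RHS]eq_bigr do rewrite /pullback mulr_sumr.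
rewrite exchange_big /=; apply: eq_bigr => a _.
rewrite (hderive_sum_coord u hx (Sa a)) mulr_sumr; apply: eq_bigr => l _.
by rewrite mulrCA.
Qed.

(** The differential of the pullback of the Liouville form is the pullback of w,
    which is zero on a Lagrangian surface; the terms with second derivatives of
    the parametrization cancel by symmetry. *)
Lemma pullback_closed u u' :
  hderive (pullback u') (coord k q) u = hderive (pullback u) (coord k q) u'.
Proof.
pose D u := dmap iota k i q u.
have Da t a : hderive (fun x => phi x 0 a) (coord k q) t = D t 0 a.
  by rewrite -(hderive_row t a hx Sr).
have E t t' : hderive (pullback t') (coord k q) t =
   \sum_a D t' 0 a * hderive (primitive_coef i a) (coord i (iota q)) (D t) +
   \sum_a primitive_coef i a (coord i (iota q)) *
     hderive (fun x => hderive (fun x => phi x 0 a) x t') (coord k q) t.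
  have Sd a : hsmooth (fun x => hderive (fun x => phi x 0 a) x t') (coord k q).
    exact: hsmooth_derive.
  have Sp a : hsmooth (primitive_coef i a) (phi (coord k q)).
    by rewrite /phi rep_at //; exact: primitive_coef_hsmooth.
  rewrite /pullback hderive_sum //; last by move=> a; exact: (hsmoothM (Sc a) (Sd a)).
  rewrite -big_split /=; apply: eq_bigr => a _.
  apply: (etrans (hderiveM t hx (Sc a) (Sd a))); rewrite Da mulrC; congr (_ * _ + _).
    by rewrite (hderive_comp t hx hr Sr (Sp a)) rep_at.
  by rewrite /phi /= coordK ?inE.
have C := primitive_closed (D u) (D u') Wq di.
rewrite (Lag u u' dk di) in C.
have S2 : \sum_a primitive_coef i a (coord i (iota q)) *
     hderive (fun x => hderive (fun x => phi x 0 a) x u') (coord k q) u =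
   \sum_a primitive_coef i a (coord i (iota q)) *
     hderive (fun x => hderive (fun x => phi x 0 a) x u) (coord k q) u'.
  by apply: eq_bigr => a _; rewrite (hderive_sym _ _ hx (Sa a)).
exact: (etrans (E u u') (etrans (congr2 +%R (subr0_eq C) S2) (esym (E u' u)))).
Qed.

End AtPoint.
End PullbackForm.

(** * Local primitives near the boundary *)

Lemma row2E (u : 'rV[R]_2) : u = u 0 0 *: delta_mx 0 0 + u 0 1 *: delta_mx 0 1.
Proof.
apply/rowP => l; rewrite !mxE eqxx /=.
by case: l => -[|[|//]] hl; rewrite /= ?mulr1 ?mulr0 ?addr0 ?add0r; congr (u 0 _); exact: val_inj.
Qed.

Lemma det22 (A : 'M[R]_2) : \det A = A 0 0 * A 1 1 - A 0 1 * A 1 0.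
Proof.
rewrite (expand_det_row _ 0) !big_ord_recl big_ord0 addr0 /cofactor !det_mx11 !mxE /=.
rewrite expr0 mul1r expr1 mulN1r mulrN.
by congr (A _ _ * A _ _ - A _ _ * A _ _); apply: val_inj.
Qed.

Section LocalPrimitive.
Context {X : manifold R 4} (w : form2 X).
Hypothesis Sw : symplectic w.
Variables (W : set X) (v : vfield X).
Hypothesis oW : open W.
Hypothesis Vv : is_vfield W v.
Hypothesis Lv : forall (i : index X) p a b, W p -> dom i p -> lie_derivative v w i p a b = w i p a b.
Context {L : manifold R 2} (iota : L -> X).
Hypothesis Ei : smooth_embedding iota.
Hypothesis Lag : lagrangian w iota.
Hypothesis Tr : transverse_to_boundary iota.
Hypothesis bL : forall b, boundary (M:=L) b -> boundary (M:=X) (iota b).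
Variable (O : set X).
Hypothesis oO : open O.
Hypothesis leg : forall b (k : index L) (i : index X) (u : 'rV[R]_2), boundary (M:=L) b -> O (iota b) ->
  dom k b -> dom i (iota b) -> u 0 0 = 0 ->
  w i (iota b) (v i (iota b)) (dmap iota k i b u) = 0.

(** What is required of the function added as a Hamiltonian. *)
Definition local_primitive (U : set X) (h : X -> R) :=
  [/\ forall p (i : index X), U p -> dom i p -> hsmooth (h \o param i) (coord i p),
      forall p, U p -> boundary (M:=X) p -> h p = 0 &
      forall q (k : index L) (i : index X), U (iota q) -> dom k q -> dom i (iota q) -> forall u,
        hderive (h \o iota \o param k) (coord k q) u =
        - w i (iota q) (v i (iota q)) (dmap iota k i q u)].

Let Fw : is_form2 w := let: And3 H _ _ := Sw in H.
Let Si : smooth_map iota := Ei.1.1.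

Section At.
Variables (b : L) (k : index L) (i : index X).
Hypotheses (dk : dom k b) (di : dom i (iota b)).
Hypotheses (by_ : boundary (M:=X) (iota b)) (Wb : W (iota b)) (Ob : O (iota b)).
Let x0 := coord k b.
Let hx := coord_hs dk.
Let phi := coord i \o iota \o param k.
Let Sr := rep_hsmooth Si dk di.
Let hr := rep_hs Si dk di.
Let y0 : coord i (iota b) 0 0 = 0 := boundary_coord by_ di.

Lemma transverse_dir : exists u, dmap iota k i b u 0 0 != 0.
Proof.
have [u [t [t0 E]]] := Tr dk di by_ (delta_mx 0 0).
exists u; have := congr1 (fun r : 'rV[R]_4 => r 0 0) E; rewrite !mxE t0 addr0 eqxx /= => <-.
exact: oner_neq0.
Qed.

(** By transversality L meets the boundary of X only along its own boundary: at
    an interior point of L, its tangent plane would lie in that of the boundary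
    of X. *)
Lemma x0_boundary : x0 0 0 = 0.
Proof.
apply/eqP; apply: contraT => xn; have [u /eqP[]] := transverse_dir.
rewrite /dmap hderive_row //; apply: hderive_at_min.
- by move=> l l0; rewrite (_ : l = 0) ?lt_def ?xn ?hx //; exact: val_inj.
- exact: (hsmooth_rowP _ _).1 Sr 0.
- by apply: filterS hr => y H hy; rewrite /= coordK ?inE // y0; exact: H.
Qed.

Lemma near_good : \forall x \near x0, hs x ->
  [/\ dom k (param k x), coord k (param k x) = x, dom i (iota (param k x)),
      W (iota (param k x)) & O (iota (param k x))].
Proof.
have n1 := param_near dk (map_near Si (dom_near di)).
have n2 := param_near dk (map_near Si (open_nbhs_nbhs (conj oW Wb))).
have n3 := param_near dk (map_near Si (open_nbhs_nbhs (conj oO Ob))).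
apply: filterS (filterI (chart_near dk) (filterI n1 (filterI n2 n3))).
by move=> x [H1 [H2 [H3 H4]]] h; have [H5 H6] := H1 h; split => //; [exact: H2|exact: H3|exact: H4].
Qed.

(** In these charts the boundary of L is mapped into the boundary of X. *)
Lemma phi_boundary : \forall x \near x0, hs x -> x 0 0 = 0 -> phi x 0 0 = 0.
Proof.
apply: filterS near_good => x H h x00; have [H1 H2 H3 _ _] := H h.
apply: boundary_coord => //; apply: bL.
by exists k, 0; split => //; rewrite H2.
Qed.

Lemma dphi_tangent : dmap iota k i b (delta_mx 0 1) 0 0 = 0.
Proof.
rewrite /dmap hderive_row //; apply: hderive_locally_cst => //.
apply: filterS (near_line (delta_mx 0 1) phi_boundary) => t H ht.
have {}H := H ht; rewrite H; last by rewrite !mxE x0_boundary mulr0 addr0.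
by rewrite /phi /= coordK ?inE // y0.
Qed.

Lemma dphi_normal : dmap iota k i b (delta_mx 0 0) 0 0 != 0.
Proof.
have [u] := transverse_dir; apply: contraNneq => E.
have := congr1 (fun z : 'rV[R]_4 => z 0 0) (dmap_linear Si dk di (u 0 0) (delta_mx 0 0) (u 0 1 *: delta_mx 0 1)).
rewrite (dmapE Si (_ *: _) dk di) -scalemxAl -(dmapE Si _ dk di) -row2E => ->.
by apply/eqP; rewrite [LHS]mxE [X in X + _]mxE [X in _ + X]mxE E dphi_tangent !mulr0 addr0.
Qed.

Lemma second_coord : exists j, dmap iota k i b (delta_mx 0 1) 0 j != 0.
Proof.
apply: contrapT => /forallNP H; have [_ inj] := Ei.1.
have : delta_mx 0 1 = 0 :> 'rV[R]_2.
  apply: (inj b k i dk di); rewrite (dmapE Si 0 dk di) mul0mx; apply/rowP => j.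
  by rewrite [RHS]mxE; apply/eqP; apply: contraT => /H.
by move=> /matrixP/(_ 0 1); rewrite !mxE /= => /eqP; rewrite oner_eq0.
Qed.

(** With g the radial primitive of the Liouville form on a half-disc of L around
    b, the function is - g composed with the retraction th \o kap \o coord i,
    where kap keeps the coordinates 0 and j of X and th inverts
    F = kap \o Phi, Phi being a smooth extension of iota in the charts across
    the boundary of L. *)
Lemma local_primitive_exists : exists U h, [/\ open U, U (iota b) & local_primitive U h].
Proof.
have [j jn] := second_coord.
have [U1 [Phi [oU1 U1x CPhi PhiE]]] := Sr.
have x00 := x0_boundary.
have dPhi u : 'D_u Phi x0 = dmap iota k i b u.
  by rewrite /dmap (hderiveE hx oU1 U1x (Ck_derivable (v := u) (CPhi 1%N) U1x) PhiE).
(* the two coordinates of X that restrict to coordinates on L *)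
pose sg (l : 'I_2) : 'I_4 := if l == 0 then 0 else j.
pose kap (z : 'rV[R]_4) : 'rV[R]_2 := \row_l z 0 (sg l).
pose F x := kap (Phi x).
have FE (l : 'I_2) : (fun y => F y 0 l) = (fun y => Phi y 0 (sg l)) by apply/funext => y; rewrite mxE.
have CF : smooth U1 F.
  by move=> n; apply/Ck_rowP => // l; rewrite FE; exact: (Ck_rowP _ _ oU1).1 (CPhi n) _.
(* the Jacobian is triangular: the first coordinate of X is constant along
   the boundary of L *)
have J0 : jac F x0 \in unitmx.
  have dF (l m : 'I_2) : jac F x0 l m = dmap iota k i b (delta_mx 0 l) 0 (sg m).
    by rewrite mxE FE -(derive_row _ (Ck_derivable (CPhi 1%N) U1x)) dPhi.
  rewrite unitmxE unitfE det22 !dF /sg /= dphi_tangent mulr0 subr0.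
  by rewrite mulf_neq0 // dphi_normal.
have [B [V [th [[oB Bx] [oV VFx] BU1 thF [Cth thP]]]]] := inverse_function oU1 CF U1x J0.
pose pb l := pullback w v iota k i (delta_mx 0 l).
have PB l : hsmooth (pb l) x0 by exact: (pullback_hsmooth Sw oW Vv Si dk di Wb).
have [U2 /choice[Bl HB]] := choice PB.
(* needed to see that the retraction preserves boundaries *)
have nD : \forall x \near x0, 'D_(delta_mx 0 0) (fun y => Phi y 0 0) x != 0.
  have C0 := (Ck_rowP _ _ oU1).1 (CPhi 1%N) 0.
  have cD : {for x0, continuous ('D_(delta_mx 0 0) (fun y => Phi y 0 0))}.
    exact: Ck_cont (Ck_derive _ C0) U1x.
  have nn : nbhs ('D_(delta_mx 0 0) (fun y => Phi y 0 0) x0) [set t : R | t != 0].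
    apply: open_nbhs_nbhs; split; first exact: open_neq.
    by rewrite /= -(derive_row _ (Ck_derivable (CPhi 1%N) U1x)) dPhi dphi_normal.
  exact: (cD _ nn).
have nU2 : \forall x \near x0, forall l, U2 l x.
  have nl l : \forall x \near x0, U2 l x by have [oU2 U2x _ _] := HB l; exact: open_nbhs_nbhs.
  exact: (@filter_forall _ _ _ (nbhs x0) _ nl).
have nB : \forall x \near x0, B x by exact: open_nbhs_nbhs.
have nall : \forall x \near x0, (B x /\ 'D_(delta_mx 0 0) (fun y => Phi y 0 0) x != 0) /\
    ((forall l, U2 l x) /\ ((hs x -> [/\ dom k (param k x), coord k (param k x) = x,
     dom i (iota (param k x)), W (iota (param k x)) & O (iota (param k x))]) /\
     (hs x -> x 0 0 = 0 -> phi x 0 0 = 0))).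
  exact: filterI (filterI nB nD) (filterI nU2 (filterI near_good phi_boundary)).
have [r /= r0 br] := (nbhs_ballP _ _).1 nall.
have {nall} bB x : ball x0 r x -> B x by move=> /br[[]].
have bD x : ball x0 r x -> 'D_(delta_mx 0 0) (fun y => Phi y 0 0) x != 0 by move=> /br[[]].
have bU2 x l : ball x0 r x -> U2 l x by move=> /br[_ []].
have bgood x : ball x0 r x -> hs x -> [/\ dom k (param k x), coord k (param k x) = x,
    dom i (iota (param k x)), W (iota (param k x)) & O (iota (param k x))].
  by move=> /br[_ [_ []]].
have bphi x : ball x0 r x -> hs x -> x 0 0 = 0 -> phi x 0 0 = 0 by move=> /br[_ [_ []]].
have ob := ball_open x0 r.
have CB l : smooth (ball x0 r) (Bl l).
  by move=> n; have [_ _ C _] := HB l; apply: Ck_sub (C n) => y; exact: bU2.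
have BlE l x : ball x0 r x -> hs x -> Bl l x = pb l x.
  by move=> bx h; have [_ _ _ ->] := HB l; rewrite //; exact: bU2.
have pbE (u x : 'rV[R]_2) : ball x0 r x -> hs x -> pullback w v iota k i u x = \sum_l u 0 l * Bl l x.
  move=> bx h; have [H1 H2 H3 H4 _] := bgood x bx h.
  have := pullback_linear w v Si H1 H3 u; rewrite H2 => ->.
  by apply: eq_bigr => l _; rewrite BlE.
pose g := radial_primitive x0 Bl.
have Cg : smooth (ball x0 r) g by exact: radial_primitive_smooth.
have hsray x (t : R) : hs x -> 0 <= t <= 1 -> hs (x0 + t *: (x - x0)).
  move=> h /andP[t0 t1] l l0; have -> : l = 0 by exact: val_inj.
  by rewrite !mxE x00 subr0 add0r mulr_ge0 // h.
have gD (x u : 'rV[R]_2) : ball x0 r x -> hs x -> 'D_u g x = pullback w v iota k i u x.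
  move=> bx h; rewrite (pbE u x bx h) /g; apply: radial_primitive_derive => // t t01 u1 u2.
  set z := x0 + t *: (x - x0).
  have bz : ball x0 r z by exact: ray_ball.
  have hz : hs z by exact: hsray.
  have [H1 H2 H3 H4 _] := bgood z bz hz.
  have Cs (u3 : 'rV[R]_2) : Ck 1 (ball x0 r) (fun y => \sum_l u3 0 l * Bl l y).
    by apply: Ck_sum => // l; apply: CkM => //; [exact: Ck_cst|exact: CB].
  have Es (u3 y : 'rV[R]_2) : ball x0 r y -> hs y -> \sum_l u3 0 l * Bl l y = pullback w v iota k i u3 y.
    by move=> byy hy; rewrite pbE.
  rewrite -(hderiveE hz ob bz (Ck_derivable (v := u1) (Cs u2) bz) (Es u2)).
  rewrite -(hderiveE hz ob bz (Ck_derivable (v := u2) (Cs u1) bz) (Es u1)).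
  have := pullback_closed Sw oW Vv Lv Si Lag H1 H3 H4 u1 u2.
  by rewrite H2.
have g0 (x : 'rV[R]_2) : ball x0 r x -> x 0 0 = 0 -> g x = 0.
  move=> bx xz; rewrite /g /radial_primitive big1 // => l _.
  have [->|l1] := eqVneq l 0; first by rewrite !mxE xz x00 subr0 mul0r.
  have El : l = 1 by case: l l1 => -[|[|//]] hl //= _; exact: val_inj.
  rewrite [X in _ * X](_ : _ = 0) ?mulr0 //; apply/eqP; rewrite -normr_le0.
  apply: int01_norm_le; first exact: ray_continuous01 (CB l 0) bx.
  move=> t t01; rewrite expr0 mul1r normr_le0; apply/eqP.
  set z := x0 + t *: (x - x0).
  have bz : ball x0 r z by exact: ray_ball.
  have z0 : z 0 0 = 0 by rewrite !mxE xz x00 subr0 mulr0 addr0.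
  have hz : hs z by move=> m m0; rewrite (_ : m = 0) ?z0 //; exact: val_inj.
  have [H1 H2 H3 H4 H5] := bgood z bz hz.
  rewrite BlE // /pb -H2 pullbackE //; apply: leg => //.
    by exists k, 0; split => //; rewrite H2.
  by rewrite El mxE.
pose h (p : X) : R := - g (th (kap (coord i p))).
have kapphi x : hs x -> U1 x -> kap (phi x) = F x by move=> hx' Ux; rewrite /F PhiE.
pose N0 := [set q : L | [/\ dom k q, dom i (iota q), ball x0 r (coord k q) & V (F (coord k q))]].
have nN0 : \forall q \near b, N0 q.
  have cF : {for x0, continuous F} := Ck_cont (CF 0) U1x.
  have nVF : \forall x \near x0, V (F x) by apply: cF; exact: open_nbhs_nbhs.
  have nb : \forall x \near x0, ball x0 r x by apply: open_nbhs_nbhs; split => //; exact: ballxx.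
  have nVb : \forall x \near x0, ball x0 r x /\ V (F x) by exact: filterI nb nVF.
  have m1 := coord_near dk nVb.
  have m2 := map_near Si (dom_near di).
  by apply: filterS (filterI (dom_near dk) (filterI m1 m2)) => q [? [[? ?] ?]].
have [_ [_ _ Top]] := Ei.
have [V' oV' V'E] := Top _ (open_interior N0).
pose U0 := [set p : X | [/\ dom i p, V (kap (coord i p)) & ball x0 r (th (kap (coord i p)))]].
have Ckap n : Ck n setT kap.
  apply/Ck_rowP; first exact: openT.
  move=> l; apply: (@Ck_ext _ _ _ _ (fun z : 'rV[R]_4 => z 0 (sg l))); first exact: openT.
    by move=> y _; rewrite mxE.
  by apply: Ck_coord; exact: openT.
have kapy : kap (coord i (iota b)) = F x0.
  by rewrite -kapphi // /phi /= coordK ?inE.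
have nU0 : \forall p \near iota b, U0 p.
  have ck : {for coord i (iota b), continuous kap} := Ck_cont (Ckap 0) I.
  have ct : {for F x0, continuous th} := Ck_cont (Cth 0) VFx.
  have nb : \forall y \near F x0, ball x0 r (th y).
    by apply: ct; rewrite thF //; apply: open_nbhs_nbhs; split => //; exact: ballxx.
  have nV : \forall y \near F x0, V y by exact: open_nbhs_nbhs.
  have m0 : \forall z \near coord i (iota b), V (kap z) /\ ball x0 r (th (kap z)).
    have nVb : \forall y \near kap (coord i (iota b)), V y /\ ball x0 r (th y).
      by rewrite kapy; exact: filterI nV nb.
    exact: ck nVb.
  by apply: filterS (filterI (dom_near di) (coord_near di m0)) => p [? []].
exists (interior U0 `&` V'), h; split.
- by apply: openI => //; exact: open_interior.
- split; first exact: nU0.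
  have : N0° b by exact: nN0.
  by rewrite V'E.
split.
- move=> p i' [/interior_subset[dp Vp bp] _] dp'.
  have SG : smooth_at (fun z => - g (th (kap z))) (coord i p).
    have S1 : smooth_at kap (coord i p) by exists setT => //; split => //; exact: openT.
    have S2 : smooth_at th (kap (coord i p)) by exists V.
    have S3 : smooth_at (fun x => - g x) (th (kap (coord i p))).
      by exists (ball x0 r) => // n; apply: CkN => //; exact: Cg.
    exact: (smooth_at_comp (smooth_at_comp_row S1 S2) S3).
  have Sp : hsmooth (h \o param i) (coord i p).
    apply: hsmooth_eq (smooth_at_hsmooth SG).
    by apply: filterS (chart_near dp) => z H hz; rewrite /h /= (H hz).2.
  by have [] := hderive_pullback (h := h) (id_smooth X) (delta_mx 0 0) dp' dp Sp.
- move=> p [/interior_subset[dp Vp bp] _] bdp.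
  rewrite /h; set P := th (kap (coord i p)) in bp *.
  have [BP FP] := thP _ Vp.
  have Phi0 : Phi P 0 0 = 0.
    have := congr1 (fun r : 'rV[R]_2 => r 0 0) FP; rewrite /F !mxE /sg /= => ->.
    exact: boundary_coord.
  (* Let P' be the point of the boundary of L below P.  The first coordinate of
     Phi vanishes at P and at P', and its normal derivative is nonzero on the
     segment between them. *)
  suff P0 : P 0 0 = 0 by rewrite g0 ?oppr0.
  pose P' := P - P 0 0 *: delta_mx 0 0.
  have P'0 : P' 0 0 = 0 by rewrite !mxE eqxx mulr1 subrr.
  have hP' : hs P' by move=> m m0; rewrite (_ : m = 0) ?P'0 //; exact: val_inj.
  have bP' : ball x0 r P'.
    move: bp; rewrite -ball_normE /=; apply: le_lt_trans; apply: row_norm_le => // l.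
    have [->|l1] := eqVneq l 0; first by rewrite mxE [X in _ + X]mxE P'0 x00 subr0 normr0.
    apply: le_trans (row_norm_coord _ l).
    by rewrite !mxE (negbTE l1) mulr0 subr0.
  have Phi'0 : Phi P' 0 0 = 0 by rewrite PhiE ?bphi //; exact/BU1/bB.
  have C0 := (Ck_rowP _ _ oU1).1 (CPhi 1%N) 0.
  have EP : P = P' + P 0 0 *: delta_mx 0 0 by rewrite /P' subrK.
  have bs (t : R) : 0 <= t <= 1 -> ball x0 r (P' + t *: (P 0 0 *: delta_mx 0 0)).
    move=> t01; have := ball_segment bp bP' t01.
    by rewrite [P - P'](_ : _ = P 0 0 *: delta_mx 0 0) // /P' opprB addrC subrK.
  have dd (t : R) : 0 <= t <= 1 ->
     derivable (fun y => Phi y 0 0) (P' + t *: (P 0 0 *: delta_mx 0 0)) (P 0 0 *: delta_mx 0 0) /\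
     'D_(P 0 0 *: delta_mx 0 0) (fun y => Phi y 0 0) (P' + t *: (P 0 0 *: delta_mx 0 0)) =
      P 0 0 * 'D_(delta_mx 0 0) (fun y => Phi y 0 0) (P' + t *: (P 0 0 *: delta_mx 0 0)).
    move=> t01; have d1 := Ck_derivable (v := delta_mx 0 0) C0 (BU1 _ (bB _ (bs t t01))).
    by have [] := derivable_scale (P 0 0) d1.
  have [t t01] := mvt_dir (fun t t01 => (dd t t01).1).
  have [_ ->] := dd t t01; rewrite -EP Phi0 Phi'0 subrr => /esym/eqP.
  by rewrite mulf_eq0 (negbTE (bD _ (bs t t01))) orbF => /eqP.
- move=> q k' i' [_ V'q] dk' di' u.
  have nN : N0° q by rewrite V'E.
  have [dq diq bq VFq] := interior_subset nN.
  have hq := coord_hs dq.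
  have nE : \forall x \near coord k q, hs x -> - g x = (h \o iota \o param k) x.
    have nN' : \forall q' \near q, N0 q' by exact: nN.
    apply: filterS (filterI (param_near dq nN') (chart_near dq)) => x [H1 H2] hx'.
    have [H3 H4] := H2 hx'; have [H5 H6 H7 H8] := H1 hx'; rewrite H4 in H7 H8.
    have bBx : B x := bB x H7.
    by rewrite -[RHS]/(- g (th (kap (phi x)))) (kapphi x hx' (BU1 x bBx)) thF.
  have Sg : smooth_at (fun x => - g x) (coord k q).
    by exists (ball x0 r) => // n; apply: CkN => //; exact: Cg.
  have Sh := hsmooth_eq nE (smooth_at_hsmooth Sg).
  have dg v' := Ck_derivable (v := v') (Cg 1%N) bq.
  have Eh (u' : 'rV[R]_2) : hderive (h \o iota \o param k) (coord k q) u' =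
     - w i (iota q) (v i (iota q)) (dmap iota k i q u').
    rewrite -(hderive_eq u' hq nE (smooth_at_hsmooth Sg)).
    rewrite (hderiveE (g := - g) hq ob bq (derivableN (dg u'))) //.
    rewrite (deriveN (dg u')) gD // pullbackE //.
  have [_ E1] := hderive_pullback (h := h \o iota) (id_smooth L) u dk' dq Sh.
  apply: (etrans E1); apply: (etrans (Eh _)); congr (- _).
  rewrite (dmap_transition _ Si dq dk' diq).
  have [_ _ wT _] := Fw; rewrite (wT i i' _ _ _ diq di').
  rewrite (dmap_transition_r _ Si dk' diq di'); congr (w i' (iota q) _ _).
  have Wq : W (iota q).
    have Eq : param k (coord k q) = q by rewrite coordK ?inE.
    by have [_ _ _ H _] := bgood _ bq hq; rewrite Eq in H.
  by have [vT _] := Vv; exact: esym (vT i i' _ Wq diq di').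
Qed.

End At.

End LocalPrimitive.

(** * Gluing local primitives *)

(** The finite sequences, directed by inclusion, form the filter to which the
    covering characterization of compactness applies. *)
Lemma finite_subcover (T : topologicalType) (C : set T) (D : T -> set T) : compact C ->
  (forall x, C x -> nbhs x (D x)) -> exists s : seq T, forall y, C y -> exists2 x, x \in s & D x y.
Proof.
move=> /compact_near_coveringP cC nD.
pose F : set_system (seq T) := [set S | exists s0 : seq T, forall s : seq T, {subset s0 <= s} -> S s].
have FF : Filter F.
  split.
  - by exists [::].
  - move=> A B [s1 H1] [s2 H2]; exists (s1 ++ s2) => s H; split.
      by apply: H1 => x xs; apply: H; rewrite mem_cat xs.
    by apply: H2 => x xs; apply: H; rewrite mem_cat xs orbT.
  - by move=> A B AB [s0 H]; exists s0 => s /H /AB.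
have [x Cx|s0 H] := cC _ F (fun (s : seq T) y => exists2 x, x \in s & D x y) FF; last first.
  by exists s0 => y Cy; exact: H Cy.
exists (D x, [set s : seq T | x \in s]); first split; first exact: nD.
  by exists [:: x] => s H /=; apply: H; rewrite inE.
by move=> [y s] [Dy xs]; exists x.
Qed.

(** The manifold, being compact and Hausdorff, is regular.  So the support can be
    confined to a neighbourhood of y whose closure K lies inside one chart, and
    extension by zero is smooth. *)
Lemma manifold_bump n (M : manifold R n) (U : set M) y : compact [set: M] -> open U -> U y ->
  exists K (rho : M -> R),
   [/\ closed K /\ K `<=` U, forall p, 0 <= rho p, \forall p \near y, 0 < rho p,
       forall p, ~ K p -> rho p = 0 &
       forall p (i : index M), dom i p -> hsmooth (rho \o param i) (coord i p)].
Proof.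
move=> cM oU Uy; have [i di] := dom_cover y; have hx := coord_hs di.
have nU : nbhs y (U `&` dom i) by apply: filterI; [exact: open_nbhs_nbhs|exact: dom_near].
have [B nB BU] := compact_regular (carrier_hausdorff (m := M)) cM filterT nU.
have nB' := param_near di nB.
have [e /= e0 be] := (nbhs_ballP _ _).1 nB'.
pose r := e / 2; have r0 : 0 < r by rewrite divr_gt0.
set x := coord i y in hx be *.
pose rho p := if pselect (dom i p) then bump x r (coord i p) else 0.
have rhoE p : dom i p -> rho p = bump x r (coord i p) by rewrite /rho; case: pselect.
have rhoB p : rho p != 0 -> B p.
  rewrite /rho; case: pselect => dp; last by rewrite eqxx.
  move=> /(bump_support r0) h; rewrite -[p](coordK (i := i)) ?inE //.
  apply: be (coord_hs dp); rewrite -ball_normE /= distrC.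
  by apply: le_lt_trans h _; rewrite /r ltr_pdivrMr // ltr_pMr // ltr1n.
have rho0 p : ~ closure B p -> rho p = 0.
  by move=> nK; apply/eqP; apply: contra_notT nK => /rhoB /subset_closure.
have rhoS p : dom i p -> hsmooth (rho \o param i) (coord i p).
  move=> dp; apply: (@hsmooth_eq _ _ (bump x r)).
    by apply: filterS (chart_near dp) => z H hz; have [H1 H2] := H hz; rewrite /= rhoE // H2.
  by exists setT, (bump x r); split => //; [exact: openT|exact: bump_smooth].
exists (closure B), rho; split.
- by split; [exact: closed_closure|move=> p /BU[]].
- by move=> p; rewrite /rho; case: pselect => // dp; exact: bump_ge0.
- have nb : \forall z \near x, 0 < bump x r z.
    have c : {for x, continuous (bump x r)} := Ck_cont (bump_smooth x r 0) I.
    have nn : nbhs (bump x r x) [set t : R | 0 < t].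
      by apply: open_nbhs_nbhs; split; [exact: open_gt|exact: bump_center].
    exact: (c _ nn).
  have nd := coord_near di nb.
  by apply: filterS (filterI nd (dom_near di)) => p [b dp]; rewrite rhoE.
- exact: rho0.
move=> p j dj; have [dp|ndp] := pselect (dom i p).
  by have [] := hderive_pullback (h := rho) (id_smooth M) 0 dj dp (rhoS p dp).
have nK : ~ closure B p by move=> /BU[].
have nn : \forall q \near p, ~ closure B q.
  by apply: open_nbhs_nbhs; split => //; exact/closed_openC/closed_closure.
apply: (hsmooth_eq _ (hsmooth_cst 0 _)).
by apply: filterS (param_near dj nn) => z H hz; rewrite /= rho0 //; exact: H.
Qed.
Lemma closed_range m n (M : manifold R m) (N : manifold R n) (f : M -> N) :
  compact [set: M] -> smooth_map f -> closed (range f).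
Proof.
move=> cM Sf; apply: compact_closed; first exact: carrier_hausdorff.
by apply: continuous_compact cM; apply: continuous_subspaceT; exact: Sf.1.
Qed.

Section Gluing.
Context {X : manifold R 4} (w : form2 X) (v : vfield X).
Hypothesis cX : compact [set: X].
Context {L : manifold R 2} (iota : L -> X).
Hypothesis cL : compact [set: L].
Hypothesis Ei : smooth_embedding iota.
Let Si : smooth_map iota := Ei.1.1.
Notation primitive := (local_primitive w v iota).

(** The range of iota is closed, so the zero function is a solution away from
    it. *)
Lemma primitive_off y : ~ range iota y -> exists U h, [/\ open U, U y & primitive U h].
Proof.
move=> ny; exists (~` range iota), (fun=> 0); split => //.
  exact: closed_openC (closed_range cL Si).
split => // [p i _ _|q k i nq]; first exact: hsmooth_cst.
by case: nq; exists q.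
Qed.

(** If y = iota b, both functions vanish at y and have the same derivative on a
    half-disc of L around b, which is convex.  That they agree on L near y in
    the topology of X uses that iota is a topological embedding. *)
Lemma primitive_unique y U1 h1 U2 h2 : boundary (M:=X) y ->
  open U1 -> U1 y -> primitive U1 h1 -> open U2 -> U2 y -> primitive U2 h2 ->
  \forall p \near y, range iota p -> h1 p = h2 p.
Proof.
move=> by_ oU1 U1y [H1 B1 D1] oU2 U2y [H2 B2 D2].
have [[b _ by'] | ny] := pselect (range iota y); last first.
  have nn : \forall p \near y, ~ range iota p.
    by apply: open_nbhs_nbhs; split => //; exact: closed_openC (closed_range cL Si).
  by apply: filterS nn.
rewrite -{}by' in by_ U1y U2y *.
have [k dk] := dom_cover b; have [i di] := dom_cover (iota b).
have hx := coord_hs dk; set x0 := coord k b in hx.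
have S1 := (hderive_pullback (h := h1) Si 0 dk di (H1 _ _ U1y di)).1.
have S2 := (hderive_pullback (h := h2) Si 0 dk di (H2 _ _ U2y di)).1.
have [U [g1 [g2 [oU Ux [C1 C2] E]]]] := hsmooth_common S1 S2.
have n0 : \forall q \near b, [/\ dom k q, dom i (iota q), U1 (iota q) & U2 (iota q)].
  have m1 := map_near Si (dom_near di).
  have m2 := map_near Si (open_nbhs_nbhs (conj oU1 U1y)).
  have m3 := map_near Si (open_nbhs_nbhs (conj oU2 U2y)).
  by apply: filterS (filterI (dom_near dk) (filterI m1 (filterI m2 m3))) => q [? [? []]].
have n1 : \forall x \near x0, U x /\ (hs x -> coord k (param k x) = x /\
    [/\ dom k (param k x), dom i (iota (param k x)), U1 (iota (param k x)) & U2 (iota (param k x))]).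
  apply: filterS (filterI (open_nbhs_nbhs (conj oU Ux)) (filterI (param_near dk n0) (chart_near dk))).
  by move=> x [Ux' [P1 P2]]; split => // hx'; split; [exact: (P2 hx').2|exact: P1].
have [r /= r0 br] := (nbhs_ballP _ _).1 n1.
have eqD x : ball x0 r x -> hs x -> h1 (iota (param k x)) = h2 (iota (param k x)).
  move=> bx hx'; have Es z : ball x0 r z -> hs z -> g1 z = h1 (iota (param k z)) /\ g2 z = h2 (iota (param k z)).
    by move=> bz hz; exact: E _ (br _ bz).1 hz.
  have dz (g : 'rV[R]_2 -> R) z : smooth U g -> ball x0 r z -> derivable g z (x - x0).
    by move=> Cg bz; exact: Ck_derivable (Cg 1%N) (br _ bz).1.
  have bs (s : R) : 0 <= s <= 1 -> ball x0 r (x0 + s *: (x - x0)) by exact: ray_ball.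
  have [s s01] := mvt_dir (f := g1 - g2) (x := x0) (v := x - x0)
     (fun s s01 => derivableB (dz g1 _ C1 (bs s s01)) (dz g2 _ C2 (bs s s01))).
  set z := x0 + s *: (x - x0).
  have bz : ball x0 r z := bs s s01.
  have hz : hs z by exact: hs_segment.
  have [_ /(_ hz)[Ez [dkz diz U1z U2z]]] := br z bz.
  rewrite (deriveB (dz g1 z C1 bz) (dz g2 z C2 bz)).
  have oz (g : 'rV[R]_2 -> R) h : smooth U g -> (forall y, U y -> hs y -> g y = (h \o iota \o param k) y) ->
      'D_(x - x0) g z = hderive (h \o iota \o param k) z (x - x0).
    by move=> Cg Eg; rewrite (hderiveE hz oU (br z bz).1 (dz g z Cg bz) Eg).
  rewrite (oz g1 h1 C1) => [|t Ut ht]; last exact: (E t Ut ht).1.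
  rewrite (oz g2 h2 C2) => [|t Ut ht]; last exact: (E t Ut ht).2.
  have F1 := D1 _ k i U1z dkz diz (x - x0); have F2 := D2 _ k i U2z dkz diz (x - x0).
  rewrite Ez in F1 F2; rewrite F1 F2 subrr [x0 + _]addrC subrK.
  have [e1 e2] := Es x bx hx'; have [e3 e4] := E x0 Ux hx.
  rewrite -[(g1 - g2) x]/(g1 x - g2 x) -[(g1 - g2) x0]/(g1 x0 - g2 x0) e1 e2 e3 e4 /=.
  rewrite /x0 coordK ?inE // (B1 _ U1y by_) (B2 _ U2y by_) !subr0.
  exact: subr0_eq.
have [_ [_ _ Top]] := Ei.
have nb : \forall x \near x0, ball x0 r x by apply: open_nbhs_nbhs; split; [exact: ball_open|exact: ballxx].
pose N := [set q | dom k q /\ ball x0 r (coord k q)].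
have nN : N° b.
  have m := coord_near dk nb.
  by apply: filterS (filterI (dom_near dk) m).
have [V oV VE] := Top _ (open_interior N).
have Vb : V (iota b) by rewrite VE in nN.
apply: filterS (open_nbhs_nbhs (conj oV Vb)) => p Vp [q _ qp]; rewrite -{}qp in Vp *.
have : N° q by rewrite VE.
move=> /interior_subset[dq bq].
by have := eqD _ bq (coord_hs dq); rewrite coordK ?inE.
Qed.
Lemma near_all_seq (T : topologicalType) (I : eqType) (s : seq I) (y : T) (P : I -> T -> Prop) :
  (forall a, a \in s -> \forall p \near y, P a p) -> \forall p \near y, forall a, a \in s -> P a p.
Proof.
elim: s => [_|a s IH H]; first by near=> p.
have n1 := H a (mem_head _ _).
have n2 := IH (fun b bs => H b (@mem_behead _ (a :: s) b bs)).
apply: filterS (filterI n1 n2) => p [Pa Ps] b; rewrite inE => /orP[/eqP->//|].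
exact: Ps.
Unshelve. all: by end_near. Qed.

(** The quotient of the sums of rho_a h_a and of rho_a.  Near a given point only
    those a matter whose patch contains the point; the corresponding h_a agree
    on L, so on L the quotient is equal to any one of them. *)
Lemma primitive_glue (C : set X) : compact C -> C `<=` boundary (M:=X) ->
  (forall y, C y -> exists U h, [/\ open U, U y & primitive U h]) ->
  exists W h, [/\ open W, C `<=` W & primitive W h].
Proof.
move=> cC bC loc.
(* d = ((U, h), (K, rho)); off C the empty patch is used *)
pose patch (d : (set X * (X -> R)) * (set X * (X -> R))) :=
  [/\ open d.1.1 /\ primitive d.1.1 d.1.2, closed d.2.1 /\ d.2.1 `<=` d.1.1,
      forall p, 0 <= d.2.2 p, forall p, ~ d.2.1 p -> d.2.2 p = 0 &
      forall p (i : index X), dom i p -> hsmooth (d.2.2 \o param i) (coord i p)].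
have H y : exists d, patch d /\ (C y -> \forall p \near y, 0 < d.2.2 p).
  have [Cy|nCy] := pselect (C y).
    have [U [h [oU Uy Ph]]] := loc y Cy.
    by have [K [rho [HK r0 ry rK rS]]] := manifold_bump cX oU Uy; exists (U, h, (K, rho)).
  exists (set0, fun=> 0, (set0, fun=> 0)); split => //; split => //=.
  - by split; [exact: open0|split].
  - by split; [exact: closed0|].
  - by move=> p i _; exact: hsmooth_cst.
have {H}[d Hd] := choice H.
pose U a := (d a).1.1; pose h a := (d a).1.2; pose K a := (d a).2.1; pose rho a := (d a).2.2.
have oU a : open (U a) by have [[[H _] _ _ _ _] _] := Hd a.
have PU a : primitive (U a) (h a) by have [[[]]] := Hd a.
have cK a : closed (K a) by have [[_ []]] := Hd a.
have KU a : K a `<=` U a by have [[_ []]] := Hd a.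
have r0 a p : 0 <= rho a p by have [[_ _ H _ _] _] := Hd a; exact: H.
have rK a p : ~ K a p -> rho a p = 0 by have [[_ _ _ H _] _] := Hd a; exact: H.
have rS a p (i : index X) : dom i p -> hsmooth (rho a \o param i) (coord i p).
  by have [[_ _ _ _ H] _] := Hd a; exact: H.
have rC y : C y -> nbhs y [set p | 0 < rho y p]°.
  by move=> Cy; apply: nbhs_interior; have [_] := Hd y; exact.
have [s cov] := finite_subcover cC rC.
pose S p := \sum_(a <- s | a \in s) rho a p.
pose T p := \sum_(a <- s | a \in s) rho a p * h a p.
pose hh p := (S p)^-1 * T p.
pose G a0 := [set p | [/\ 0 < S p, U a0 p & forall a, a \in s ->
   (U a p /\ (range iota p -> h a p = h a0 p)) \/ ~ K a p]].
have nG y : C y -> exists a0, nbhs y (G a0).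
  move=> Cy; have [a0 a0s Dy] := cov y Cy; exists a0.
  have ra0 : \forall p \near y, 0 < rho a0 p by exact: Dy.
  have Ua0 : U a0 y.
    by apply: KU; apply: contrapT => /rK E; have := nbhs_singleton ra0; rewrite E ltxx.
  have nU0 : \forall p \near y, U a0 p by apply: open_nbhs_nbhs.
  have nA : \forall p \near y, forall a, a \in s -> (U a p /\ (range iota p -> h a p = h a0 p)) \/ ~ K a p.
    apply: near_all_seq => a _; have [Ka|nKa] := pselect (K a y).
      have nA := primitive_unique (bC _ Cy) (oU a) (KU _ _ Ka) (PU a) (oU a0) Ua0 (PU a0).
      have nUa : \forall p \near y, U a p by apply: open_nbhs_nbhs; split => //; exact: KU.
      by apply: filterS (filterI nA nUa) => p [? ?]; left.
    have nn : \forall p \near y, ~ K a p.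
      by apply: open_nbhs_nbhs; split => //; exact/closed_openC/cK.
    by apply: filterS nn => p ?; right.
  apply: filterS (filterI ra0 (filterI nU0 nA)) => p [rp [Up HA]]; split => //.
  rewrite /S (big_rem a0) //= a0s ltr_wpDr //.
  by apply: sumr_ge0.
exists (\bigcup_a0 (G a0)°), hh; split.
- by apply: bigcup_open => a _; exact: open_interior.
- by move=> y /nG[a0 Ga]; exists a0.
split.
- move=> p i [a0 _ /interior_subset[S0 U0 HA]] di; have hx := coord_hs di.
  have SS : hsmooth (S \o param i) (coord i p) by apply: hsmooth_sum => a _; exact: rS.
  have ST : hsmooth (T \o param i) (coord i p).
    apply: hsmooth_sum => a /HA[[Ua _]|nKa].
      apply: hsmoothM; first exact: rS.
      by have [PS _ _] := PU a; exact: PS.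
    have nn : \forall q \near p, ~ K a q.
      by apply: open_nbhs_nbhs; split => //; exact/closed_openC/cK.
    apply: (hsmooth_eq _ (hsmooth_cst 0 _)).
    by apply: filterS (param_near di nn) => z nK hz; rewrite rK ?mul0r //; exact: nK.
  apply: hsmoothM ST; apply: hsmoothV => //.
  by rewrite /= coordK ?inE // gt_eqF.
- move=> p [a0 _ /interior_subset[S0 U0 HA]] bp; rewrite /hh /T big1 ?mulr0 // => a /HA[[Ua _]|nKa].
    by have [_ PB _] := PU a; rewrite PB ?mulr0.
  by rewrite rK ?mul0r.
move=> q k i [a0 _ Gq] dk di u.
have [_ U0 _] := interior_subset Gq.
have [P1 _ P3] := PU a0; rewrite -(P3 q k i U0 dk di u).
have nGq : \forall p \near iota q, G a0 p by exact: Gq.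
have nE : \forall x \near coord k q, hs x -> (h a0 \o iota \o param k) x = (hh \o iota \o param k) x.
  apply: filterS (param_near dk (map_near Si nGq)) => x H hx; have {H}[S0 _ HA] := H hx.
  rewrite /= /hh; set p := iota (param k x) in S0 HA *.
  have -> : T p = S p * h a0 p.
    rewrite /T /S mulr_suml; apply: eq_bigr => a /HA[[_ E]|nKa]; last by rewrite rK ?mul0r.
    by rewrite E //; exists (param k x).
  by rewrite mulKf // gt_eqF.
have S0 := (hderive_pullback (h := h a0) Si u dk di (P1 _ _ U0 di)).1.
by rewrite (hderive_eq u (coord_hs dk) nE S0).
Qed.
End Gluing.

(** * One end of the cobordism *)

Section OneEnd.
Context {X : manifold R 4} (w : form2 X).
Hypothesis Sw : symplectic w.
Hypothesis cX : compact [set: X].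
Context {L : manifold R 2} (iota : L -> X).
Hypothesis cL : compact [set: L].
Hypothesis Ei : smooth_embedding iota.
Hypothesis Lag : lagrangian w iota.
Hypothesis Tr : transverse_to_boundary iota.
Hypothesis bL : forall b, boundary (M:=L) b -> boundary (M:=X) (iota b).
Variables (s : R) (Y : manifold R 3) (o : orientation Y) (xi : plane_field Y) (f : Y -> X).
Hypothesis cY : closed_manifold Y.
Hypothesis Sf : smooth_map f.
Hypothesis fb : range f `<=` boundary (M:=X).
Context {K : manifold R 1} (oK : orientation K) (j : K -> Y) (bm : K -> L).
Hypothesis Leg : legendrian_link xi oK j.
Hypothesis Ibm : immersion bm.
Hypothesis bmb : range bm `<=` boundary (M:=L).
Hypothesis bmj : iota \o bm =1 f \o j.
Variable O : set X.
Hypotheses (oO : open O) (fO : range f `<=` O).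
Hypothesis bO : forall b, boundary (M:=L) b -> O (iota b) -> range bm b.

Let Si : smooth_map iota := Ei.1.1.
Let Fw : is_form2 w := let: And3 H _ _ := Sw in H.

(** A vector tangent to the boundary of L comes from a vector tangent to the
    Legendrian link, on which the contact form induced by w(v, .) vanishes.
    The open set O separates this end of X from the other one. *)
Lemma contract_legendrian W v : liouville_near w s o xi f W v ->
  forall b (k : index L) (i : index X) (u : 'rV[R]_2), boundary (M:=L) b -> O (iota b) ->
  dom k b -> dom i (iota b) -> u 0 0 = 0 ->
  w i (iota b) (v i (iota b)) (dmap iota k i b u) = 0.
Proof.
move=> [_ _ _ _ [a [_ aC] aE]] b k i u bb Ob.
have [q _ <-] := bO bb Ob; move=> dk di u0.
have [e dq] := dom_cover q; have [m dm] := dom_cover (j q).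
have [[_ bK] _ [[Sj _] _] xiK] := Leg.
have [Sbm inj] := Ibm.
pose c : 'rV[R]_1 := delta_mx 0 0.
have di' : dom i (f (j q)) by have := bmj q; rewrite /= => <-.
set D := dmap bm e k q c.
have D0 : D 0 0 = 0 by exact: (dmap_boundary bK Sbm bmb).
have D1 : D 0 1 != 0.
  apply/eqP => D1; have : c = 0.
    apply: (inj q e k dq dk); rewrite -[LHS]/D (dmapE Sbm 0 dq dk) mul0mx.
    by rewrite [D]row2E D0 D1 !scale0r addr0.
  by move=> /matrixP/(_ 0 0); rewrite !mxE eqxx /= => /eqP; rewrite oner_eq0.
have uD : u = (u 0 1 / D 0 1) *: D.
  have [uE DE] : u = u 0 1 *: delta_mx 0 1 /\ D = D 0 1 *: delta_mx 0 1.
    by split; rewrite {1}[LHS]row2E ?u0 ?D0 scale0r add0r.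
  by rewrite {1}uE {2}DE scalerA divfK.
have EZ : dmap iota k i (bm q) u = (u 0 1 / D 0 1) *: dmap iota k i (bm q) D.
  by rewrite uD !(dmapE Si _ dk di) -scalemxAl -uD.
have E1 : dmap iota k i (bm q) D = dmap (iota \o bm) e i q c by rewrite (dmap_comp c Sbm Si dq dk di).
have E2 : dmap (f \o j) e i q c = dmap f m i (j q) (dmap j e m q c) by rewrite (dmap_comp c Sj Sf dq dm di').
have E3 : dmap (iota \o bm) e i q c = dmap (f \o j) e i q c by rewrite (funext bmj).
have A0 : a m (j q) (dmap j e m q c) = 0.
  have [xiE _] := aC m (j q) I dm; have := xiK q e m c dq dm; by rewrite xiE.
rewrite EZ form2Zr // E1 E3 E2 -[iota (bm q)]/((iota \o bm) q) bmj /= -(aE _ _ _ _ dm di') A0.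
by rewrite mulr0.
Qed.

Lemma liouville_tangent_end :
  (exists W v, liouville_near w s o xi f W v) ->
  exists W v, liouville_near w s o xi f W v /\ tangent_to iota W v.
Proof.
move=> [W [v Lv]]; have leg := contract_legendrian Lv.
have [[oW fW] Vv Lie _ _] := Lv.
have cf : compact (range f).
  apply: continuous_compact cY.1; apply: continuous_subspaceT; exact: Sf.1.
have loc y : range f y -> exists U h, [/\ open U, U y & local_primitive w v iota U h].
  move=> fy; have [[b _ E]|ny] := pselect (range iota y); last exact: primitive_off.
  rewrite -{}E in fy *; have [k dk] := dom_cover b; have [i di] := dom_cover (iota b).
  exact: (local_primitive_exists Sw oW Vv Lie Ei Lag Tr bL oO leg dk di (fb fy) (fW _ fy) (fO fy)).
have [W' [h [oW' fW' [P1 P2 P3]]]] := primitive_glue cX cL Ei cf fb loc.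
have oI : open (W' `&` W) by exact: openI.
have Q1 p (i : index X) : (W' `&` W) p -> dom i p -> hsmooth (h \o param i) (coord i p).
  by move=> [Wp _]; exact: P1.
have Q2 p : (W' `&` W) p -> boundary (M:=X) p -> h p = 0 by move=> [Wp _]; exact: P2.
have Q3 q (k : index L) (i : index X) : (W' `&` W) (iota q) -> dom k q -> dom i (iota q) -> forall u,
  hderive (h \o iota \o param k) (coord k q) u = - w i (iota q) (v i (iota q)) (dmap iota k i q u).
  by move=> [Wp _]; exact: P3.
have fI : range f `<=` W' `&` W by move=> y fy; split; [exact: fW'|exact: fW].
exists (W' `&` W), (fun i p => v i p + hamiltonian w h i p); split.
  exact: (modified_liouville_near Sw Lv cY Sf fb oI (@subIsetr _ _ _) fI Q1 Q2).
exact: (modified_tangent Sw Ei.1 Lag Q1 Q3).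
Qed.

End OneEnd.

End LiouvilleTangency.

Theorem lemma1p1 (R : realType)
  (X : manifold R 4) (w : form2 X)
  (Ym Yp : manifold R 3) (om : orientation Ym) (op : orientation Yp)
  (xim : plane_field Ym) (xip : plane_field Yp) (im : Ym -> X) (ip : Yp -> X)
  (hX : strong_symplectic_cobordism w om op xim xip im ip)
  (Km Kp : manifold R 1) (oKm : orientation Km) (oKp : orientation Kp)
  (jm : Km -> Ym) (jp : Kp -> Yp)
  (hKm : legendrian_link xim oKm jm) (hKp : legendrian_link xip oKp jp)
  (L : manifold R 2) (oL : orientation L) (iota : L -> X)
  (bm : Km -> L) (bp : Kp -> L)
  (hL : lagrangian_cobordism w iota oL im ip oKm oKp jm jp bm bp) :
  (exists (Wm : set X) (vm : vfield X),
     liouville_near w (-1)%R om xim im Wm vm /\ tangent_to iota Wm vm) /\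
  (exists (Wp : set X) (vp : vfield X),
     liouville_near w 1%R op xip ip Wp vp /\ tangent_to iota Wp vp).
Proof.
have [[cX Sw] [[cYm _ _] [cYp _ _]] [[[Im _] [Ip _]] disj bX _ _] Vm Vp] := hX.
have [[cL _] Ei Lag Tr [[[[Ibm _] [Ibp _]] _ bdL _ _] Em Ep]] := hL.
have imb : range im `<=` boundary (M:=X) by rewrite -bX; exact: subsetUl.
have ipb : range ip `<=` boundary (M:=X) by rewrite -bX; exact: subsetUr.
have bmb : range bm `<=` boundary (M:=L) by rewrite -bdL; exact: subsetUl.
have bpb : range bp `<=` boundary (M:=L) by rewrite -bdL; exact: subsetUr.
have bL b : boundary (M:=L) b -> boundary (M:=X) (iota b).
  rewrite -bdL => -[[q _ <-]|[q _ <-]].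
    by have := Em q; rewrite /= => ->; apply: imb; exists (jm q).
  by have := Ep q; rewrite /= => ->; apply: ipb; exists (jp q).
have oC (Y : manifold R 3) (f : Y -> X) : closed_manifold Y -> smooth_map f -> open (~` range f).
  by move=> [cY _] Sf; exact: closed_openC (closed_range cY Sf).
(* removing the other end from X leaves only the boundary of L over this end *)
split.
- have bO b : boundary (M:=L) b -> (~` range ip) (iota b) -> range bm b.
    rewrite -bdL => -[//|[q _ <-]] []; have := Ep q; rewrite /= => ->; by exists (jp q).
  have fO : range im `<=` ~` range ip by apply/disjoints_subset.
  exact: (liouville_tangent_end Sw cX cL Ei Lag Tr bL cYm Im.1 imb hKm Ibm bmb Em (oC _ _ cYp Ip.1) fO bO Vm).
- have bO b : boundary (M:=L) b -> (~` range im) (iota b) -> range bp b.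
    rewrite -bdL => -[[q _ <-]|//] []; have := Em q; rewrite /= => ->; by exists (jm q).
  have fO : range ip `<=` ~` range im by apply/disjoints_subset; rewrite setIC.
  exact: (liouville_tangent_end Sw cX cL Ei Lag Tr bL cYp Ip.1 ipb hKp Ibp bpb Ep (oC _ _ cYm Im.1) fO bO Vp).
Qed.
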